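(* Let $p\in\mathbb{R}^3$ be a base point with non-trivial stabilizer in a full cubic group $G$, and suppose that $Gp$ is not an orbit with smaller stabilizer for any other crystallographic group; that is, there are no crystallographic group $G'\neq G$ and point $p'$ with $G'p'=Gp$ such that the stabilizer of $p'$ in $G'$ has smaller order than the stabilizer of $p$ in $G$. Then $G$ is one of the groups $F4_132$ or $F\frac{2}{d}\overline{3}$, and the Dirichlet stereohedra of this orbit, i.e. the Voronoi cells of $Gp$, have at most twelve facets.
   Context: A crystallographic group is a discrete subgroup of $\mathrm{Isom}(\mathbb{R}^3)$ containing a full-rank lattice of translations. Let $R_1$ be the group generated by the rotations of order three about all lines with directions $(\pm1,\pm1,\pm1)$ through points of $\mathbb{Z}^3$. A full cubic group is, up to similarity, a crystallographic group $G$ such that the subgroup generated by all rotations of order three in $G$ equals $R_1$. $F4_132$ and $F\frac2d\overline3$ denote crystallographic types in international notation (numbers 210 and 203, the latter also written $Fd\overline3$). The stabilizer of $p$ in $G$ is $\{g\in G: gp=p\}$. The Dirichlet stereohedron of $p$ is the Voronoi cell $\{x: |x-p|\le|x-q| \text{ for all } q\in Gp\}$. Facets are 2-dimensional faces. *)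

(* Defs.v *)
From HB Require Import structures.
From mathcomp Require Import all_boot all_order all_algebra.
From mathcomp Require Import all_classical all_reals all_analysis.

Set Implicit Arguments.
Unset Strict Implicit.
Unset Printing Implicit Defensive.

Import Order.TTheory GRing.Theory Num.Theory.
Import numFieldNormedType.Exports.

Local Open Scope classical_set_scope.
Local Open Scope ring_scope.

(* Points of Euclidean 3-space are row vectors, so linear maps act on the
   right.  The library norm on 'rV[R]_3 is the sup norm; the Euclidean metric
   is therefore introduced separately (both induce the same topology). *)

Definition dot (R : realType) (u v : 'rV[R]_3) : R :=
  \sum_(i < 3) u 0 i * v 0 i.

Definition edist (R : realType) (x y : 'rV[R]_3) : R :=
  Num.sqrt (dot (x - y) (x - y)).

(* Distance-preserving maps of R^3 are automatically bijective. *)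
Definition isometry (R : realType) (g : 'rV[R]_3 -> 'rV[R]_3) : Prop :=
  forall x y, edist (g x) (g y) = edist x y.

Definition isom_subgroup (R : realType)
    (G : set ('rV[R]_3 -> 'rV[R]_3)) : Prop :=
  [/\ (forall g, G g -> isometry g),
      G idfun,
      (forall g h, G g -> G h -> G (g \o h)) &
      (forall g, G g -> exists2 h, G h & cancel g h /\ cancel h g)].

(* The subgroup of Isom(R^3) generated by S.  Only meaningful when S consists
   of isometries (otherwise the intersection is over the empty family). *)
Definition generated (R : realType) (S : set ('rV[R]_3 -> 'rV[R]_3)) :
    set ('rV[R]_3 -> 'rV[R]_3) :=
  smallest (@isom_subgroup R) S.

Definition translation (R : realType) (v : 'rV[R]_3) :
    'rV[R]_3 -> 'rV[R]_3 :=
  fun x => x + v.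

(* Isom(R^3) carries the compact-open topology, which is also the topology of
   pointwise convergence on isometries. *)
Definition discrete_subgroup (R : realType)
    (G : set ('rV[R]_3 -> 'rV[R]_3)) : Prop :=
  isom_subgroup G /\
  G `<=` @isolated {compact-open, 'rV[R]_3 -> 'rV[R]_3} G.

(* The rows of B are a basis of the full-rank lattice of translations. *)
Definition crystallographic (R : realType)
    (G : set ('rV[R]_3 -> 'rV[R]_3)) : Prop :=
  discrete_subgroup G /\
  exists2 B : 'M[R]_3, B \in unitmx &
    forall z : 'rV[int]_3, G (translation (map_mx intr z *m B)).

Definition rotation_about (R : realType) (c u : 'rV[R]_3)
    (g : 'rV[R]_3 -> 'rV[R]_3) : Prop :=
  exists A : 'M[R]_3,
    [/\ A *m A^T = 1%:M, \det A = 1, u *m A = u &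
        forall x, g x = c + (x - c) *m A].

Definition order3 (T : Type) (g : T -> T) : Prop :=
  g <> idfun /\ g \o g \o g = idfun.

Definition odd_subgroup (R : realType) (G : set ('rV[R]_3 -> 'rV[R]_3)) :
    set ('rV[R]_3 -> 'rV[R]_3) :=
  generated [set g | [/\ G g, order3 g &
    exists c u : 'rV[R]_3, u != 0 /\ rotation_about c u g]].

Definition R1 (R : realType) : set ('rV[R]_3 -> 'rV[R]_3) :=
  generated [set g | order3 g /\
    exists (c : 'rV[int]_3) (u : 'rV[R]_3),
      (forall i, u 0 i = 1 \/ u 0 i = -1) /\
      rotation_about (map_mx intr c) u g].
Arguments R1 : clear implicits.

Definition similarity (R : realType) (f : 'rV[R]_3 -> 'rV[R]_3) : Prop :=
  exists2 k : R, 0 < k & forall x y, edist (f x) (f y) = k * edist x y.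

(* f G f^-1, where f' is meant to be the inverse of f. *)
Definition conjugate (R : realType) (f f' : 'rV[R]_3 -> 'rV[R]_3)
    (G : set ('rV[R]_3 -> 'rV[R]_3)) : set ('rV[R]_3 -> 'rV[R]_3) :=
  [set f \o g \o f' | g in G].

Definition full_cubic (R : realType)
    (G : set ('rV[R]_3 -> 'rV[R]_3)) : Prop :=
  crystallographic G /\
  exists f f' : 'rV[R]_3 -> 'rV[R]_3,
    [/\ similarity f, cancel f f', cancel f' f &
        odd_subgroup (conjugate f f' G) = R1 R].

Definition orbit_of (R : realType) (G : set ('rV[R]_3 -> 'rV[R]_3))
    (p : 'rV[R]_3) : set 'rV[R]_3 :=
  [set g p | g in G].

Definition stabilizer (R : realType) (G : set ('rV[R]_3 -> 'rV[R]_3))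
    (p : 'rV[R]_3) : set ('rV[R]_3 -> 'rV[R]_3) :=
  [set g | G g /\ g p = p].

Definition card_lt (T U : Type) (A : set T) (B : set U) : Prop :=
  ~~ (B #<= A)%card.

(* The 230 crystallographic types are the classes of crystallographic groups
   under conjugation by orientation-preserving affine maps. *)
Definition same_type (R : realType)
    (G H : set ('rV[R]_3 -> 'rV[R]_3)) : Prop :=
  exists (M : 'M[R]_3) (b : 'rV[R]_3), 0 < \det M /\
    conjugate (fun x => x *m M + b) (fun y => (y - b) *m invmx M) G = H.

Definition vec3 (R : realType) (a b c : R) : 'rV[R]_3 :=
  \row_(i < 3) [:: a; b; c]`_i.

Definition triplet (R : realType) (f : R -> R -> R -> 'rV[R]_3) :
    'rV[R]_3 -> 'rV[R]_3 :=
  fun v => f (v 0 0) (v 0 1) (v 0 2).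

(* Generators of the face-centred group F23 (No. 196), in the conventional
   coordinates of the International Tables. *)
Definition F23_generators (R : realType) : set ('rV[R]_3 -> 'rV[R]_3) :=
  [set` [:: translation (vec3 1 0 0);
            translation (vec3 0 1 0);
            translation (vec3 0 0 1);
            translation (vec3 0 2^-1 2^-1);
            translation (vec3 2^-1 0 2^-1);
            triplet (fun x y z => vec3 (- x) (- y) z);
            triplet (fun x y z => vec3 (- x) y (- z));
            triplet (fun x y z => vec3 z x y)] : seq ('rV[R]_3 -> 'rV[R]_3)].

(* No. 210, origin at 23.  The Tables list the two binary rotations with an
   extra centring translation, which does not change the generated group. *)
Definition F4132 (R : realType) : set ('rV[R]_3 -> 'rV[R]_3) :=
  generated (@F23_generators R `|`
    [set triplet (fun x y z => vec3 (y + 3 / 4) (x + 1 / 4) (- z + 3 / 4))]).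
Arguments F4132 : clear implicits.

(* No. 203 (also written Fd-3), origin choice 1, at 23. *)
Definition Fd3bar (R : realType) : set ('rV[R]_3 -> 'rV[R]_3) :=
  generated (@F23_generators R `|`
    [set triplet (fun x y z =>
           vec3 (- x + 1 / 4) (- y + 1 / 4) (- z + 1 / 4))]).
Arguments Fd3bar : clear implicits.

Definition voronoi_cell (R : realType) (S : set 'rV[R]_3) (q : 'rV[R]_3) :
    set 'rV[R]_3 :=
  [set x | forall q', S q' -> edist x q <= edist x q'].

Definition aff_independent (R : realType) (d : nat)
    (x : 'I_d.+1 -> 'rV[R]_3) : Prop :=
  row_free (\matrix_(i < d) (x (lift ord0 i) - x ord0)).

Definition contains_aff_independent (R : realType) (F : set 'rV[R]_3)
    (d : nat) : Prop :=
  exists2 x : 'I_d.+1 -> 'rV[R]_3, aff_independent x & forall i, F (x i).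

(* The affine hull of F has dimension d. *)
Definition has_dimension (R : realType) (F : set 'rV[R]_3) (d : nat) : Prop :=
  contains_aff_independent F d /\ ~ contains_aff_independent F d.+1.

(* F is cut out of P by a valid linear inequality. *)
Definition is_face (R : realType) (P F : set 'rV[R]_3) : Prop :=
  exists (u : 'rV[R]_3) (c : R),
    (forall x, P x -> dot u x <= c) /\ F = P `&` [set x | dot u x = c].

(* For a 3-dimensional cell P the trivial choice u = 0 gives P itself or the
   empty set, neither of which is 2-dimensional. *)
Definition facets (R : realType) (P : set 'rV[R]_3) : set (set 'rV[R]_3) :=
  [set F | is_face P F /\ has_dimension F 2].

(* Main.v *)
Require Import Defs.
From mathcomp Require Import all_boot all_order all_algebra.
From mathcomp Require Import all_classical all_reals all_analysis.
From mathcomp Require Import finmap ring lra zify.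
(* all_analysis shadows [edist] *)
Import Defs.

(** R1 is the group F23 with translation lattice D3 (integral vectors with even
    sum) and chiral tetrahedral point group. Up to a similarity G contains and
    normalizes R1, so it lies between R1 and its normalizer Im-3m.

    A subgroup G' with G = G' Stab(p) that does not contain Stab(p) has the same
    orbit and a smaller stabilizer. Kernels of characters and a subgroup of
    index 3 therefore force Stab(p) to consist of half-turns about lines parallel
    to the coordinate axes, and p becomes (x,0,0) or (x,0,1/2) with 2x not an
    integer. In the second case, and in the first one as long as the translation
    parts of G form a lattice, the orbit of p is also the orbit of a group with
    a single threefold direction that acts freely on it. What remains is
    R1 extended by one coset mapping D3 to D3 + (±1/2,±1/2,±1/2), that is
    F4_132 or Fd-3.

    The orbit then has one point on every edge of the cubic lattices Z^3 and
    Z^3 + (1/2,1/2,1/2). The Voronoi cell of p among the points on the edges of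
    Z^3 is a square bipyramid around the edge of p, independently of x; it is
    covered by the bipyramids around the four edges of the other lattice that
    bound its equator. So 8 + 4 neighbours determine the cell. *)

Set Implicit Arguments.
Unset Strict Implicit.
Unset Printing Implicit Defensive.

Import Order.TTheory GRing.Theory Num.Theory.
Import numFieldNormedType.Exports.

Local Open Scope classical_set_scope.
Local Open Scope ring_scope.

(** * Signed coordinate permutations with half-integral translations *)

(** The orbit of (x,0,0) depends on the group only through the classes in Z/4, modulo D3, of its
    translation parts, since R1 already permutes the axes and their directions. A group with a much
    smaller point group, not contained in G, can thus have the same orbit; here minimality among all
    crystallographic groups is used, not only among subgroups. The class is not a homomorphism: an
    element with an odd number of signs negates odd classes, so it can have an odd class and a
    square of class 0. Only in this way do the class sets {0,1} and {0,3} arise; they are not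
    subgroups of Z/4 and so escape the rhombohedral groups. They are mirror images of each other;
    class 3 is kept because the tabulated generators have it. Maps are encoded by a permutation,
    signs and an integral doubled translation, which turns the group theory into finite case
    distinctions and congruences. The coordinates of R1 are twice those of the tables, where the
    cube of the face-centred lattice has edge 1. *)

Lemma I3_ind (P : 'I_3 -> Prop) : P 0 -> P 1 -> P 2 -> forall i, P i.
Proof.
move=> P0 P1 P2 [[|[|[|//]]] lti].
- by rewrite (_ : Ordinal lti = 0) //; apply: val_inj.
- by rewrite (_ : Ordinal lti = 1) //; apply: val_inj.
- by rewrite (_ : Ordinal lti = 2) //; apply: val_inj.
Qed.

Lemma I3D11 : 1 + 1 = 2 :> 'I_3. Proof. exact: val_inj. Qed.
Lemma I3D12 : 1 + 2 = 0 :> 'I_3. Proof. exact: val_inj. Qed.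
Lemma I3D21 : 2 + 1 = 0 :> 'I_3. Proof. exact: val_inj. Qed.
Lemma I3D22 : 2 + 2 = 1 :> 'I_3. Proof. exact: val_inj. Qed.
Lemma I3N1 : - 1 = 2 :> 'I_3. Proof. exact: val_inj. Qed.
Lemma I3N2 : - 2 = 1 :> 'I_3. Proof. exact: val_inj. Qed.

Definition I3E :=
  (I3N1, I3N2, I3D11, I3D12, I3D21, I3D22, add0r (1 : 'I_3), add0r (2 : 'I_3),
   addr0 (1 : 'I_3), addr0 (2 : 'I_3), addr0 (0 : 'I_3), oppr0 ('I_3)).

Lemma big_I3 (T : Type) (idx : T) (op : Monoid.law idx) (F : 'I_3 -> T) :
  \big[op/idx]_(i < 3) F i = op (op (F 0) (F 1)) (F 2).
Proof.
rewrite !big_ord_recr big_ord0 /= Monoid.mul1m.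
by congr (op (op (F _) (F _)) (F _)); apply: val_inj.
Qed.

Lemma row3P (T : Type) (u v : 'rV[T]_3) :
  u 0 0 = v 0 0 -> u 0 1 = v 0 1 -> u 0 2 = v 0 2 -> u = v.
Proof. by move=> e0 e1 e2; apply/rowP; apply: I3_ind. Qed.

(* All six permutations of the coordinates are dihedral maps of Z/3. *)
Definition dih (m : bool) (k i : 'I_3) : 'I_3 := if m then k - i else k + i.

(* [Op m k e t] encodes the affine map [act]: all elements of the normalizer
   Im-3m of R1 have this form, with doubled translation part [t]. *)
Record op := Op {
  omu : bool; ok : 'I_3; oe : {ffun 'I_3 -> bool}; ot : 'rV[int]_3 }.

Definition osg (d : op) : 'I_3 -> 'I_3 := dih (omu d) (ok d).

Definition act (R : realType) (d : op) (v : 'rV[R]_3) : 'rV[R]_3 :=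
  \row_i ((-1) ^+ oe d i * v 0 (osg d i) + (ot d 0 i)%:~R / 2).

Definition one_op := Op false 0 [ffun=> false] 0.

Definition mul_op (d d' : op) :=
  Op (omu d (+) omu d') (dih (omu d') (ok d') (ok d))
     [ffun i => oe d i (+) oe d' (osg d i)]
     (\row_i (ot d 0 i + (-1) ^+ oe d i * ot d' 0 (osg d i))).

Definition inv_sg (d : op) : 'I_3 -> 'I_3 :=
  dih (omu d) (if omu d then ok d else - ok d).

Definition inv_op (d : op) :=
  Op (omu d) (if omu d then ok d else - ok d)
     [ffun i => oe d (inv_sg d i)]
     (\row_i (- ((-1) ^+ oe d (inv_sg d i) * ot d 0 (inv_sg d i)))).

Lemma osg_mul d d' i : osg (mul_op d d') i = osg d' (osg d i).
Proof.
rewrite /osg /dih /=; case: (omu d); case: (omu d') => /=;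
 by rewrite ?opprD ?opprK ?addrA.
Qed.

Lemma inv_sgK d i : osg d (inv_sg d i) = i.
Proof.
rewrite /osg /inv_sg /dih; case: (omu d); first by rewrite opprB addrC subrK.
by rewrite addrA subrr add0r.
Qed.

Lemma osgK d i : inv_sg d (osg d i) = i.
Proof.
rewrite /osg /inv_sg /dih; case: (omu d); first by rewrite opprB addrC subrK.
by rewrite addrA addNr add0r.
Qed.

Lemma act_mul (R : realType) d d' (v : 'rV[R]_3) :
  act (mul_op d d') v = act d (act d' v).
Proof.
apply/rowP => i; rewrite !mxE osg_mul ffunE signr_addb.
rewrite intrD rmorphM /= rmorph_sign; by field.
Qed.

Lemma act_one (R : realType) (v : 'rV[R]_3) : act one_op v = v.
Proof.
apply/rowP => i; rewrite !mxE /= ffunE /osg /dih /= add0r expr0; by field.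
Qed.

Lemma act_inv (R : realType) d (v : 'rV[R]_3) : act (inv_op d) (act d v) = v.
Proof.
apply/rowP => i; rewrite !mxE !ffunE.
have -> : osg (inv_op d) i = inv_sg d i by [].
rewrite inv_sgK rmorphN rmorphM /= rmorph_sign.
have := sqrr_sign R (oe d (inv_sg d i)).
set s := (-1) ^+ _ => s2; rewrite -[RHS]mul1r -[in RHS]s2.
by field.
Qed.

Lemma act_invr (R : realType) d (v : 'rV[R]_3) : act d (act (inv_op d) v) = v.
Proof.
apply/rowP => i; rewrite !mxE !ffunE.
have -> : osg (inv_op d) (osg d i) = inv_sg d (osg d i) by [].
rewrite osgK rmorphN rmorphM /= rmorph_sign.
have := sqrr_sign R (oe d i).
set s := (-1) ^+ _ => s2.
transitivity (s ^+ 2 * v 0 i + (1 - s ^+ 2) * ((ot d 0 i)%:~R / 2)); first by field.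
by rewrite s2 subrr mul0r addr0 mul1r.
Qed.

Lemma op_eq d d' : omu d = omu d' -> ok d = ok d' ->
  (forall i, oe d i = oe d' i) -> (forall i, ot d 0 i = ot d' 0 i) -> d = d'.
Proof.
case: d d' => m k e t [m' k' e' t'] /= -> -> eqe eqt.
by congr (Op _ _ _ _); [apply/ffunP | apply/rowP].
Qed.

Lemma mul_opA : associative mul_op.
Proof.
move=> a b c; apply: op_eq => [||i|i]; rewrite ?mxE ?ffunE ?osg_mul /=.
- exact: addbA.
- have := osg_mul b c (ok a).
  by rewrite /osg /dih /= => <-; case: (omu b); case: (omu c);
     rewrite ?addr0 ?subr0.
- by rewrite addbA.
- rewrite ?mxE ?ffunE ?signr_addb.
  ring.
Qed.

Lemma mul1op d : mul_op one_op d = d.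
Proof.
apply: op_eq => [||i|i] //=; rewrite ?mxE ?ffunE /osg /dih /= ?add0r ?expr0 ?mul1r //.
by case: (omu d); rewrite ?subr0 ?addr0.
Qed.

Lemma mulop1 d : mul_op d one_op = d.
Proof.
apply: op_eq => [||i|i] //=; rewrite ?addbF ?add0r ?mxE ?ffunE ?addbF //=.
by rewrite ?mxE mulr0 addr0.
Qed.

Lemma mulVop d : mul_op (inv_op d) d = one_op.
Proof.
apply: op_eq => [||i|i] //=; rewrite ?addbb ?mxE ?ffunE //=.
- by rewrite /dih; case: (omu d); rewrite ?subrr ?addNr.
- by rewrite -[osg _ _]/(inv_sg d i) addbb.
- by rewrite -[osg _ _]/(inv_sg d i) addNr.
Qed.

Lemma mulopV d : mul_op d (inv_op d) = one_op.
Proof.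
apply: op_eq => [||i|i] //=; rewrite ?addbb ?mxE ?ffunE //=.
- by rewrite /dih; case: (omu d); rewrite ?subrr ?addNr.
- by rewrite osgK addbb.
- by rewrite osgK mulrN mulrA -expr2 sqrr_sign mul1r subrr.
Qed.

Lemma mulKop d d' : mul_op (inv_op d) (mul_op d d') = d'.
Proof. by rewrite mul_opA mulVop mul1op. Qed.

Lemma mulKVop d d' : mul_op d (mul_op (inv_op d) d') = d'.
Proof. by rewrite mul_opA mulopV mul1op. Qed.

Lemma mulopK d d' : mul_op (mul_op d' d) (inv_op d) = d'.
Proof. by rewrite -mul_opA mulopV mulop1. Qed.

Lemma sgE (R : pzRingType) (b : bool) (x : R) :
  (-1) ^+ b * x = if b then - x else x.
Proof. by case: b; rewrite ?expr0 ?expr1 ?mul1r ?mulN1r. Qed.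

Lemma mul_otE a b i : ot (mul_op a b) 0 i =
  ot a 0 i + (if oe a i then - ot b 0 (osg a i) else ot b 0 (osg a i)).
Proof. by rewrite mxE sgE. Qed.

Lemma mul_oeE a b i : oe (mul_op a b) i = oe a i (+) oe b (osg a i).
Proof. by rewrite ffunE. Qed.

(* t / 2 lies in the lattice generated by Z^3 and (1/2,1/2,1/2). *)
Definition bcc (d : op) : bool :=
  (modz (ot d 0 0) 2 == modz (ot d 0 1) 2) &&
  (modz (ot d 0 0) 2 == modz (ot d 0 2) 2).

(* The class of t / 2 in the quotient Z/4 of the body-centred lattice by the
   lattice D3 of integral vectors with even sum. *)
Definition cl (d : op) : int := modz (ot d 0 0 + ot d 0 1 + ot d 0 2) 4.

(* [alpha], [rho] and [omu] are characters of the normalizer of R1. *)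
Definition alpha (d : op) : bool := oe d 0 (+) oe d 1 (+) oe d 2.

Definition rho (d : op) : bool := modz (ot d 0 0) 2 == 1.

Lemma osgP d : [\/ [\/ (osg d 0, osg d 1, osg d 2) = (0, 1, 2),
                       (osg d 0, osg d 1, osg d 2) = (1, 2, 0) |
                       (osg d 0, osg d 1, osg d 2) = (2, 0, 1)],
                   (osg d 0, osg d 1, osg d 2) = (0, 2, 1),
                   (osg d 0, osg d 1, osg d 2) = (1, 0, 2) |
                   (osg d 0, osg d 1, osg d 2) = (2, 1, 0)].
Proof.
rewrite /osg /dih; case: (omu d); move: (ok d); apply: I3_ind; rewrite !I3E.
- by constructor 2.
- by constructor 3.
- by constructor 4.
- by constructor 1; constructor 1.
- by constructor 1; constructor 2.
- by constructor 1; constructor 3.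
Qed.

Ltac osg_cases d :=
  case: (osgP d) => [[]|||] [? ? ?];
  repeat match goal with H : osg d _ = _ |- _ => rewrite ?H; clear H end.

Lemma alpha_mul a b : alpha (mul_op a b) = alpha a (+) alpha b.
Proof.
rewrite /alpha !mul_oeE; osg_cases a;
  by case: (oe a 0); case: (oe a 1); case: (oe a 2);
     case: (oe b 0); case: (oe b 1); case: (oe b 2).
Qed.

Lemma bcc_mul a b : bcc a -> bcc b -> bcc (mul_op a b).
Proof.
rewrite /bcc !mul_otE; osg_cases a;
  case: (oe a 0); case: (oe a 1); case: (oe a 2); lia.
Qed.

Lemma rho_mul a b : bcc b -> rho (mul_op a b) = rho a (+) rho b.
Proof.
by rewrite /bcc /rho !mul_otE; osg_cases a; case: (oe a 0); lia.
Qed.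

(** All entries of the doubled translation of [b] have the parity [rho b]. Negating an even entry
    leaves the sum unchanged modulo 4, negating an odd one shifts it by 2. So only an odd number of
    signs acting on an odd class matters, and there the shift by 2 is negation. *)
Lemma cl_mul a b : bcc b -> cl (mul_op a b) =
  ((if rho b && alpha a then cl a - cl b else cl a + cl b) %% 4)%Z.
Proof.
rewrite /bcc /cl /rho /alpha !mul_otE; osg_cases a;
  case: (oe a 0); case: (oe a 1); case: (oe a 2);
  rewrite /= ?andbT ?andbF //; try (case: ifP); lia.
Qed.

Lemma rho_cl d : bcc d -> rho d = (((cl d) %% 2)%Z == 1).
Proof. rewrite /bcc /rho /cl; lia. Qed.

Lemma cl_bound d : 0 <= cl d < 4.
Proof. rewrite /cl; lia. Qed.

Lemma bcc_one : bcc one_op.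
Proof. by rewrite /bcc !mxE. Qed.

Lemma inv_sgE d i : inv_sg d i = osg (inv_op d) i.
Proof. by []. Qed.

Lemma inv_otE d i : ot (inv_op d) 0 i =
  if oe d (osg (inv_op d) i) then ot d 0 (osg (inv_op d) i)
  else - ot d 0 (osg (inv_op d) i).
Proof. by rewrite mxE sgE -inv_sgE; case: ifP; rewrite ?opprK. Qed.

Lemma bcc_inv d : bcc d -> bcc (inv_op d).
Proof.
rewrite /bcc !inv_otE; osg_cases (inv_op d);
  case: (oe d 0); case: (oe d 1); case: (oe d 2); lia.
Qed.

Lemma alpha_one : alpha one_op = false.
Proof. by rewrite /alpha !ffunE. Qed.

Lemma alpha_inv d : alpha (inv_op d) = alpha d.
Proof.
have := alpha_mul d (inv_op d); rewrite mulopV alpha_one.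
by case: (alpha d); case: (alpha (inv_op d)).
Qed.

Lemma rho_one : rho one_op = false.
Proof. by rewrite /rho !mxE. Qed.

Lemma rho_inv d : bcc d -> rho (inv_op d) = rho d.
Proof.
move=> Nd; have := rho_mul d (bcc_inv Nd); rewrite mulopV rho_one.
by case: (rho d); case: (rho (inv_op d)).
Qed.

Lemma cl_one : cl one_op = 0.
Proof. by rewrite /cl !mxE. Qed.

Definition opgroup (D : set op) : Prop :=
  [/\ D one_op, forall a b, D a -> D b -> D (mul_op a b) &
      forall a, D a -> D (inv_op a)].

(* The group R1, see [R1_F23op]. *)
Definition F23op : set op :=
  [set d | [/\ bcc d, cl d = 0, alpha d = false & omu d = false]].

Definition bcc_ops : set op := [set d | bcc d].

Lemma F23op_mul a b : F23op a -> F23op b -> F23op (mul_op a b).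
Proof.
move=> [Na ca aa ma] [Nb cb ab mb]; split; rewrite ?bcc_mul //.
- by rewrite cl_mul // ca cb aa andbF.
- by rewrite alpha_mul aa ab.
- by rewrite /= ma mb.
Qed.

(** As [a] has class 0 and no sign parity, the class is computed as for [mul_op n (inv_op n)], where
    it vanishes. *)
Lemma F23op_conj n a : bcc n -> F23op a ->
  F23op (mul_op n (mul_op a (inv_op n))).
Proof.
move=> Nn [Na ca aa ma]; have Nv := bcc_inv Nn.
have Nav := bcc_mul Na Nv.
split; rewrite ?bcc_mul //.
- have := cl_mul n Nv; rewrite mulopV cl_one => h.
  rewrite cl_mul // (cl_mul a Nv) ca aa andbF add0r.
  rewrite (rho_mul a Nv) (rho_cl Na) ca /=.
  move: h; have := cl_bound (inv_op n); have := cl_bound n; case: ifP => _; lia.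
- by rewrite !alpha_mul aa alpha_inv; case: (alpha n).
- by rewrite /= ma; case: (omu n).
Qed.

Lemma F23op_inv a : F23op a -> F23op (inv_op a).
Proof.
move=> [Na ca aa ma]; have Nv := bcc_inv Na; split => //; last first.
  by rewrite alpha_inv.
have := cl_mul a Nv; rewrite mulopV cl_one ca aa andbF add0r.
have := cl_bound (inv_op a); lia.
Qed.

Lemma F23op_one : F23op one_op.
Proof. by split; rewrite ?bcc_one ?cl_one ?alpha_one. Qed.

Lemma opgroup_F23op : opgroup F23op.
Proof. by split; [exact: F23op_one | exact: F23op_mul | exact: F23op_inv]. Qed.

Definition trop (t : 'rV[int]_3) : op := Op false 0 [ffun=> false] t.

Definition vec3z (a b c : int) : 'rV[int]_3 := \row_i [:: a; b; c]`_i.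

Definition linop (m : bool) (k : 'I_3) (a b c : bool) : op :=
  Op m k [ffun i : 'I_3 => nth false [:: a; b; c] i] 0.

Lemma osg_trop t i : osg (trop t) i = i.
Proof. by rewrite /osg /dih /= add0r. Qed.

Lemma trop_mul t u : mul_op (trop t) (trop u) = trop (t + u).
Proof.
apply: op_eq => [||i|i]; first by [].
- by rewrite /= addr0.
- by rewrite mul_oeE !ffunE.
- by rewrite mul_otE osg_trop ffunE mxE.
Qed.

Lemma trop_inv t : inv_op (trop t) = trop (- t).
Proof.
have := mulKop (trop t) (trop (- t)); rewrite trop_mul subrr => <-.
by rewrite -[trop 0]/one_op mulop1.
Qed.

Lemma op_decomp d : d = mul_op (trop (ot d)) (linop (omu d) (ok d) (oe d 0) (oe d 1) (oe d 2)).
Proof.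
apply: op_eq => [||i|i]; first by [].
- by rewrite /= /dih addr0 subr0; case: (omu d).
- rewrite mul_oeE osg_trop !ffunE.
  by move: i; apply: I3_ind.
- by rewrite mul_otE osg_trop ffunE mxE addr0.
Qed.

Lemma vec3z_E a b c :
  (vec3z a b c 0 0 = a) * (vec3z a b c 0 1 = b) * (vec3z a b c 0 2 = c).
Proof. by rewrite !mxE. Qed.

Lemma linop_oeE m k a b c : (oe (linop m k a b c) 0 = a) *
  (oe (linop m k a b c) 1 = b) * (oe (linop m k a b c) 2 = c).
Proof. by rewrite !ffunE. Qed.

Lemma trop_multiple (D : set op) t (n : int) :
  opgroup D -> D (trop t) -> D (trop (t *~ n)).
Proof.
move=> [D1 DM DV] Dt.
have Dn (m : nat) : D (trop (t *+ m)).
  by elim: m => [//|m IH]; rewrite mulrS -trop_mul; apply: DM.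
case: n => m; first by rewrite -pmulrn.
by rewrite NegzE mulrNz -pmulrn -trop_inv; apply: DV.
Qed.

Lemma row_mulrz (t : 'rV[int]_3) n i : (t *~ n) 0 i = t 0 i * n.
Proof.
by case: n => m; rewrite -?mulrzz ?NegzE ?mulrNz -?pmulrn ?mxE ?mulmxnE.
Qed.

Lemma F23op_gen (D : set op) : opgroup D ->
  D (linop false 1 false false false) -> D (linop false 0 true true false) ->
  D (trop (vec3z 0 2 2)) -> F23op `<=` D.
Proof.
move=> gD Dc Dv Dt d [Nd cd ad md]; have [D1 DM DV] := gD.
have conjc t : D (trop t) -> D (trop (vec3z (t 0 1) (t 0 2) (t 0 0))).
  move=> Dt'; have := DM _ _ Dc (DM _ _ Dt' (DV _ Dc)).
  congr D; apply: op_eq => [||i|i]; first by [].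
  - exact: val_inj.
  - by rewrite !ffunE; move: i; apply: I3_ind.
  - by move: i; apply: I3_ind; rewrite !mul_otE inv_otE !ffunE !mxE oppr0 addr0 add0r
        /osg /dih /= !I3E.
have Dt1 := conjc _ Dt; have Dt2 := conjc _ Dt1.
rewrite !vec3z_E in Dt1 Dt2.
rewrite (op_decomp d) md; apply: (DM).
  (* Solves (2y+2z, 2x+2z, 2x+2y) = [ot d]. The divisions are exact, since class 0 makes all entries
     even and their sum divisible by 4. *)
  pose x : int := divz (ot d 0 1 + ot d 0 2 - ot d 0 0) 4.
  pose y : int := divz (ot d 0 0 + ot d 0 2 - ot d 0 1) 4.
  pose z : int := divz (ot d 0 0 + ot d 0 1 - ot d 0 2) 4.
  have -> : ot d = vec3z 0 2 2 *~ x + (vec3z 2 0 2 *~ y + vec3z 2 2 0 *~ z).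
    by apply: row3P; rewrite [RHS]mxE [X in _ + X]mxE !row_mulrz !vec3z_E /= /x /y /z; move: Nd cd;
      rewrite /bcc /cl; lia.
  rewrite -!trop_mul; apply: (DM); first exact: trop_multiple.
  by apply: (DM); apply: trop_multiple.
have Dv1 : D (linop false 0 false true true).
  have := DM _ _ (DV _ Dc) (DM _ _ Dv Dc); congr D.
  apply: op_eq => [||i|i]; first by [].
  - exact: val_inj.
  - by rewrite !ffunE; move: i; apply: I3_ind.
  - by rewrite !mul_otE inv_otE !mxE; do 3 case: ifP => _; rewrite ?oppr0 ?addr0.
have Dlin k : D (linop false k false false false).
  have Dc2 := DM _ _ Dc Dc.
  move: k; apply: I3_ind => //; first last.
    move: Dc2; congr D; apply: op_eq => [||i|i] //.
    - by rewrite !ffunE; move: i; apply: I3_ind.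
    - by rewrite !mul_otE !mxE; case: ifP.
  move: D1; congr D; apply: op_eq => [||i|i] //.
  by rewrite !ffunE; move: i; apply: I3_ind.
have Dsg a b c : a (+) b (+) c = false -> D (linop false 0 a b c).
  case: a b c => [] [] [] // _.
  move: (DM _ _ Dv Dv1); congr D; apply: op_eq => [||i|i] //.
  - exact: val_inj.
  - by rewrite !ffunE; move: i; apply: I3_ind.
  - by rewrite !mul_otE !mxE; case: ifP.
have -> : linop false (ok d) (oe d 0) (oe d 1) (oe d 2) =
    mul_op (linop false 0 (oe d 0) (oe d 1) (oe d 2))
           (linop false (ok d) false false false).
  apply: op_eq => [||i|i] //.
  - by rewrite /= /dih addr0.
  - by rewrite mul_oeE !ffunE; move: i; apply: I3_ind; rewrite addbF.
  - by rewrite !mul_otE !mxE; case: ifP.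
exact: DM (Dsg _ _ _ ad) (Dlin _).
Qed.

(** * Stabilizers that cannot be decreased *)

Lemma proper_card_lt_choice (T : choiceType) (A B : set T) :
  finite_set B -> A `<=` B -> A <> B -> card_lt A B.
Proof.
move=> finB leAB neAB; have finA := sub_finite_set leAB finB.
apply/negP => leBA; apply: neAB.
have /(fcard_eq finA finB) eqAB : (A #= B)%card.
  by apply/card_eqPle; split => //; apply: subset_card_le.
apply: (fset_set_inj finA finB); apply/eqP.
by rewrite eqEfcard eqAB leqnn andbT -fset_set_sub //; apply/asboolP.
Qed.

Lemma proper_card_lt (T : Type) (A B : set T) :
  finite_set B -> A `<=` B -> A <> B -> card_lt A B.
Proof. exact: (@proper_card_lt_choice {classic T}). Qed.

Definition opstab (R : realType) (D : set op) (P : 'rV[R]_3) : set op :=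
  [set d | D d /\ act d P = P].

Definition oporbit (R : realType) (D : set op) (P : 'rV[R]_3) : set 'rV[R]_3 :=
  [set act d P | d in D].

Definition has_lattice (D : set op) : Prop :=
  forall t, F23op (trop t) -> D (trop t).

(** Only competitors given by ops, with the same base point, are kept. Each becomes a
    crystallographic group of the original space, so the hypothesis of the theorem yields this form,
    see [minimal_stab_pull]. *)
Definition minimal_stab (R : realType) (D : set op) (P : 'rV[R]_3) : Prop :=
  forall D', opgroup D' -> D' `<=` bcc_ops -> has_lattice D' ->
  oporbit D' P = oporbit D P -> ~ card_lt (opstab D' P) (opstab D P).

Definition linear_part (d : op) : bool * 'I_3 * {ffun 'I_3 -> bool} :=
  (omu d, ok d, oe d).

Lemma act_linear_part_inj (R : realType) (v : 'rV[R]_3) d d' :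
  linear_part d = linear_part d' -> act d v = act d' v -> d = d'.
Proof.
case: d d' => m k e t [m' k' e' t'] [-> -> ->] /rowP eqa.
congr Op; apply/rowP => i; have := eqa i; rewrite !mxE /= => /addrI.
have n2 : (2 : R)^-1 != 0 by rewrite invr_eq0 pnatr_eq0.
by move/(mulIf n2)/intr_inj.
Qed.

(** An op fixing [P] is determined by its linear part, for which there are finitely many choices.
    Finiteness makes a proper subset of the stabilizer strictly smaller. *)
Lemma finite_opstab (R : realType) (D : set op) (P : 'rV[R]_3) :
  finite_set (opstab D P).
Proof.
have injl : {in opstab D P &, injective linear_part}.
  move=> d d' /set_mem [_ dP] /set_mem [_ d'P] eql.
  by apply: (act_linear_part_inj eql (v := P)); rewrite dP d'P.
have /card_eqPle[_ le] := inj_card_eq injl.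
exact: card_le_finite le finite_finset.
Qed.

Definition admissible (D : set op) : Prop :=
  [/\ opgroup D, F23op `<=` D & D `<=` bcc_ops].

Lemma stab_sub (R : realType) (D D' : set op) (P : 'rV[R]_3) :
  admissible D -> minimal_stab D P ->
  opgroup D' -> D' `<=` D -> has_lattice D' ->
  (forall d, D d -> exists2 s, opstab D P s & D' (mul_op d s)) ->
  opstab D P `<=` D'.
Proof.
move=> [gD FD ND] mD gD' sD'D lD' tr s Ss; apply: contrapT => nD's.
apply: (mD D') => //.
- exact: subset_trans sD'D ND.
- apply/seteqP; split => [_ [d D'd <-]|_ [d Dd <-]].
    by exists d => //; apply: sD'D.
  have [s' [Ds' s'P] D'm] := tr d Dd.
  by exists (mul_op d s') => //; rewrite act_mul s'P.
- apply: proper_card_lt; first exact: finite_opstab.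
    by move=> d [D'd dP]; split => //; apply: sD'D.
  by move=> eqS; apply: nD's; move: Ss; rewrite -eqS => -[].
Qed.

(** Here [D'] need not be contained in [D]; this is the form used for competitors of another point
    group. *)
Lemma stab_trivial (R : realType) (D D' : set op) (P : 'rV[R]_3) :
  admissible D -> minimal_stab D P ->
  opgroup D' -> D' `<=` bcc_ops -> has_lattice D' ->
  oporbit D' P = oporbit D P ->
  (forall d, D' d -> act d P = P -> d = one_op) ->
  forall s, opstab D P s -> s = one_op.
Proof.
move=> [gD FD ND] mD gD' ND' lD' eqO tr s Ss; apply: contrapT => ns1.
have [D1 _ _] := gD.
apply: (mD D') => //; apply: proper_card_lt; first exact: finite_opstab.
  by move=> d [D'd /tr ->] //; split; rewrite ?act_one.
by move=> eqS; apply: ns1; move: Ss; rewrite -eqS => -[/tr].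
Qed.

(** An [s] with [chi s] true would represent the other coset of the kernel of [chi] in [D], so the
    kernel would have the same orbit without containing [s]. Vanishing on [F23op] keeps the lattice
    D3 in the kernel. *)
Lemma stab_char (R : realType) (D : set op) (P : 'rV[R]_3) (chi : op -> bool) :
  (forall a b, bcc a -> bcc b -> chi (mul_op a b) = chi a (+) chi b) ->
  (forall d, F23op d -> chi d = false) ->
  admissible D -> minimal_stab D P ->
  forall s, opstab D P s -> chi s = false.
Proof.
move=> chiM chiF aD mD s Ss; apply/negbTE/negP => chis.
have [[D1 DM DV] FD ND] := aD; have [Ds sP] := Ss.
have chiV d : D d -> chi (inv_op d) = chi d.
  move=> Dd; have := chiM d (inv_op d) (ND _ Dd) (ND _ (DV _ Dd)).
  by rewrite mulopV (chiF _ F23op_one); case: (chi d); case: (chi _).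
have : [set d | D d /\ chi d = false] s.
  apply: (stab_sub aD mD) Ss; first split.
  - by split; [exact: D1 | exact: chiF F23op_one].
  - move=> a b [Da ca] [Db cb]; split; first exact: DM.
    by rewrite chiM ?ca ?cb //; apply: ND.
  - by move=> a [Da ca]; split; [exact: DV | rewrite chiV].
  - by move=> d [].
  - by move=> t Ft; split; [exact: FD | exact: chiF].
  move=> d Dd; case E : (chi d).
    exists s => //; split; first exact: DM.
    by rewrite chiM ?E ?chis //; apply: ND.
  exists one_op; first by split; rewrite ?act_one.
  by rewrite mulop1.
by case=> _; rewrite chis.
Qed.

(** Since [osg d 0] equals [ok d], the condition [ok d = 0] defines the stabilizer of the first
    coordinate direction, a subgroup of index 3. The powers of an [s] with a cyclic coordinate
    permutation represent its three cosets. *)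
Lemma stab_shift (R : realType) (D : set op) (P : 'rV[R]_3) :
  admissible D -> minimal_stab D P ->
  forall s, opstab D P s -> ok s = 0.
Proof.
move=> aD mD s Ss; have [[D1 DM DV] FD ND] := aD; have [Ds sP] := Ss.
have ms : omu s = false.
  apply: (stab_char (chi := omu)) Ss => //.
  by move=> d [].
apply: contrapT => ks; suff : [set d | D d /\ ok d = 0] s by case.
apply: (stab_sub aD mD) Ss; first split.
- by split.
- move=> a b [Da ca] [Db cb]; split; first exact: DM.
  by rewrite /= /dih ca cb; case: (omu b); rewrite ?addr0 ?subr0.
- move=> a [Da ca]; split; first exact: DV.
  by rewrite /= ca oppr0; case: (omu a).
- by move=> d [].
- by move=> t Ft; split => //; apply: FD.
move=> d Dd.
have kM a b : omu b = false -> ok (mul_op a b) = ok b + ok a.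
  by move=> mb; rewrite /= /dih mb.
have [/eqP kd|/eqP kd|/eqP kd] : [\/ ok d == 0, ok d == ok s | ok d == - ok s].
- move: ks; case: (ok s) => [[|[|[|//]]] ?]; case: (ok d) => [[|[|[|//]]] ?] ks;
  by [constructor 1 | constructor 2 | constructor 3 | case: ks; apply: val_inj].
- exists one_op; first by split; rewrite ?act_one.
  by rewrite mulop1.
- exists (mul_op s s); first by split; [exact: DM | rewrite act_mul !sP].
  split; first by apply: (DM) => //; apply: DM.
  rewrite kM; last by rewrite /= ms.
  rewrite kM // kd; move: (ok s); apply: I3_ind; exact: val_inj.
- exists s => //; split; first exact: DM.
  by rewrite kM // kd subrr.
Qed.

(** * Orbits of points on a coordinate axis *)

Lemma vec3E (R : realType) (a b c : R) :
  (vec3 a b c 0 0 = a) * (vec3 a b c 0 1 = b) * (vec3 a b c 0 2 = c).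
Proof. by rewrite !mxE. Qed.

Lemma actE (R : realType) d (v : 'rV[R]_3) i : act d v 0 i =
  (if oe d i then - v 0 (osg d i) else v 0 (osg d i)) + (ot d 0 i)%:~R / 2.
Proof. by rewrite mxE sgE. Qed.

Definition axis_pt (R : realType) (x : R) (i : 'I_3) (b : bool)
    (t : 'rV[int]_3) : 'rV[R]_3 :=
  \row_j ((if j == i then if b then - x else x else 0) + (t 0 j)%:~R / 2).

Lemma act_axis (R : realType) (x : R) d i : osg d i = 0 ->
  act d (vec3 x 0 0) = axis_pt x i (oe d i) (ot d).
Proof.
move=> di; apply/rowP => j; rewrite actE [RHS]mxE; congr (_ + _).
case: eqP => [->|ji]; first by rewrite di vec3E.
have : osg d j != 0.
  apply/eqP => dj; apply: ji.
  by rewrite -(osgK d j) dj -di osgK.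
by move: (osg d j); apply: I3_ind => //; rewrite ?vec3E ?oppr0; case: ifP.
Qed.

Definition tcl (t : 'rV[int]_3) : int := cl (trop t).

Definition tbcc (t : 'rV[int]_3) : bool := bcc (trop t).

Lemma F23op_trop t : F23op (trop t) <-> tbcc t /\ tcl t = 0.
Proof.
split; first by case.
by case; split=> //; rewrite /alpha !ffunE.
Qed.

Lemma row_subE (t u : 'rV[int]_3) i : (t - u) 0 i = t 0 i - u 0 i.
Proof. by rewrite !mxE. Qed.

Lemma change_translation (D : set op) d t : admissible D -> D d ->
  tbcc t -> tcl t = cl d ->
  exists2 d', D d' & [/\ ot d' = t, oe d' = oe d, omu d' = omu d & ok d' = ok d].
Proof.
move=> [[D1 DM DV] FD ND] Dd Nt ct; exists (mul_op (trop (t - ot d)) d).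
  apply: (DM) => //; apply: FD; apply/F23op_trop.
  move: Nt ct (ND _ Dd).
  rewrite /bcc_ops /tbcc /tcl /= /cl /bcc /= !row_subE => Nt ct Nd; split; lia.
split.
- by apply/rowP => i; rewrite mul_otE osg_trop ffunE mxE /= mxE subrK.
- by apply/ffunP => i; rewrite mul_oeE osg_trop ffunE.
- by [].
- by rewrite /= /dih addr0 subr0; case: (omu d).
Qed.

Lemma F23op_axis d i b : exists2 v, F23op v & forall (R : realType) (x : R),
  act (mul_op d v) (vec3 x 0 0) = axis_pt x i b (ot d).
Proof.
pose j := osg d i; pose b' := oe d i (+) b.
(* [v] takes (x,0,0) to axis [j] with sign [b']; the same sign at a second coordinate keeps the
   number of signs even, as [F23op] requires. *)
pose v := Op false (- j) [ffun l => if l == j + 2 then false else b'] 0.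
exists v => [|R x].
  split; rewrite ?/cl ?/bcc ?mxE //.
  by rewrite /alpha !ffunE /=; move: (j); apply: I3_ind; case: (b').
have vi : osg (mul_op d v) i = 0 by rewrite osg_mul /osg /= -/j /dih addNr.
rewrite (act_axis _ vi); congr axis_pt.
  rewrite mul_oeE !ffunE -/j.
  have -> : (j == j + 2) = false by move: (j); apply: I3_ind.
  by rewrite /b' addKb.
by apply/rowP => l; rewrite mul_otE mxE oppr0; case: ifP; rewrite addr0.
Qed.

Lemma orbit_axis (R : realType) (D : set op) (x : R) d i b t :
  admissible D -> D d -> tbcc t -> tcl t = cl d ->
  oporbit D (vec3 x 0 0) (axis_pt x i b t).
Proof.
move=> aD Dd Nt ct; have [d1 Dd1 [<- _ _ _]] := change_translation aD Dd Nt ct.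
have [[D1 DM DV] FD ND] := aD; have [v Fv <-] := F23op_axis d1 i b.
by exists (mul_op d1 v) => //; apply: DM => //; apply: FD.
Qed.

(** The right-hand side sees [D] only through its values of [cl], which is the basis for comparing
    [D] with groups of other point groups. *)
Lemma orbit_axisE (R : realType) (D : set op) (x : R) p :
  admissible D -> oporbit D (vec3 x 0 0) p <->
  exists d i b t, [/\ D d, tbcc t, tcl t = cl d & p = axis_pt x i b t].
Proof.
move=> aD; have [_ _ ND] := aD; split=> [[d Dd <-]|[d [i [b [t [Dd Nt ct ->]]]]]].
  exists d, (inv_sg d 0), (oe d (inv_sg d 0)), (ot d); split => //; first exact: (ND _ Dd).
  exact/act_axis/inv_sgK.
exact: orbit_axis ct.
Qed.

(* Types R-3 ([inv = true]) and R3, with translation lattice D3, Z^3 or the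
   body-centred one for q = 4, 2, 1. *)
Definition rhomb_ops (q : int) (inv : bool) : set op :=
  [set d | [/\ bcc d, omu d = false, (forall i, oe d i = oe d 0),
               modz (cl d) q = 0 & (oe d 0 ==> inv)]].

Lemma opgroup_rhomb q inv : q \in [:: 1; 2; 4 : int] -> opgroup (rhomb_ops q inv).
Proof.
move=> hq.
have dq a b : bcc b -> modz (cl a) q = 0 -> modz (cl b) q = 0 ->
    modz (cl (mul_op a b)) q = 0.
  move=> Nb; rewrite (cl_mul a Nb); case: ifP => _;
  by move: hq; rewrite !inE => /or3P[] /eqP ->; lia.
split.
- split; rewrite ?bcc_one ?cl_one ?mod0z //; last by rewrite ffunE.
  by move=> i; rewrite !ffunE.
- move=> a b [Na ma ea qa ia] [Nb mb eb qb ib]; split.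
  + exact: bcc_mul.
  + by rewrite /= ma mb.
  + by move=> i; rewrite !mul_oeE ea eb (eb (osg _ 0)).
  + exact: dq.
  + by rewrite mul_oeE eb; move: ia ib; case: (oe a 0); case: (oe b 0); case: inv.
- move=> a [Na ma ea qa ia]; split.
  + exact: bcc_inv.
  + by [].
  + by move=> i; rewrite !ffunE ea (ea (inv_sg _ 0)).
  + have := cl_mul a (bcc_inv Na); rewrite mulopV cl_one.
    move: hq qa; have := cl_bound (inv_op a); have := cl_bound a.
    by rewrite !inE; case: ifP => _ ? ? /or3P[] /eqP ->; lia.
  + by rewrite ffunE ea.
Qed.

(** A point (m,0,0) lies on a threefold axis of R1, which [stab_shift] excludes. The rotation [s]
    sends (x,y,z) to (y+m, z, x-m). *)
Lemma axis_not_int (R : realType) (D : set op) (x : R) :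
  admissible D -> minimal_stab D (vec3 x 0 0) -> forall m : int, x <> m%:~R.
Proof.
move=> aD mD m xm; have [_ FD _] := aD.
pose s := Op false 1 [ffun=> false] (vec3z (m * 2) 0 (- (m * 2))).
suff Ss : opstab D (vec3 x 0 0) s by have := stab_shift aD mD Ss.
split.
  apply: FD; split; rewrite /bcc /cl /alpha ?ffunE ?vec3z_E //=; lia.
apply: row3P; rewrite actE ffunE /osg /dih /= !I3E !vec3E vec3z_E ?xm.
- by rewrite intrM; field.
- by field.
- by rewrite rmorphN /= intrM; field.
Qed.

Lemma half_int (R : realType) (n : int) (x : R) : n%:~R / 2 = x ->
  modz n 2 = 0 -> exists m : int, x = m%:~R.
Proof.
move=> <- n2; exists (divz n 2).
have -> : n = divz n 2 * 2 by lia.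
by rewrite mulzK // intrM; field.
Qed.

(** A threefold part would make x half of the first translation entry while another entry vanishes;
    that entry is then even and x an integer. What remains is the inversion in (x,0,0): its doubled
    translation is 4x = 2n, with n odd because x is not an integer, so its class is 2. *)
Lemma rhomb_stab (R : realType) (x : R) q inv d : (forall m : int, x <> m%:~R) ->
  rhomb_ops q inv d -> act d (vec3 x 0 0) = vec3 x 0 0 ->
  d = one_op \/ oe d 0 /\ exists n : int, [/\ x = n%:~R / 2, modz (n *2) 4 = 2 & modz (modz (n * 2) 4) q = 0].
Proof.
move=> nx [Nd md ed qd _] /rowP dP.
have int_half (t : int) (y : R) : (y = x \/ y = - x) -> y = t%:~R / 2 ->
    modz t 2 = 0 -> False.
  move=> yx yt t2; have [m ym] := half_int (esym yt) t2.
  case: yx => yx; first by apply: (nx m); rewrite -yx ym.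
  by apply: (nx (- m)); rewrite rmorphN /= -ym yx opprK.
have zero (t : int) (b : bool) : (if b then - (0 : R) else 0) + t%:~R / 2 = 0 -> t = 0.
  case: b; rewrite ?oppr0 add0r => /eqP; rewrite mulf_eq0 invr_eq0 pnatr_eq0 orbF intr_eq0; exact: eqP.
have := dP 0; have := dP 1; have := dP 2.
rewrite !actE !(ed 1) !(ed 2) /osg /dih md.
have kE : ok d = 0 \/ ok d = 1 \/ ok d = 2 by move: (ok d); apply: I3_ind; auto.
case: kE => [k0|[k0|k0]]; rewrite k0 !I3E !vec3E.
- move=> /zero t2 /zero t1; case e0 : (oe d 0) => t0; last first.
    left; apply: op_eq => // [i|i]; first by rewrite ffunE ed e0.
    rewrite [RHS]mxE; move: i; apply: I3_ind => //.
    by apply: (zero _ false); move: t0; lra.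
  right; split => //; exists (divz (ot d 0 0) 2).
  have x4 : (ot d 0 0)%:~R = x * 4 by move: t0; lra.
  have ev : ot d 0 0 = divz (ot d 0 0) 2 * 2.
    by move: Nd; rewrite /bcc t1 t2; lia.
  have xn : x = (divz (ot d 0 0) 2)%:~R / 2.
    by move: x4; rewrite {1}ev intrM; lra.
  split => //.
    have n2 := half_int (esym xn).
    have n1 : modz (divz (ot d 0 0) 2) 2 <> 0.
      by move=> /n2 [m xm]; apply: (nx m).
    lia.
  by move: qd; rewrite /cl t1 t2 !addr0 {1}ev.
- move=> t2 /zero t1 t0; exfalso; apply: (int_half (ot d 0 0) x); first by left.
    by move: t0; case: (oe d 0); lra.
  by move: Nd; rewrite /bcc t1; lia.
- move=> /zero t2 t1 t0; exfalso; apply: (int_half (ot d 0 0) x); first by left.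
    by move: t0; case: (oe d 0); lra.
  by move: Nd; rewrite /bcc t2; lia.
Qed.

Lemma rhomb_orbit (R : realType) (x : R) q inv i b t :
  tbcc t -> modz (tcl t) q = 0 -> (b ==> inv) ->
  oporbit (rhomb_ops q inv) (vec3 x 0 0) (axis_pt x i b t).
Proof.
move=> Nt qt bi; pose d := Op false (- i) [ffun => b] t.
have di : osg d i = 0 by rewrite /osg /dih /= addNr.
exists d; last by rewrite (act_axis _ di) ffunE.
by split => //; rewrite ?ffunE // => j; rewrite !ffunE.
Qed.

Lemma axis_pt_flip (R : realType) (x : R) (n : int) i t : x = n%:~R / 2 ->
  axis_pt x i true t = axis_pt x i false (t - \row_j (if j == i then n *2 else 0)).
Proof.
move=> xn; apply/rowP => j; rewrite !mxE /= rmorphB /=.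
by case: eqP => _; rewrite ?xn ?intrM ?rmorph0; field.
Qed.

(* If the translation parts form a lattice, the orbit is also the orbit of a
   group of type R-3 or R3 that acts on it freely. *)
Lemma axis_not_lattice (R : realType) (D : set op) (x : R) (q : int) :
  admissible D -> minimal_stab D (vec3 x 0 0) -> q \in [:: 1; 2; 4 : int] ->
  (forall d, D d -> modz (cl d) q = 0) ->
  (forall c : int, 0 <= c < 4 -> modz c q = 0 -> exists2 d, D d & cl d = c) ->
  False.
Proof.
move=> aD mD hq Dq qD; have nx := axis_not_int aD mD; have [_ FD ND] := aD.
pose s := linop false 0 false true true.
have Ss : opstab D (vec3 x 0 0) s.
  split.
    apply: FD; split; rewrite /bcc /cl /alpha ?linop_oeE ?mxE //=.
  by apply: row3P; rewrite actE linop_oeE /osg /dih /= !I3E !vec3E !mxE; field.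
have s1 : s <> one_op by move/(congr1 (fun d => oe d 1)); rewrite linop_oeE ffunE.
have main inv :
    (forall i t, tbcc t -> modz (tcl t) q = 0 ->
       oporbit (rhomb_ops q inv) (vec3 x 0 0) (axis_pt x i true t)) ->
    (forall d, rhomb_ops q inv d -> act d (vec3 x 0 0) = vec3 x 0 0 ->
       d = one_op) -> False.
  move=> flip free; apply: s1; move: s Ss.
  apply: (stab_trivial (D' := rhomb_ops q inv) aD mD) => //.
  - exact: opgroup_rhomb.
  - by move=> d [].
  - by move=> t [Nt ct _ _]; split; rewrite ?ct ?mod0z // ?ffunE // => i; rewrite !ffunE.
  - apply/seteqP; split => [_ [d [Nd md ed qd _] <-]|p].
      have [d' Dd' cd'] := qD _ (cl_bound d) qd.
      rewrite (act_axis _ (inv_sgK d 0)).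
      exact: (@orbit_axis R D x d').
    move/(orbit_axisE _ _ aD) => [d [i [b [t [Dd Nt ct ->]]]]].
    have qt : modz (tcl t) q = 0 by rewrite ct Dq.
    by case: b; [exact: flip | exact: rhomb_orbit].
(* The inversion in (x,0,0) has class 2, so it belongs to the competitor only if q divides 2 and 2x
   is an integer. Outside that case type R-3 acts freely. In it R3 is taken, and the points with -x
   are recovered by the translation 2x along the axis, again of class 2. *)
have [q4|q4] := eqVneq (modz 2 q) 0; last first.
  apply: (main true) => [i t Nt qt|d Qd dP]; first exact: rhomb_orbit.
  by case: (rhomb_stab nx Qd dP) => // -[_ [n [_ n4 nq]]]; move: q4; rewrite -n4 nq eqxx.
have [[n xn]|nhalf] := pselect (exists n : int, x = n%:~R / 2); last first.
  apply: (main true) => [i t Nt qt|d Qd dP]; first exact: rhomb_orbit.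
  case: (rhomb_stab nx Qd dP) => // -[_ [n [xn _ _]]].
  by case: nhalf; exists n.
have nodd : modz n 2 <> 0.
  by move=> n2; have [m xm] := half_int (esym xn) n2; exact: (nx m).
apply: (main false) => [i t Nt qt|d Qd dP]; last first.
  case: (rhomb_stab nx Qd dP) => // -[].
  by case: Qd => _ _ _ _; rewrite implybF => /negbTE ->.
pose u : 'rV[int]_3 := \row_j (if j == i then n * 2 else 0).
rewrite (axis_pt_flip _ _ xn) -/u.
have [Eu1 [u0 u1 u2]] : u 0 0 + u 0 1 + u 0 2 = n * 2 /\
    [/\ modz (u 0 0) 2 = 0, modz (u 0 1) 2 = 0 & modz (u 0 2) 2 = 0].
  by rewrite !mxE; move: (i); apply: I3_ind; rewrite /=; split; try split; lia.
apply: rhomb_orbit => //.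
  by move: Nt; rewrite /tbcc /bcc /= !row_subE; lia.
move: qt q4; rewrite /tcl /cl /= !row_subE.
by move: hq; rewrite !inE => /or3P[] /eqP ->; lia.
Qed.

(* For c = 3 the types Fd-3 (m = false) and F4_132 (m = true). *)
Definition dia_ops (c : int) (m : bool) : set op :=
  F23op `|` [set d | [/\ bcc d, cl d = c, alpha d & omu d = m]].

(** If class 2 occurs with an odd class, class 2 without one, or class 0 alone, the classes are the
    multiples of q = 1, 2, 4, excluded by [lattice]. So an odd class occurs without class 2. Then
    products of two odd elements must have class 0, which forces a single coset of [F23op]. *)
Lemma axis_dia (R : realType) (D : set op) (x : R) :
  admissible D -> minimal_stab D (vec3 x 0 0) ->
  exists c m, (c = 1 \/ c = 3) /\ D = dia_ops c m.
Proof.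
move=> aD mD; have [[D1 DM DV] FD ND] := aD.
have lattice := axis_not_lattice aD mD.
have Dc0 : exists2 d, D d & cl d = 0 by exists one_op; rewrite ?cl_one.
have [[d2 Dd2 c2]|no2] := pselect (exists2 d, D d & cl d = 2).
  have c2M d : D d -> cl (mul_op d d2) = modz (cl d + 2) 4.
    by move=> Dd; rewrite (cl_mul _ (ND _ Dd2)) (rho_cl (ND _ Dd2)) c2.
  have [[d1 Dd1 odd1]|no1] := pselect (exists2 d, D d & modz (cl d) 2 = 1).
    exfalso; apply: (lattice 1) => // [d _|c cb _]; first by rewrite modz1.
    have h : c = 0 \/ c = 2 \/ c = cl d1 \/ c = modz (cl d1 + 2) 4.
      by have := cl_bound d1; lia.
    case: h => [->|[->|[->|->]]] //; first by exists d2.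
      by exists d1.
    by exists (mul_op d1 d2); [exact: DM | exact: c2M].
  exfalso; apply: (lattice 2) => // [d Dd|c cb ce].
    have [//|] : modz (cl d) 2 = 0 \/ modz (cl d) 2 = 1 by lia.
    by move=> od; case: no1; exists d.
  have [->//|->] : c = 0 \/ c = 2 by lia.
  by exists d2.
have [[d1 Dd1 odd1]|no1] := pselect (exists2 d, D d & modz (cl d) 2 = 1); last first.
  exfalso; apply: (lattice 4) => // [d Dd|c cb ce].
    have [//|[|]] : modz (cl d) 4 = 0 \/ modz (cl d) 2 = 1 \/ cl d = 2.
    - by have := cl_bound d; lia.
    - by move=> od; case: no1; exists d.
    - by move=> od; case: no2; exists d.
  by have -> : c = 0 by lia.
have even d : D d -> rho d = false -> F23op d.
  move=> Dd; rewrite (rho_cl (ND _ Dd)) => ed.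
  have c0 : cl d = 0.
    have [//|] : cl d = 0 \/ cl d = 2 by have := cl_bound d; lia.
    by move=> c2; case: no2; exists d.
  have [||d' Dd' [t0 e0 m0 k0]] := change_translation (t := 0) aD Dd.
  - exact: bcc_one.
  - by rewrite c0 -cl_one.
  (* [v] brings the image back to (x,0,0), so [mul_op d' v] lies in the stabilizer, where [alpha]
     and [omu] vanish; it shares them with [d]. *)
  have [v Fv vP] := F23op_axis d' 0 false; have [_ _ av mv] := Fv.
  have Ss : opstab D (vec3 x 0 0) (mul_op d' v).
    split; first by apply: DM => //; apply: FD.
    rewrite vP t0; apply: row3P; rewrite !mxE /= ; by field.
  have ad : alpha d = false.
    have -> : alpha d = alpha (mul_op d' v) by rewrite alpha_mul av addbF /alpha e0.
    apply: (stab_char _ _ aD mD Ss) => [a b _ _|a []//].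
    exact: alpha_mul.
  have md : omu d = false.
    have -> : omu d = omu (mul_op d' v) by rewrite /= mv addbF m0.
    by apply: (stab_char _ _ aD mD Ss) => // a [].
  by split => //; apply: ND.
have oddP d d' : D d -> D d' -> rho d -> rho d' ->
    [/\ alpha d, alpha d', omu d = omu d' & cl d = cl d'].
  have two a b : D a -> D b -> rho a -> rho b -> F23op (mul_op a b).
    by move=> Da Db ra rb; apply: even; [exact: DM | rewrite rho_mul ?ra ?rb //; apply: ND].
  have al a : D a -> rho a -> alpha a.
    move=> Da ra; have [_ + _ _] := two a a Da Da ra ra.
    rewrite cl_mul ?ra; last exact: ND.
    move: ra; rewrite (rho_cl (ND _ Da)); case: (alpha a) => //=; lia.
  move=> Da Db ra rb; have [_ + _ +] := two _ _ Da Db ra rb.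
  have aa := al _ Da ra; have ab := al _ Db rb.
  rewrite cl_mul ?rb ?aa ?ab; last exact: ND.
  move=> /= c0 m0; split => //; first by move: m0; case: (omu d); case: (omu d').
  by move: c0; have := cl_bound d; have := cl_bound d'; lia.
have r1 : rho d1 by rewrite (rho_cl (ND _ Dd1)) odd1.
have [a1 _ _ _] := oddP _ _ Dd1 Dd1 r1 r1.
exists (cl d1), (omu d1); split.
  by have := cl_bound d1; lia.
apply/seteqP; split => d.
  move=> Dd; case rd : (rho d); last by left; apply: even.
  by right; have [ad _ md cd] := oddP _ _ Dd Dd1 rd r1; split => //; apply: ND.
case=> [|[Nd cd ad md]]; first exact: FD.
rewrite -(mulKVop d1 d); apply: (DM) => //; apply: FD.
have DV1 := DV _ Dd1; have rd : rho d by rewrite (rho_cl Nd) cd odd1.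
have rV : rho (inv_op d1) by rewrite rho_inv //; apply: ND.
have [aV _ mV cV] := oddP _ _ DV1 Dd1 rV r1.
split.
- by apply: bcc_mul => //; apply: ND.
- by rewrite cl_mul // rd aV /= cd cV subrr mod0z.
- by rewrite alpha_mul aV ad.
- by rewrite /= md addbb.
Qed.

(** * Normal form of the base point *)

Lemma stab_linear_part (R : realType) (D : set op) (P : 'rV[R]_3) s :
  admissible D -> minimal_stab D P -> opstab D P s ->
  [/\ bcc s, rho s = false, alpha s = false, omu s = false & ok s = 0].
Proof.
move=> aD mD Ss; have [_ _ ND] := aD; split.
- by case: Ss => /ND.
- apply: (stab_char _ _ aD mD Ss) => [a b _|d [Nd cd _ _]]; first exact: rho_mul.
  by rewrite (rho_cl Nd) cd.
- apply: (stab_char _ _ aD mD Ss) => [a b _ _|d []//]; exact: alpha_mul.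
- by apply: (stab_char _ _ aD mD Ss) => // d [].
- exact: stab_shift Ss.
Qed.

Lemma fixed_coord (R : realType) (P : 'rV[R]_3) s i : osg s i = i ->
  act s P = P -> if oe s i then P 0 i = (ot s 0 i)%:~R / 4 else ot s 0 i = 0.
Proof.
move=> si /rowP/(_ i); rewrite actE si; case: (oe s i) => h; first by lra.
have : (ot s 0 i)%:~R = 0 :> R by lra.
by move/eqP; rewrite intr_eq0 => /eqP.
Qed.

(** What is left are diagonal linear parts with an even number of signs, hence half-turns about
    lines of direction [i0]. A negated coordinate is fixed at a quarter of its doubled translation
    entry, which is even because [rho] vanishes. *)
Lemma stab_half_coords (R : realType) (D : set op) (P : 'rV[R]_3) s :
  admissible D -> minimal_stab D P -> opstab D P s -> s <> one_op ->
  exists i0 (a b : int), P 0 (i0 + 1) = a%:~R / 2 /\ P 0 (i0 + 2) = b%:~R / 2.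
Proof.
move=> aD mD Ss s1; have [Ns rs als ms ks] := stab_linear_part aD mD Ss.
have [_ sP] := Ss; have si i : osg s i = i by rewrite /osg ms ks /dih add0r.
have half i : oe s i -> exists a : int, P 0 i = a%:~R / 2.
  move=> ei; have := fixed_coord (si i) sP; rewrite ei => ->.
  exists (divz (ot s 0 i) 2).
  have te : ot s 0 i = divz (ot s 0 i) 2 * 2.
    have : modz (ot s 0 i) 2 = 0; last by lia.
    by move: (i) Ns rs; rewrite /bcc /rho; apply: I3_ind; lia.
  by rewrite {1}te intrM; field.
have : exists i0, oe s (i0 + 1) /\ oe s (i0 + 2).
  case e0 : (oe s 0); case e1 : (oe s 1); case e2 : (oe s 2);
    move: als; rewrite /alpha e0 e1 e2 // => _.
  - by exists 2; rewrite !I3E e0 e1.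
  - by exists 1; rewrite !I3E e0 e2.
  - by exists 0; rewrite !I3E e1 e2.
  - case: s1; apply: op_eq => // [i|i]; rewrite ?ffunE ?mxE; move: i; apply: I3_ind => //.
    + by have := fixed_coord (si 0) sP; rewrite e0.
    + by have := fixed_coord (si 1) sP; rewrite e1.
    + by have := fixed_coord (si 2) sP; rewrite e2.
by move=> [i0 [/half [a Pa] /half [b Pb]]]; exists i0, a, b.
Qed.

Lemma to_axis (R : realType) (P : 'rV[R]_3) i0 (a b : int) :
  P 0 (i0 + 1) = a%:~R / 2 -> P 0 (i0 + 2) = b%:~R / 2 -> modz a 2 = modz b 2 ->
  exists2 n, bcc n & exists x, act n P = vec3 x 0 0.
Proof.
(* The cyclic permutation brings direction [i0] to the front; the first translation entry only has
   to match the common parity of the other two. *)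
move=> Pa Pb ab; exists (Op false i0 [ffun=> false] (vec3z (- a) (- a) (- b))).
  by rewrite /bcc !vec3z_E; lia.
exists (P 0 i0 - a%:~R / 2); apply: row3P;
  rewrite actE ffunE /osg /dih /= ?Pa ?Pb ?vec3z_E ?vec3E ?addr0.
- by rewrite rmorphN /=; field.
- by rewrite rmorphN /=; field.
- by rewrite rmorphN /=; field.
Qed.

Lemma to_skew_axis (R : realType) (P : 'rV[R]_3) i0 (a b : int) :
  P 0 (i0 + 1) = a%:~R / 2 -> P 0 (i0 + 2) = b%:~R / 2 -> modz a 2 <> modz b 2 ->
  exists2 n, bcc n & act n P = vec3 (P 0 i0) 0 (1 / 2).
Proof.
move=> Pa Pb ab; have [[a0 b1]|[a1 b0]] : (modz a 2 = 0 /\ modz b 2 = 1) \/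
   (modz a 2 = 1 /\ modz b 2 = 0) by lia.
- exists (Op false i0 [ffun=> false] (vec3z 0 (- a) (1 - b))).
    by rewrite /bcc !vec3z_E; lia.
  apply: row3P;
    rewrite actE ffunE /osg /dih /= ?Pa ?Pb ?vec3z_E ?vec3E ?addr0.
  + by field.
  + by rewrite rmorphN /=; field.
  + by rewrite rmorphB /=; field.
- exists (Op true i0 [ffun=> false] (vec3z 0 (- b) (1 - a))).
    by rewrite /bcc !vec3z_E; lia.
  apply: row3P;
    rewrite actE ffunE /osg /dih /= !I3E ?Pa ?Pb ?vec3z_E ?vec3E ?addr0.
  + by field.
  + by rewrite rmorphN /=; field.
  + by rewrite rmorphB /=; field.
Qed.

(** If all three coordinates are half-integers, two of their numerators agree in parity, and that
    pair serves in [to_axis]. So the skew position remains only when 2x is not an integer. *)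
Lemma stab_normal_form (R : realType) (D : set op) (P : 'rV[R]_3) s :
  admissible D -> minimal_stab D P -> opstab D P s -> s <> one_op ->
  exists2 n, bcc n & exists x, act n P = vec3 x 0 0 \/
    act n P = vec3 x 0 (1 / 2) /\ forall m : int, x <> m%:~R / 2.
Proof.
move=> aD mD Ss s1; have [i0 [a [b [Pa Pb]]]] := stab_half_coords aD mD Ss s1.
have [ab|ab] := pselect (modz a 2 = modz b 2).
  by have [n Nn [x nP]] := to_axis Pa Pb ab; exists n => //; exists x; left.
have [[c Pc]|nc] := pselect (exists c : int, P 0 i0 = c%:~R / 2); last first.
  have [n Nn nP] := to_skew_axis Pa Pb ab; exists n => //; exists (P 0 i0).
  by right; split => // m Pm; apply: nc; exists m.
have [ac|bc] : modz c 2 = modz a 2 \/ modz b 2 = modz c 2 by lia.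
  have [||n Nn [x nP]] := @to_axis _ P (i0 + 2) c a _ _ ac.
  - by rewrite -addrA I3E addr0.
  - by rewrite -addrA I3E.
  by exists n => //; exists x; left.
have [||n Nn [x nP]] := @to_axis _ P (i0 + 1) b c _ _ bc.
- by rewrite -addrA I3E.
- by rewrite -addrA I3E addr0.
by exists n => //; exists x; left.
Qed.

(* On (x, 0, 1/2) a sign change of one coordinate amounts to a lattice
   translation or to nothing, so this group has the same orbit as [D]. *)
Definition const_sign_ops (D : set op) : set op :=
  [set d | [/\ bcc d, forall i, oe d i = oe d 0 &
               exists2 d0, D d0 & omu d0 = omu d /\ rho d0 = rho d]].

Lemma opgroup_const_sign (D : set op) : admissible D -> opgroup (const_sign_ops D).
Proof.
move=> [[D1 DM DV] FD ND]; split.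
- split; rewrite ?bcc_one //; first by move=> i; rewrite !ffunE.
  by exists one_op.
- move=> a b [Na ea [a0 Da0 [ma ra]]] [Nb eb [b0 Db0 [mb rb]]]; split.
  + exact: bcc_mul.
  + by move=> i; rewrite !mul_oeE ea eb (eb (osg _ 0)).
  + exists (mul_op a0 b0); first exact: DM.
    by rewrite /= ma mb !rho_mul ?ra ?rb //; apply: ND.
- move=> a [Na ea [a0 Da0 [ma ra]]]; split.
  + exact: bcc_inv.
  + by move=> i; rewrite !ffunE ea (ea (inv_sg _ 0)).
  + exists (inv_op a0); first exact: DV.
    by rewrite !rho_inv ?ra //; apply: ND.
Qed.

Lemma skew_axis_false (R : realType) (D : set op) (x : R) s :
  admissible D -> minimal_stab D (vec3 x 0 (1 / 2)) ->
  (forall m : int, x <> m%:~R / 2) ->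
  opstab D (vec3 x 0 (1 / 2)) s -> s <> one_op -> False.
Proof.
move=> aD mD nx Ss s1; have [[D1 DM DV] FD ND] := aD; have [Ds sP] := Ss.
have [Ns rs als ms ks] := stab_linear_part aD mD Ss.
have si i : osg s i = i by rewrite /osg ms ks /dih add0r.
have quarter (t : int) : modz t 2 = 0 -> x <> t%:~R / 4.
  move=> te xt; apply: (nx (divz t 2)).
  by rewrite xt {1}(_ : t = divz t 2 * 2); [rewrite intrM; field | lia].
(* Negating the first coordinate would put x in Z/2, so [s] is the half-turn about the line
   (.,0,1/2), with translation (0,0,1). *)
have cs : cl s = 2.
  have e0 : oe s 0 = false.
    apply/negbTE/negP => e0; have := fixed_coord (si 0) sP.
    by rewrite e0 vec3E; apply: quarter; move: rs; rewrite /rho; lia.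
  have t0 : ot s 0 0 = 0 by have := fixed_coord (si 0) sP; rewrite e0.
  have e12 : oe s 1 = oe s 2 by move: als; rewrite /alpha e0; case: (oe s 1); case: (oe s 2).
  have := fixed_coord (si 1) sP; have := fixed_coord (si 2) sP.
  rewrite e12 !vec3E; case e2 : (oe s 2).
    move=> t2 t1; have {}t1 : ot s 0 1 = 0.
      by apply/eqP; rewrite -(intr_eq0 R); apply/eqP; lra.
    have {}t2 : ot s 0 2 = 2 by apply: (@intr_inj R); lra.
    by rewrite /cl t0 t1 t2.
  move=> t2 t1; case: s1; apply: op_eq => // i; rewrite ?ffunE ?mxE; move: i; apply: I3_ind => //.
  by rewrite e12.
have full d : bcc d -> alpha d = false -> omu d = false -> rho d = false -> D d.
  move=> Nd ad md rd; have [c0|c2] : cl d = 0 \/ cl d = 2.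
  - by move: rd; rewrite (rho_cl Nd); have := cl_bound d; lia.
  - by apply: FD.
  rewrite -(mulKop s d); apply: (DM); first exact: DV.
  apply: FD; split; rewrite ?bcc_mul ?cl_mul ?alpha_mul ?als ?ad //=.
    by rewrite rd /= cs c2.
  by rewrite ms md.
have D'D d : const_sign_ops D d -> exists2 d1, D d1 & omu d1 = omu d /\
    act d1 (vec3 x 0 (1 / 2)) = act d (vec3 x 0 (1 / 2)).
  move=> [Nd ed [d0 Dd0 [m0 r0]]].
  (* On (x,0,1/2) the sign of the zero coordinate is invisible. It is chosen so that [d1] has the
     same [alpha] as [d0]; then [mul_op (inv_op d0) d1] has trivial characters and lies in [D] by
     [full]. *)
  pose c := oe d 0 (+) alpha d (+) alpha d0.
  pose d1 := Op (omu d) (ok d) [ffun i => if osg d i == 1 then c else oe d i] (ot d).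
  have N1 : bcc d1 by [].
  exists d1; last first.
    split=> //; apply/rowP => i; rewrite !actE ffunE.
    have -> : osg d1 i = osg d i by [].
    case: eqP => // ->; rewrite vec3E oppr0.
    by case: ifP; case: ifP.
  have a1 : alpha d1 = alpha d0.
    rewrite /alpha !ffunE /c -[RHS]/(alpha d0); move: (alpha d0) => a0.
    rewrite /alpha !(ed 1) !(ed 2); osg_cases d => /=; by case: (oe d 0); case: a0.
  rewrite -(mulKVop d0 d1); apply: (DM) => //.
  have N0 := ND _ Dd0; have NV := bcc_inv N0.
  apply: full.
  - exact: bcc_mul.
  - by rewrite alpha_mul alpha_inv a1 addbb.
  - by rewrite /= m0 addbb.
  - by rewrite rho_mul // rho_inv // r0 /d1 /rho /= addbb.
apply: s1; move: s Ss {Ds sP Ns rs als ms ks si cs full}.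
apply: (stab_trivial (D' := const_sign_ops D) aD mD).
- exact: opgroup_const_sign.
- by move=> d [].
- move=> t Ft; have [Nt _ _ _] := Ft; split => //; first by move=> i; rewrite !ffunE.
  by exists (trop t) => //; apply: FD.
- apply/seteqP; split => [_ [d Dd <-]|_ [d Dd <-]].
    by have [d1 Dd1 [_ <-]] := D'D d Dd; exists d1.
  have Nd := ND _ Dd.
  pose b := oe d (inv_sg d 0).
  (* All signs are replaced by the sign [b] that x receives. At the coordinate 1/2 this costs a
     translation by 1 or -1, doubled in [u], so that [rho] is kept. *)
  pose u : 'rV[int]_3 := \row_i (if osg d i == 2 then
    if oe d i then (if b then 0 else - 2) else (if b then 2 else 0) else 0).
  have uE i : u 0 i = if osg d i == 2 then
    if oe d i then (if b then 0 else - 2) else (if b then 2 else 0) else 0.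
    by rewrite mxE.
  pose d' := Op (omu d) (ok d) [ffun=> b] (ot d + u).
  have tE i : ot d' 0 i = ot d 0 i + u 0 i by rewrite mxE.
  have ue i : modz (u 0 i) 2 = 0 by rewrite uE; do !case: ifP.
  exists d'.
    split; first by move: Nd (ue 0) (ue 1) (ue 2); rewrite /bcc_ops /bcc /= -/d' !tE; lia.
      by move=> i; rewrite !ffunE.
    by exists d => //; split => //; rewrite /rho tE; move: (ue 0); lia.
  apply/rowP => i; rewrite !actE tE uE ffunE.
  have -> : osg d' i = osg d i by [].
  have := osgK d i; rewrite intrD /b; move: (osg d i); apply: I3_ind => /=; rewrite ?vec3E.
  + by move=> ->; rewrite addr0.
  + by move=> _; rewrite !oppr0; do 2 case: ifP => _; rewrite addr0.
  + by move=> _; case: (oe d i); case: (oe d _); rewrite ?addr0 //; field.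
- move=> d Dd dP; have [d1 Dd1 [m1 d1P]] := D'D d Dd.
  have S1 : opstab D (vec3 x 0 (1 / 2)) d1 by split; rewrite ?d1P.
  have md : omu d = false by have [_ _ _ <- _] := stab_linear_part aD mD S1.
  have [Nd ed _] := Dd; move/rowP: dP => dP.
  have := dP 0; have := dP 1; have := dP 2.
  rewrite !actE !(ed 1) !(ed 2) /osg /dih md.
  have kE : ok d = 0 \/ ok d = 1 \/ ok d = 2 by move: (ok d); apply: I3_ind; auto.
  case: kE => [k0|[k0|k0]]; rewrite k0 !I3E !vec3E.
  + case e0 : (oe d 0) => t2 t1 t0.
      have {}t1 : ot d 0 1 = 0.
        by apply/eqP; rewrite -(intr_eq0 R); apply/eqP; move: t1; lra.
      exfalso; apply: (quarter (ot d 0 0)); last by move: t0; lra.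
      by move: Nd; rewrite /bcc t1; lia.
    apply: op_eq => // [i|i]; first by rewrite ffunE ed e0.
    have z (t : int) (y : R) : y + t%:~R / 2 = y -> t = 0.
      by move=> h; apply/eqP; rewrite -(intr_eq0 R); apply/eqP; lra.
    by rewrite [RHS]mxE; move: i; apply: I3_ind; [apply: z t0|apply: z t1|apply: z t2].
  + move=> _ _ t0; exfalso; apply: (nx (ot d 0 0)).
    by move: t0; case: (oe d 0); lra.
  + move=> _ _ t0; exfalso; move: t0; case: (oe d 0) => t0.
      by apply: (nx (ot d 0 0 - 1)); rewrite rmorphB /=; lra.
    by apply: (nx (ot d 0 0 + 1)); rewrite rmorphD /=; lra.
Qed.

(** * Euclidean isometries and the group R1 *)

Lemma dotE (R : realType) (u v : 'rV[R]_3) :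
  dot u v = u 0 0 * v 0 0 + u 0 1 * v 0 1 + u 0 2 * v 0 2.
Proof. by rewrite /dot big_I3. Qed.

Lemma dotC (R : realType) (u v : 'rV[R]_3) : dot u v = dot v u.
Proof. by rewrite !dotE; ring. Qed.

Lemma dotDl (R : realType) (u v w : 'rV[R]_3) : dot (u + v) w = dot u w + dot v w.
Proof. by rewrite !dotE !mxE; ring. Qed.

Lemma dotDr (R : realType) (u v w : 'rV[R]_3) : dot w (u + v) = dot w u + dot w v.
Proof. by rewrite !(dotC w) dotDl. Qed.

Lemma dotNl (R : realType) (u w : 'rV[R]_3) : dot (- u) w = - dot u w.
Proof. by rewrite !dotE !mxE; ring. Qed.

Lemma dotNr (R : realType) (u w : 'rV[R]_3) : dot w (- u) = - dot w u.
Proof. by rewrite !(dotC w) dotNl. Qed.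

Lemma dotZl (R : realType) a (u w : 'rV[R]_3) : dot (a *: u) w = a * dot u w.
Proof. by rewrite !dotE !mxE; ring. Qed.

Lemma dotZr (R : realType) a (u w : 'rV[R]_3) : dot w (a *: u) = a * dot w u.
Proof. by rewrite !(dotC w) dotZl. Qed.

Lemma dot_mx (R : realType) (u v : 'rV[R]_3) : dot u v = (u *m v^T) 0 0.
Proof. by rewrite mxE; apply: eq_bigr => i _; rewrite mxE. Qed.

Lemma dot_ge0 (R : realType) (u : 'rV[R]_3) : 0 <= dot u u.
Proof. by rewrite dotE -!expr2 !addr_ge0 ?sqr_ge0. Qed.

Lemma dot_eq0 (R : realType) (u : 'rV[R]_3) : dot u u = 0 -> u = 0.
Proof.
rewrite dotE -!expr2 => /eqP; rewrite !paddr_eq0 ?addr_ge0 ?sqr_ge0 //.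
rewrite !sqrf_eq0 => /andP[/andP[/eqP u0 /eqP u1] /eqP u2].
by apply: row3P; rewrite mxE.
Qed.

Lemma eucl_edist_sq (R : realType) (x y : 'rV[R]_3) :
  edist x y ^+ 2 = dot (x - y) (x - y).
Proof. by rewrite sqr_sqrtr ?dot_ge0. Qed.

Lemma eucl_edist_ge0 (R : realType) (x y : 'rV[R]_3) : 0 <= edist x y.
Proof. exact: sqrtr_ge0. Qed.

Lemma eucl_edist_le (R : realType) (x y z w : 'rV[R]_3) :
  (edist x y <= edist z w) = (dot (x - y) (x - y) <= dot (z - w) (z - w)).
Proof. by rewrite ler_sqrt ?dot_ge0. Qed.

(** Once rescaled and made to fix 0, the map preserves inner products by polarization. The images of
    the unit vectors are then orthonormal, and inner products with them recover all coordinates. *)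
Lemma similarity_affine (R : realType) (f : 'rV[R]_3 -> 'rV[R]_3) :
  similarity f -> exists k A b, [/\ 0 < k, A *m A^T = 1%:M &
    forall x, f x = k *: (x *m A) + b].
Proof.
move=> [k k0 fk]; pose g x := k^-1 *: (f x - f 0).
have kn0 : k != 0 by rewrite gt_eqF.
have gsub x y : dot (g x - g y) (g x - g y) = dot (x - y) (x - y).
  have -> : g x - g y = k^-1 *: (f x - f y).
    by rewrite /g -scalerBr opprB addrA subrK.
  rewrite dotZl dotZr -eucl_edist_sq fk exprMn eucl_edist_sq expr2.
  by rewrite mulrA mulrA mulrA mulfVK // mulVf // mul1r.
have g0 : g 0 = 0 by rewrite /g subrr scaler0.
have gn x : dot (g x) (g x) = dot x x by have := gsub x 0; rewrite g0 !subr0.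
have gd x y : dot (g x) (g y) = dot x y.
  have := gsub x y; rewrite !(dotDl, dotDr, dotNl, dotNr) !gn.
  by rewrite (dotC (g y)) (dotC y); lra.
pose A : 'M[R]_3 := \matrix_(i, j) g (delta_mx 0 i) 0 j.
have rA i : row i A = g (delta_mx 0 i) by apply/rowP => j; rewrite !mxE.
have delta x j : dot x (delta_mx 0 j) = x 0 j.
  rewrite /dot (bigD1 j) //= mxE !eqxx mulr1 big1 ?addr0 // => i ij.
  by rewrite mxE (negbTE ij) andbF mulr0.
have xA x j : (x *m A^T) 0 j = dot x (g (delta_mx 0 j)).
  by rewrite -rA !mxE; apply: eq_bigr => i _; rewrite !mxE.
have AA : A *m A^T = 1%:M.
  apply/row_matrixP => i; rewrite row_mul rA row1; apply/rowP => j.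
  by rewrite xA gd delta.
exists k, A, (f 0); split=> // x.
have <- : g x = x *m A.
  have xE : x = g x *m A^T by apply/rowP => j; rewrite xA gd delta.
  by rewrite [in RHS]xE -mulmxA (mulmx1C AA) mulmx1.
by rewrite /g scalerA mulfV // scale1r subrK.
Qed.

Lemma isometry_affine (R : realType) (g : 'rV[R]_3 -> 'rV[R]_3) :
  isometry g -> exists A b, A *m A^T = 1%:M /\ forall x, g x = x *m A + b.
Proof.
move=> gi.
have [|k [A [b [k0 AA gE]]]] := @similarity_affine R g.
  exists 1; first exact: ltr01.
  by move=> x y; rewrite gi mul1r.
exists A, b; split=> // x; rewrite gE; congr (_ + _).
have := gi (delta_mx 0 0) 0; rewrite !gE mul0mx scaler0 add0r.
move/(congr1 (fun a => a ^+ 2)); rewrite !eucl_edist_sq subr0 addrK dotZl dotZr.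
rewrite dot_mx trmx_mul mulmxA -(mulmxA _ A) AA mulmx1 -dot_mx.
have -> : dot (delta_mx 0 0) (delta_mx 0 0) = 1 :> R by rewrite dotE !mxE /= !mulr0 !addr0 mulr1.
rewrite mulr1 -expr2 => /eqP; rewrite sqrf_eq1 => /orP[|] /eqP kk; first by rewrite kk scale1r.
by move: k0; rewrite kk ltr0N1.
Qed.

(** The image of 0 gives the translation. The entries of (1,2,4) have distinct absolute values, so
    its image reveals permutation and signs. The same two points serve for discreteness. *)
Lemma act_eq2 (R : realType) d d' : act d (0 : 'rV[R]_3) = act d' 0 ->
  act d (vec3 1 2 4 : 'rV[R]_3) = act d' (vec3 1 2 4) -> d = d'.
Proof.
move=> /rowP E0 /rowP E1.
have et i : ot d 0 i = ot d' 0 i.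
  have := E0 i; rewrite !actE !mxE oppr0 !if_same !add0r => h.
  by apply: (@intr_inj R); lra.
have es i : oe d i = oe d' i /\ osg d i = osg d' i.
  have := E1 i; rewrite !actE et => /addIr.
  move: (osg d i) (osg d' i); apply: I3_ind; apply: I3_ind; rewrite !vec3E;
    case: (oe d i); case: (oe d' i) => // h; exfalso; lra.
have ek : ok d = ok d'.
  have [_] := es 0; rewrite /osg /dih; case: (omu d); case: (omu d');
  by rewrite ?subr0 ?addr0.
have em : omu d = omu d'.
  have [_] := es 1; rewrite /osg /dih ek; move: (ok d');
  by case: (omu d); case: (omu d') => //; apply: I3_ind.
by apply: op_eq => // i; case: (es i).
Qed.

Lemma act_inj (R : realType) d d' : @act R d = @act R d' -> d = d'.
Proof. by move=> eqa; apply: (@act_eq2 R); rewrite eqa. Qed.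

Lemma act_isometry (R : realType) d : isometry (@act R d).
Proof.
move=> x y; congr Num.sqrt.
have sub v w i : (act d v - act d w) 0 i =
    if oe d i then - (v - w) 0 (osg d i) else (v - w) 0 (osg d i) :> R.
  have -> : (act d v - act d w) 0 i = act d v 0 i - act d w 0 i by rewrite !mxE.
  by rewrite !actE [(v - w) 0 _]mxE [(- w) 0 _]mxE; case: ifP => _; ring.
rewrite !dotE !sub; set z := x - y; clearbody z.
osg_cases d; case: (oe d 0); case: (oe d 1); case: (oe d 2); ring.
Qed.

Lemma cancel_unique (T : Type) (g h h' : T -> T) :
  cancel g h -> cancel h g -> cancel h' g -> h' = h.
Proof. by move=> gh hg h'g; apply/funext => x; rewrite -[LHS]gh h'g. Qed.

Lemma isom_subgroup_inv (R : realType) (G : set ('rV[R]_3 -> 'rV[R]_3)) g h :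
  isom_subgroup G -> G g -> cancel g h -> cancel h g -> G h.
Proof.
move=> [_ _ _ GV] Gg gh hg; have [h' Gh' [gh' h'g]] := GV g Gg.
by rewrite (cancel_unique gh' h'g hg).
Qed.

Lemma isom_subgroup_act (R : realType) (D : set op) : opgroup D ->
  isom_subgroup [set @act R d | d in D].
Proof.
move=> [D1 DM DV]; split.
- by move=> _ [d _ <-]; apply: act_isometry.
- by exists one_op => //; apply/funext => x; rewrite act_one.
- move=> _ _ [d Dd <-] [d' Dd' <-]; exists (mul_op d d'); first exact: DM.
  by apply/funext => x; rewrite act_mul.
- move=> _ [d Dd <-]; exists (act (inv_op d)).
    by exists (inv_op d) => //; apply: DV.
  by split=> x; rewrite ?act_inv ?act_invr.
Qed.

(** Inverses are unique as functions, so the inverse found in [H] lies in every member of the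
    intersection; [H] also shows that the family is not empty. *)
Lemma isom_subgroup_generated (R : realType)
    (S H : set ('rV[R]_3 -> 'rV[R]_3)) :
  isom_subgroup H -> S `<=` H -> isom_subgroup (generated S).
Proof.
move=> sH SH; have [HI H1 HM HV] := sH; split.
- by move=> g /(_ H (conj sH SH)); apply: HI.
- by move=> K [[_ K1 _ _] _].
- move=> g h Gg Gh K KS; have [[_ _ KM _] _] := KS.
  by apply: KM; [apply: Gg | apply: Gh].
- move=> g Gg; have [h Hh [gh hg]] := HV g (Gg H (conj sH SH)).
  exists h => // K KS; have [sK _] := KS.
  exact: (isom_subgroup_inv sK (Gg K KS)).
Qed.

Lemma opgroup_pull (R : realType) (G : set ('rV[R]_3 -> 'rV[R]_3)) f f' :
  isom_subgroup G -> cancel f f' -> cancel f' f ->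
  opgroup [set d | G (f' \o @act R d \o f)].
Proof.
move=> sG ff' f'f; have [_ G1 GM _] := sG; split.
- move: G1; congr G; apply/funext => x /=; by rewrite act_one ff'.
- move=> a b /= Ga Gb; have := GM _ _ Ga Gb; congr G.
  by apply/funext => x /=; rewrite f'f act_mul.
- move=> a /= Ga; apply: (isom_subgroup_inv sG Ga).
  + by move=> x /=; rewrite f'f act_inv ff'.
  + by move=> x /=; rewrite f'f act_invr ff'.
Qed.

(** For k = 1, 2 these are the threefold rotations about the line through [c] with direction u_j =
    (-1)^(b j); both [c] and [c + u] are fixed. *)
Definition rotop (k : 'I_3) (b : 'I_3 -> bool) (c : 'rV[int]_3) : op :=
  Op false k [ffun j => b j (+) b (j + k)]
    (\row_j ((c 0 j - (if b j (+) b (j + k) then - c 0 (j + k) else c 0 (j + k))) * 2)).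

Lemma rotop_otE k b c j : ot (rotop k b c) 0 j =
  (c 0 j - (if b j (+) b (j + k) then - c 0 (j + k) else c 0 (j + k))) * 2.
Proof. by rewrite mxE. Qed.

Lemma F23op_rotop k b c : k != 0 -> F23op (rotop k b c).
Proof.
move=> k0; have : k = 1 \/ k = 2.
  by move: k k0; apply: I3_ind => // _; [left|right].
move=> {k0} k12; split => //.
- rewrite /bcc !rotop_otE; lia.
- rewrite /cl !rotop_otE; case: k12 => ->; rewrite !I3E.
    by case: (b 0); case: (b 1); case: (b 2) => /=; lia.
  by case: (b 0); case: (b 1); case: (b 2) => /=; lia.
- rewrite /alpha !ffunE; case: k12 => ->; rewrite !I3E;
  by case: (b 0); case: (b 1); case: (b 2).
Qed.

Lemma rotop_cube k b c : mul_op (rotop k b c) (mul_op (rotop k b c) (rotop k b c)) = one_op.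
Proof.
have s j : osg (rotop k b c) j = j + k by rewrite /osg /dih /= addrC.
apply: op_eq => [||i|i]; first by [].
- by rewrite /=; move: k {s}; apply: I3_ind; apply: val_inj.
- rewrite !mul_oeE !s !ffunE.
  have -> : i + k + k + k = i by move: i k {s}; apply: I3_ind; apply: I3_ind; apply: val_inj.
  by case: (b i); case: (b (i + k)); case: (b (i + k + k)).
- rewrite !mul_otE !s !rotop_otE !ffunE [RHS]mxE.
  have -> : i + k + k + k = i by move: i k {s}; apply: I3_ind; apply: I3_ind; apply: val_inj.
  by case: (b i); case: (b (i + k)); case: (b (i + k + k)) => /=; ring.
Qed.

Lemma det_mx33 (R : comPzRingType) (A : 'M[R]_3) : \det A =
  A 0 0 * (A 1 1 * A 2 2 - A 1 2 * A 2 1)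
  - A 0 1 * (A 1 0 * A 2 2 - A 1 2 * A 2 0)
  + A 0 2 * (A 1 0 * A 2 1 - A 1 1 * A 2 0).
Proof.
have det2 (B : 'M[R]_2) : \det B = B 0 0 * B 1 1 - B 0 1 * B 1 0.
  rewrite (expand_det_row _ 0) !big_ord_recl big_ord0 /cofactor !det_mx11 !mxE /=.
  have E : (lift 0 0 = 1 :> 'I_2) * (lift 1 0 = 0 :> 'I_2) * (lift ord0 ord0 = 1 :> 'I_2)
    * (ord0 = 0 :> 'I_2).
    by do !split; apply: val_inj.
  rewrite !E /=; ring.
rewrite (expand_det_row _ 0) big_I3 /cofactor !det2 !mxE.
have E : (lift 0 0 = 1 :> 'I_3) * (lift 0 1 = 2 :> 'I_3) *
  (lift 1 0 = 0 :> 'I_3) * (lift 1 1 = 2 :> 'I_3) * (lift 2 0 = 0 :> 'I_3) *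
  (lift 2 1 = 1 :> 'I_3) by do !split; apply: val_inj.
rewrite !E /=; ring.
Qed.

Lemma sqr_sum3_eq0 (R : realType) (x y z : R) :
  x ^+ 2 + y ^+ 2 + z ^+ 2 = 0 -> [/\ x = 0, y = 0 & z = 0].
Proof.
move=> /eqP; rewrite !paddr_eq0 ?addr_ge0 ?sqr_ge0 //.
by rewrite !sqrf_eq0 => /andP[/andP[/eqP -> /eqP ->] /eqP ->].
Qed.

(** By Lagrange's identity the squared distance from the first row to the cross product of the other
    two is 1 - 0 + 1 - 2 det = 0. *)
Lemma cross_row (R : realType) (a b c d e f g h i : R) :
  a ^+ 2 + b ^+ 2 + c ^+ 2 = 1 -> d ^+ 2 + e ^+ 2 + f ^+ 2 = 1 ->
  g ^+ 2 + h ^+ 2 + i ^+ 2 = 1 -> d * g + e * h + f * i = 0 ->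
  a * (e * i - f * h) - b * (d * i - f * g) + c * (d * h - e * g) = 1 ->
  [/\ e * i - f * h = a, f * g - d * i = b & d * h - e * g = c].
Proof.
move=> r0 r1 r2 r12 dt.
have : (e * i - f * h - a) ^+ 2 + (f * g - d * i - b) ^+ 2 + (d * h - e * g - c) ^+ 2 = 0.
  transitivity ((d ^+ 2 + e ^+ 2 + f ^+ 2) * (g ^+ 2 + h ^+ 2 + i ^+ 2)
    - (d * g + e * h + f * i) ^+ 2 + (a ^+ 2 + b ^+ 2 + c ^+ 2)
    - 2 * (a * (e * i - f * h) - b * (d * i - f * g) + c * (d * h - e * g))).
    ring.
  by rewrite r0 r1 r2 r12 dt; ring.
by move/sqr_sum3_eq0 => [/subr0_eq -> /subr0_eq -> /subr0_eq ->].
Qed.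

(* The trace t of a rotation A satisfies t^2 = tr (A^2) + 2 t, and A^3 = 1 gives
   tr (A^2) = tr A^T = t; so t is 0 or 3, and t = 3 only for A = 1. *)
Lemma rotation111_entries (R : realType) (a b c d e f g h i : R) :
  a ^+ 2 + b ^+ 2 + c ^+ 2 = 1 -> d ^+ 2 + e ^+ 2 + f ^+ 2 = 1 ->
  g ^+ 2 + h ^+ 2 + i ^+ 2 = 1 -> a * d + b * e + c * f = 0 ->
  d * g + e * h + f * i = 0 -> g * a + h * b + i * c = 0 ->
  a * (e * i - f * h) - b * (d * i - f * g) + c * (d * h - e * g) = 1 ->
  a ^+ 2 + e ^+ 2 + i ^+ 2 + 2 * (b * d + c * g + f * h) = a + e + i ->
  a + d + g = 1 -> b + e + h = 1 -> c + f + i = 1 ->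
  ~ [/\ a = 1, e = 1 & i = 1] ->
  [/\ a = 0, e = 0 & i = 0] /\
  ([/\ b = 0, d = 1, c = 1, g = 0 & f = 0 /\ h = 1] \/
   [/\ b = 1, d = 0, c = 0, g = 1 & f = 1 /\ h = 0]).
Proof.
move=> r0 r1 r2 r01 r12 r20 dt tr c0 c1 c2 n1.
have [m0 _ _] := cross_row r0 r1 r2 r12 dt.
have [|_ m1 _] := cross_row r1 r2 r0 r20; first by move: dt; lra.
have [|_ _ m2] := cross_row r2 r0 r1 r01; first by move: dt; lra.
pose t := a + e + i.
have tt : t * (t - 3) = 0.
  have : t ^+ 2 = a ^+ 2 + e ^+ 2 + i ^+ 2 + 2 * (b * d + c * g + f * h) +
    2 * ((e * i - f * h) + (i * a - g * c) + (a * e - b * d)).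
    by rewrite /t; ring.
  rewrite tr; move: m0 m1 m2; rewrite /t; lra.
have t0 : t = 0.
  move/eqP: tt; rewrite mulf_eq0 => /orP[/eqP //|/eqP t3].
  exfalso; apply: n1; have le1 (x y z : R) : x ^+ 2 + y ^+ 2 + z ^+ 2 = 1 -> x <= 1.
    by move=> h1; have := sqr_ge0 y; have := sqr_ge0 z; nra.
  have := le1 _ _ _ r0; have := le1 e d f; have := le1 i g h.
  move=> h1 h2 h3; have {}h1 : i <= 1 by apply: h1; rewrite -r2; ring.
  have {}h2 : e <= 1 by apply: h2; rewrite -r1; ring.
  by move: t3; rewrite /t; split; lra.
have q : a ^+ 2 + e ^+ 2 + i ^+ 2 = 0 /\
    (b + d - 1) ^+ 2 + (c + g - 1) ^+ 2 + (f + h - 1) ^+ 2 = 0.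
  (* The row norms, tr (A^2) = t = 0 and the column sums make this sum of squares vanish: the
     diagonal is 0 and opposite entries add up to 1. *)
  have s : 4 * (a ^+ 2 + e ^+ 2 + i ^+ 2) + 2 * ((b + d - 1) ^+ 2 + (c + g - 1) ^+ 2 + (f + h - 1) ^+ 2) = 0.
    transitivity (2 * (a ^+ 2 + b ^+ 2 + c ^+ 2) + 2 * (d ^+ 2 + e ^+ 2 + f ^+ 2)
     + 2 * (g ^+ 2 + h ^+ 2 + i ^+ 2)
     + 2 * (a ^+ 2 + e ^+ 2 + i ^+ 2 + 2 * (b * d + c * g + f * h))
     - 4 * ((a + d + g) + (b + e + h) + (c + f + i)) + 4 * t + 6).
      by rewrite /t; ring.
    by rewrite r0 r1 r2 tr c0 c1 c2 -/t t0; ring.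
  have := sqr_ge0 a; have := sqr_ge0 e; have := sqr_ge0 i.
  have := sqr_ge0 (b + d - 1); have := sqr_ge0 (c + g - 1); have := sqr_ge0 (f + h - 1).
  by move=> *; split; lra.
case: q => /sqr_sum3_eq0[a0 e0 i0] /sqr_sum3_eq0[bd cg fh]; split=> //.
have : b * (b - 1) = 0.
  have cE : c = 1 - b by lra.
  by move: r0; rewrite cE a0; lra.
move/eqP; rewrite mulf_eq0 => /orP[/eqP b0|/eqP b1].
  by left; repeat split; lra.
by right; repeat split; lra.
Qed.

Lemma rotation_rotop (R : realType) (c : 'rV[int]_3) (u : 'rV[R]_3) g :
  (forall i, u 0 i = 1 \/ u 0 i = -1) -> rotation_about (map_mx intr c) u g ->
  order3 g -> exists k b, k != 0 /\ g = act (rotop k b c).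
Proof.
move=> u1 [A [AA dA uA gE]] [gn1 g3].
pose y : 'rV[R]_3 := map_mx intr c.
have yE i : y 0 i = (c 0 i)%:~R by rewrite mxE.
have u2 i : u 0 i ^+ 2 = 1 by case: (u1 i) => ->; rewrite ?sqrrN expr1n.
have gy z : g (y + z) = y + z *m A by rewrite gE -/y addrAC subrr add0r.
have A3 : A *m A *m A = 1%:M.
  apply/row_matrixP => i; rewrite row1 !row_mul rowE.
  have /(congr1 (fun h => h (y + delta_mx 0 i))) := g3.
  by rewrite /= !gy => /addrI.
have A2 : A *m A = A^T by rewrite -[LHS]mulmx1 -AA mulmxA A3 mul1mx.
have E i j : A i 0 * A j 0 + A i 1 * A j 1 + A i 2 * A j 2 = (i == j)%:R.
  have := congr1 (fun M : 'M[R]_3 => M i j) AA.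
  by rewrite /= !mxE big_I3 !mxE.
have T i : A i 0 * A 0 i + A i 1 * A 1 i + A i 2 * A 2 i = A i i.
  have := congr1 (fun M : 'M[R]_3 => M i i) A2.
  by rewrite /= !mxE big_I3.
have C j : u 0 0 * A 0 j + u 0 1 * A 1 j + u 0 2 * A 2 j = u 0 j.
  have := congr1 (fun M : 'rV[R]_3 => M 0 j) uA.
  by rewrite /= !mxE big_I3.
(* Conjugation by the diagonal matrix of [u] turns the axis to direction (1,1,1). *)
pose B i j := u 0 i * A i j * u 0 j.
have Bn i : B i 0 ^+ 2 + B i 1 ^+ 2 + B i 2 ^+ 2 = 1.
  by rewrite /B !exprMn !u2 !mulr1 !mul1r !expr2 E eqxx.
have Bo i j : i != j -> B i 0 * B j 0 + B i 1 * B j 1 + B i 2 * B j 2 = 0.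
  move=> ij; transitivity (u 0 i * u 0 j * (A i 0 * A j 0 * u 0 0 ^+ 2 +
     A i 1 * A j 1 * u 0 1 ^+ 2 + A i 2 * A j 2 * u 0 2 ^+ 2)).
    by rewrite /B; ring.
  by rewrite !u2 !mulr1 E (negbTE ij) mulr0.
have BC j : B 0 j + B 1 j + B 2 j = 1.
  by rewrite /B -!mulrDl C -expr2 u2.
have Bd i : B i i = A i i by rewrite /B mulrAC -expr2 u2 mul1r.
have BB i j : B i j * B j i = A i j * A j i.
  transitivity (u 0 i ^+ 2 * u 0 j ^+ 2 * (A i j * A j i)); first by rewrite /B; ring.
  by rewrite !u2 !mul1r.
have [|||[B0 B1 B2] Bk] := rotation111_entries (Bn 0) (Bn 1) (Bn 2)
    (Bo 0 1 isT) (Bo 1 2 isT) (Bo 2 0 isT) _ _ (BC 0) (BC 1) (BC 2).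
- transitivity (u 0 0 ^+ 2 * u 0 1 ^+ 2 * u 0 2 ^+ 2 * \det A).
    by rewrite det_mx33 /B; ring.
  by rewrite !u2 dA !mulr1.
- rewrite !BB !Bd; have := T 0; have := T 1; have := T 2; lra.
- rewrite !Bd => -[a e i]; apply: gn1; apply/funext => x.
  have ii j : A j j = 1 by move: j; apply: I3_ind.
  have sq0 (p q r : R) : p ^+ 2 + q ^+ 2 + r ^+ 2 = 1 ->
      [/\ p = 1 -> q = 0 /\ r = 0, q = 1 -> p = 0 /\ r = 0 & r = 1 -> p = 0 /\ q = 0].
    move=> h; split=> h1; move: h; rewrite h1 expr1n => h.
    - by have [|//] := @sqr_sum3_eq0 R 0 q r; lra.
    - by have [|//] := @sqr_sum3_eq0 R 0 p r; lra.
    - by have [|//] := @sqr_sum3_eq0 R 0 p q; lra.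
  have off i0 j : i0 != j -> A i0 j = 0.
    have := E i0 i0; rewrite eqxx -!expr2.
    move=> /sq0 []; have := ii i0; move: i0 j.
    apply: I3_ind; apply: I3_ind => // h h0 h1 h2 _.
    - by case: (h0 h).
    - by case: (h0 h).
    - by case: (h1 h).
    - by case: (h1 h).
    - by case: (h2 h).
    - by case: (h2 h).
  have A1 : A = 1%:M.
    apply/matrixP => i0 j; rewrite !mxE; case: eqP => [->|/eqP /off ->] //.
  by rewrite gE A1 mulmx1 addrC subrK.
have AB i j : A i j = u 0 i * B i j * u 0 j.
  transitivity (u 0 i ^+ 2 * u 0 j ^+ 2 * A i j); last by rewrite /B; ring.
  by rewrite !u2 !mul1r.
pose b j := u 0 j == -1.
have ub i j : u 0 i * u 0 j = if b j (+) b i then -1 else 1.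
  have m1 : (1 == -1 :> R) = false by apply/eqP; lra.
  by rewrite /b; case: (u1 i) => ->; case: (u1 j) => ->; rewrite ?eqxx ?m1 /=; ring.
have key k : k != 0 -> (forall i j, B i j = (i == j + k)%:R) ->
   g = act (rotop k b c).
  move=> k0 Bk'; apply/funext => x; apply/rowP => j.
  rewrite gE actE rotop_otE ffunE /osg /dih /= (addrC k) 3!mxE.
  rewrite (bigD1 (j + k)) //= big1 ?addr0.
    by rewrite AB Bk' eqxx mulr1 ub !mxE; case: ifP => _; rewrite ?rmorphM ?rmorphB ?rmorphN /=; field.
  by move=> i ij; rewrite AB Bk' (negbTE ij) mulr0 mul0r mulr0.
case: Bk => [[b01 b10 b02 b20 [b12 b21]]|[b01 b10 b02 b20 [b12 b21]]].
- exists 1, b; split=> //; apply: key => //.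
  by apply: I3_ind; apply: I3_ind; rewrite ?I3E ?B0 ?B1 ?B2 ?b01 ?b10 ?b02 ?b20 ?b12 ?b21.
- exists 2, b; split=> //; apply: key => //.
  by apply: I3_ind; apply: I3_ind; rewrite ?I3E ?B0 ?B1 ?B2 ?b01 ?b10 ?b02 ?b20 ?b12 ?b21.
Qed.

Lemma rotop_order3 (R : realType) k b c : k != 0 -> order3 (@act R (rotop k b c)).
Proof.
move=> k0; split.
  move=> h; have : rotop k b c = one_op.
    by apply: (@act_inj R); rewrite h; apply/funext => x; rewrite act_one.
  by move/(congr1 ok) => /= /eqP; rewrite (negbTE k0).
by apply/funext => x /=; rewrite -!act_mul -mul_opA rotop_cube act_one.
Qed.

Lemma rotop_rotation (R : realType) (b : 'I_3 -> bool) (c : 'rV[int]_3) :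
  rotation_about (map_mx intr c) (\row_j (-1) ^+ b j) (@act R (rotop 1 b c)).
Proof.
pose s (j : 'I_3) : R := (-1) ^+ b j.
have s2 j : s j * s j = 1 by rewrite -expr2 sqrr_sign.
pose A : 'M[R]_3 := \matrix_(i, j) (s j * s i * (i == j + 1)%:R).
exists A; split.
- apply/matrixP => i j; rewrite !mxE big_I3 !mxE.
  by move: i j; apply: I3_ind; apply: I3_ind;
    rewrite !I3E /= ?mulr0 ?mulr1 ?addr0 ?add0r ?mul0r // mulrACA !s2 mulr1.
- rewrite det_mx33 !mxE !I3E /=.
  transitivity ((s 0 * s 0) * (s 1 * s 1) * (s 2 * s 2)); first by ring.
  by rewrite !s2 !mulr1.
- apply/rowP => j; rewrite !mxE big_I3 !mxE -!/(s _).
  by move: j; apply: I3_ind; rewrite !I3E /= ?mulr0 ?mulr1 ?addr0 ?add0r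
   mulrCA s2 mulr1.
- move=> x; apply/rowP => j.
  rewrite actE rotop_otE ffunE /osg /dih /= (addrC 1) 3!mxE.
  rewrite (bigD1 (j + 1)) //= big1 ?addr0.
    rewrite !mxE eqxx mulr1 /s -signr_addb.
    by case: (b j (+) b (j + 1)); rewrite ?rmorphM ?rmorphB ?rmorphN /=; field.
  by move=> i ij; rewrite !mxE (negbTE ij) !mulr0.
Qed.

(** For the converse inclusion, a half-turn is the quotient of rotations about two different
    threefold axes through 0, and a translation is the quotient of rotations about two parallel
    ones. *)
Lemma R1_F23op (R : realType) : R1 R = [set @act R d | d in F23op].
Proof.
have sF : isom_subgroup [set @act R d | d in F23op].
  exact/isom_subgroup_act/opgroup_F23op.
rewrite /R1; set S := (X in generated X).
have SF : S `<=` [set @act R d | d in F23op].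
  move=> g [g3 [c [u [u1 gr]]]].
  have [k [b [k0 ->]]] := rotation_rotop u1 gr g3.
  by exists (rotop k b c) => //; apply: F23op_rotop.
have sR : isom_subgroup (generated S) := isom_subgroup_generated sF SF.
apply/seteqP; split; first by move=> g /(_ _ (conj sF SF)).
pose D := [set d | (generated S) (idfun \o @act R d \o idfun)].
suff FD : F23op `<=` D by move=> _ [d /FD + <-].
have gD : opgroup D by apply: opgroup_pull.
have [D1 DM DV] := gD.
have Drot b c : D (rotop 1 b c).
  move=> K [sK SK]; apply: SK; split; first exact: rotop_order3.
  exists c, (\row_j (-1) ^+ b j); split; last exact: rotop_rotation.
  by move=> i; rewrite mxE; case: (b i); [right|left]; rewrite ?expr1 ?expr0.
have Dc : D (linop false 1 false false false).
  have := Drot (fun=> false) 0; congr D; apply: op_eq => [||i|i] //.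
  - by rewrite !ffunE; move: i; apply: I3_ind.
  - by rewrite rotop_otE !mxE subrr mul0r.
apply: F23op_gen => //.
- have := DM _ _ (Drot (pred1 1) 0) (DV _ Dc); congr D; apply: op_eq => [||i|i] //.
  + exact: val_inj.
  + by rewrite mul_oeE !ffunE; move: i; apply: I3_ind.
  + rewrite mul_otE inv_otE rotop_otE !mxE; case: ifP; case: ifP; by rewrite ?oppr0 ?subrr ?mul0r ?addr0; case: ifP; rewrite ?oppr0.
- rewrite -(mulopK (rotop 1 (pred1 2) 0) (trop _)); apply: DM (DV _ (Drot _ _)).
  have := Drot (pred1 2) (vec3z 0 0 1); congr D; apply: op_eq => [||i|i] //.
  + exact: val_inj.
  + by rewrite mul_oeE osg_trop !ffunE.
  + rewrite mul_otE osg_trop !rotop_otE ffunE.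
    by move: i; apply: I3_ind; rewrite !I3E !mxE.
Qed.

Lemma int_norm4 (a b c : int) : a ^+ 2 + b ^+ 2 + c ^+ 2 = 4 ->
  [\/ (a = 2 \/ a = -2) /\ b = 0 /\ c = 0, (b = 2 \/ b = -2) /\ a = 0 /\ c = 0 |
      (c = 2 \/ c = -2) /\ a = 0 /\ b = 0].
Proof.
rewrite !expr2 => h.
have bd (x y z : int) : x * x + y * y + z * z = 4 ->
    [\/ x = 2 \/ x = -2, x = 1 \/ x = -1 | x = 0].
  move=> e; have : -2 <= x <= 2 by nia.
  move=> ?; have [|[|]] : (x = 2 \/ x = -2) \/ (x = 1 \/ x = -1) \/ x = 0 by lia.
  - by constructor 1.
  - by constructor 2.
  - by constructor 3.
have ha := bd _ _ _ h; have hb : b * b + a * a + c * c = 4 by lia.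
have hc : c * c + b * b + a * a = 4 by lia.
move: h; case: (bd _ _ _ hb) => [[]|[]|] ->; case: (bd _ _ _ hc) => [[]|[]|] ->;
  case: ha => [[]|[]|] -> h; try (exfalso; lia);
  by [constructor 1; auto | constructor 2; auto | constructor 3; auto].
Qed.

Lemma act0E (R : realType) d j : act d (0 : 'rV[R]_3) 0 j = (ot d 0 j)%:~R / 2.
Proof. by rewrite actE !mxE oppr0 if_same add0r. Qed.

Lemma dih_perm (t : 'I_3 -> 'I_3) : t 0 != t 1 -> t 1 != t 2 -> t 2 != t 0 ->
  exists m k, forall i, t (dih m k i) = i.
Proof.
move=> h01 h12 h20.
have [m [k [h0 h1 h2]]] : exists m k,
    [/\ dih m k (t 0) = 0, dih m k (t 1) = 1 & dih m k (t 2) = 2].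
  move: (t 0) (t 1) (t 2) h01 h12 h20; do 3!apply: I3_ind => //; move=> _ _ _.
  - by exists false, 0; split; apply: val_inj.
  - by exists true, 0; split; apply: val_inj.
  - by exists true, 1; split; apply: val_inj.
  - by exists false, 2; split; apply: val_inj.
  - by exists false, 1; split; apply: val_inj.
  - by exists true, 2; split; apply: val_inj.
pose d := Op m k [ffun=> false] 0.
exists m, k => i; rewrite -[dih m k i]/(osg d i).
have h j : osg d (t j) = j by move: j; apply: I3_ind.
have ht j : t j = inv_sg d j by rewrite -[LHS](osgK d) h.
by rewrite ht osgK.
Qed.

(** The linear part maps D3 into itself, and 2e_i is a sum of two vectors of D3. So twice each row
    of the orthogonal matrix [A] is integral of squared length 4, which leaves signed permutations.
    The images of two half-turns about axes through 0 then show that the entries of 2b are integers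
    of equal parity. *)
Lemma normalizer_bcc (R : realType) (g h : 'rV[R]_3 -> 'rV[R]_3) :
  isometry g -> cancel g h -> cancel h g ->
  (forall d, F23op d -> exists2 d', F23op d' & forall x, g (act d (h x)) = act d' x) ->
  exists2 n, bcc n & g = act n.
Proof.
move=> gi gh hg nF; have [A [b [AA gE]]] := isometry_affine gi.
have E i j : A i 0 * A j 0 + A i 1 * A j 1 + A i 2 * A j 2 = (i == j)%:R.
  have := congr1 (fun M : 'M[R]_3 => M i j) AA.
  by rewrite /= !mxE big_I3 !mxE.
have tr t : F23op (trop t) -> exists w : 'I_3 -> int,
    forall j, modz (w j) 2 = 0 /\
      (w j)%:~R = (t 0 0)%:~R * A 0 j + (t 0 1)%:~R * A 1 j + (t 0 2)%:~R * A 2 j.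
  move=> Ft; have [d' [Nd' cd' _ _] d'E] := nF _ Ft; exists (fun j => ot d' 0 j) => j.
  split; first by move: (j) Nd' cd'; rewrite /bcc /cl; apply: I3_ind; lia.
  have : g (act (trop t) (h 0)) = (\row_i ((t 0 i)%:~R / 2)) *m A.
    rewrite gE (_ : act (trop t) (h 0) = h 0 + \row_i ((t 0 i)%:~R / 2)).
      by rewrite mulmxDl addrAC -gE hg add0r.
    by apply/rowP => l; rewrite actE osg_trop ffunE !mxE.
  rewrite d'E => /rowP /(_ j); rewrite act0E mxE big_I3 !mxE /= => hh.
  lra.
have half i : exists z : 'I_3 -> int, forall j, (z j)%:~R = 2 * A i j.
  have sum (t u : 'rV[int]_3) : F23op (trop t) -> F23op (trop u) ->
      (forall l, (t + u) 0 l = if l == i then 4 else 0) ->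
      exists z : 'I_3 -> int, forall j, (z j)%:~R = 2 * A i j.
    move=> /tr [w wE] /tr [v vE] tu; exists (fun j => divz (w j + v j) 2) => j.
    have [we wj] := wE j; have [ve vj] := vE j.
    have : (w j + v j)%:~R = 4 * A i j.
      rewrite intrD wj vj.
      transitivity (((t + u) 0 0)%:~R * A 0 j + ((t + u) 0 1)%:~R * A 1 j +
        ((t + u) 0 2)%:~R * A 2 j).
        by rewrite ![in RHS]mxE !rmorphD /=; ring.
      by rewrite !tu; move: (i); apply: I3_ind => /=; ring.
    rewrite {1}(_ : w j + v j = divz (w j + v j) 2 * 2); last by lia.
    by rewrite intrM; lra.
  have HT (x y z : int) : modz x 2 = 0 -> modz y 2 = 0 -> modz z 2 = 0 ->
      modz (x + y + z) 4 = 0 -> F23op (trop (vec3z x y z)).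
    move=> ha hb hc habc; apply/F23op_trop.
    by rewrite /tbcc /tcl /bcc /cl /= !vec3z_E ha hb hc habc eqxx.
  move: i sum; apply: I3_ind => sum.
  - apply: (sum (vec3z 2 2 0) (vec3z 2 (- 2) 0)); [exact: HT|exact: HT|].
    by apply: I3_ind; rewrite !mxE.
  - apply: (sum (vec3z 2 2 0) (vec3z (- 2) 2 0)); [exact: HT|exact: HT|].
    by apply: I3_ind; rewrite !mxE.
  - apply: (sum (vec3z 2 0 2) (vec3z (- 2) 0 2)); [exact: HT|exact: HT|].
    by apply: I3_ind; rewrite !mxE.
have unit i : exists p : 'I_3 * bool, forall j, A i j = if j == p.1 then (-1) ^+ p.2 else 0.
  have [z zE] := half i.
  have : z 0 ^+ 2 + z 1 ^+ 2 + z 2 ^+ 2 = 4.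
    apply: (@intr_inj R); rewrite !rmorphD /= !rmorphXn /= !zE.
    by have := E i i; rewrite eqxx mulr1z /= => h1; lra.
  have Az j : A i j = (z j)%:~R / 2 by rewrite zE; field.
  move/int_norm4 => [[z0 [z1 z2]]|[z1 [z0 z2]]|[z2 [z0 z1]]].
  - exists (0, (z 0 == - 2)); apply: I3_ind; rewrite Az ?z1 ?z2 /= ?mul0r //.
    by case: z0 => ->; rewrite /= ?expr0 ?expr1; field.
  - exists (1, (z 1 == - 2)); apply: I3_ind; rewrite Az ?z0 ?z2 /= ?mul0r //.
    by case: z1 => ->; rewrite /= ?expr0 ?expr1; field.
  - exists (2, (z 2 == - 2)); apply: I3_ind; rewrite Az ?z1 ?z0 /= ?mul0r //.
    by case: z2 => ->; rewrite /= ?expr0 ?expr1; field.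
have [p pE] := choice unit.
have pd i j : i != j -> (p i).1 != (p j).1.
  move=> ij; apply/eqP => pij; have := E i j; rewrite (negbTE ij) !pE pij.
  move: (p j).1; apply: I3_ind => /=; rewrite !(mulr0, addr0, add0r);
    case: (p i).2; case: (p j).2; rewrite ?expr0 ?expr1; lra.
have [m [k mk]] := dih_perm (t := fun i => (p i).1) (pd 0 1 isT) (pd 1 2 isT) (pd 2 0 isT).
pose a := Op m k [ffun i => (p (dih m k i)).2] 0.
have aE x : x *m A = act a x.
  apply/rowP => j; rewrite actE ffunE !mxE rmorph0 mul0r addr0 (bigD1 (osg a j)) //=.
  rewrite big1 ?addr0 => [|i ij].
    rewrite pE -[osg a j]/(dih m k j) mk eqxx; case: (p _).2; rewrite ?expr0 ?expr1; ring.
  rewrite pE; case: eqP => [ji|_]; last by rewrite mulr0.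
  by have := pd _ _ ij; rewrite -[osg a j]/(dih m k j) mk -ji eqxx.
have g0 : g 0 = b by rewrite gE mul0mx add0r.
have hb : h b = 0 by rewrite -g0 gh.
have Na : bcc a by rewrite /bcc !mxE.
(* g conjugates half-turns about axes through 0 to half-turns about axes through b. *)
have fix0 v : F23op v -> ot v = 0 -> exists w : 'I_3 -> int, forall j,
   modz (w j) 2 = 0 /\ (w j)%:~R = 2 * (b - act v b) 0 j
   /\ modz (w 0 + w 1 + w 2) 4 = 0.
  (* Undoing the linear part of [g] beforehand leaves, after conjugation by [g], just [v] recentred
     at [b], whose translation part is b - v b. *)
  move=> Fv v0; pose u := mul_op (inv_op a) (mul_op v (inv_op (inv_op a))).
  have Fu : F23op u := F23op_conj (bcc_inv Na) Fv.
  have [d' [Nd' cd' _ _] d'E] := nF _ Fu; exists (fun j => ot d' 0 j) => j.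
  split; first by move: (j) Nd' cd'; rewrite /bcc /cl; apply: I3_ind; lia.
  split; last exact: cd'.
  have ga y : g y = act a y + b by rewrite gE aE.
  have ah x : act a (h x) = x - b.
    by apply: (addIr b); rewrite subrK -ga hg.
  have : act d' 0 = b - act v b.
    rewrite -d'E ga /u !act_mul act_invr.
    have -> : act (inv_op (inv_op a)) (h 0) = act a (h 0).
      by rewrite -[in LHS](act_inv a (h 0)) act_inv.
    rewrite ah sub0r addrC; congr (_ + _); apply/rowP => l.
    by rewrite actE [RHS]mxE actE !mxE v0 mxE; case: ifP => _; ring.
  move/rowP/(_ j); rewrite act0E => <-; lra.
have [|//|w wE] := fix0 (linop false 0 false true true).
  by split; rewrite // /bcc /cl /alpha ?linop_oeE ?mxE.
have [|//|w' wE'] := fix0 (linop false 0 true true false).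
  by split; rewrite // /bcc /cl /alpha ?linop_oeE ?mxE.
have e1 : [/\ (w 0)%:~R = 0 :> R, (w 1)%:~R = 4 * b 0 1 & (w 2)%:~R = 4 * b 0 2].
  have [_ [w0 _]] := wE 0; have [_ [w1 _]] := wE 1; have [_ [w2 _]] := wE 2.
  rewrite w0 w1 w2 !mxE !ffunE /osg /dih /= !I3E ?mxE.
  by split; ring.
have e2 : [/\ (w' 0)%:~R = 4 * b 0 0, (w' 1)%:~R = 4 * b 0 1 & (w' 2)%:~R = 0 :> R].
  have [_ [w0 _]] := wE' 0; have [_ [w1 _]] := wE' 1; have [_ [w2 _]] := wE' 2.
  rewrite w0 w1 w2 !mxE !ffunE /osg /dih /= !I3E ?mxE.
  by split; ring.
have [r0 r1 r2] := e1; have [r0' r1' r2'] := e2.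
have w11 : w' 1 = w 1 by apply: (@intr_inj R); rewrite r1 r1'.
have w00 : w 0 = 0 by apply: (@intr_inj R); rewrite r0.
have w22 : w' 2 = 0 by apply: (@intr_inj R); rewrite r2'.
pose t := vec3z (divz (w' 0) 2) (divz (w 1) 2) (divz (w 2) 2).
exists (Op m k (oe a) t).
  have [v0 [_ s0]] := wE 1; have [v1 [_ _]] := wE 2; have [u0 [_ s1]] := wE' 0.
  by rewrite /bcc !vec3z_E; move: s0 s1; rewrite w11 w00 w22; lia.
have half_eq (l : int) (y : R) : modz l 2 = 0 -> l%:~R = 4 * y -> (divz l 2)%:~R / 2 = y.
  move=> le; rewrite (_ : l = divz l 2 * 2); last by lia.
  by rewrite mulzK // intrM; lra.
apply/funext => x; rewrite gE aE; apply/rowP => l.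
rewrite mxE !actE mxE mul0r addr0; congr (_ + _).
have [v1 _] := wE 1; have [v2 _] := wE 2; have [u0 _] := wE' 0.
by move: (l); apply: I3_ind; rewrite vec3z_E; apply/esym/half_eq.
Qed.

(** * Coordinates for a full cubic group *)

Lemma odd_subgroup_sub (R : realType) (G : set ('rV[R]_3 -> 'rV[R]_3)) :
  isom_subgroup G -> odd_subgroup G `<=` G.
Proof. by move=> sG g; apply; split => // h []. Qed.

Lemma order3_conj (T : Type) (r g h : T -> T) : cancel g h -> cancel h g ->
  order3 r -> order3 (g \o r \o h).
Proof.
move=> gh hg [r1 r3]; split.
  move=> e; apply: r1; apply/funext => x.
  by have := congr1 (fun F => h (F (g x))) e; rewrite /= !gh.
apply/funext => x /=; rewrite !gh.
by have := congr1 (fun F => F (h x)) r3; rewrite /= => ->.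
Qed.

Lemma rotation_about_conj (R : realType) (c u : 'rV[R]_3) r g h :
  isometry g -> cancel g h -> cancel h g -> u != 0 -> rotation_about c u r ->
  exists c' u', u' != 0 /\ rotation_about c' u' (g \o r \o h).
Proof.
move=> gi gh hg u0 [A [AA dA uA rE]]; have [M [b [MM gE]]] := isometry_affine gi.
have MTM := mulmx1C MM.
have hE x : h x = (x - b) *m M^T.
  by rewrite -{2}(hg x) gE addrK -mulmxA MM mulmx1.
exists (g c), (u *m M); split.
  apply: contra_neq u0 => uM; by rewrite -(mulmx1 u) -MM mulmxA uM mul0mx.
exists (M^T *m A *m M); split.
- by rewrite !trmx_mul trmxK !mulmxA -(mulmxA _ M) MM mulmx1 -(mulmxA _ A) AA mulmx1.
- rewrite !det_mulmx dA mulr1 det_tr -expr2.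
  have := congr1 determinant MM; rewrite det_mulmx det_tr det1 => dM.
  by rewrite expr2.
- by rewrite !mulmxA -(mulmxA u) MM mulmx1 uA.
- move=> x; have E : (x - g c) *m M^T = h x - c.
    by rewrite hE gE opprD addrCA addrC mulmxDl mulNmx -(mulmxA c) MM mulmx1.
  by rewrite /= [LHS]gE rE mulmxDl !mulmxA E [in RHS]gE addrAC.
Qed.

(** For a group [H] containing the generators, the isometries [s] with [g \o s \o h] in [H] include
    a group containing the generators too, since elements of [G] conjugate threefold rotations of
    [G] to such rotations. *)
Lemma odd_subgroup_normal (R : realType) (G : set ('rV[R]_3 -> 'rV[R]_3)) g h r :
  isom_subgroup G -> G g -> cancel g h -> cancel h g ->
  odd_subgroup G r -> odd_subgroup G (g \o r \o h).
Proof.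
move=> sG Gg gh hg Or H [sH SH]; have [GI G1 GM GV] := sG.
have Gh := isom_subgroup_inv sG Gg gh hg.
have [HI H1 HM HV] := sH.
suff : [set s : 'rV[R]_3 -> 'rV[R]_3 | H (g \o s \o h)] r by [].
apply: Or; split; first split.
- move=> s Hs x y; have := HI _ Hs (g x) (g y); rewrite /= !gh.
  by rewrite !(GI _ Gg).
- by move: H1; congr H; apply/funext => x /=; rewrite hg.
- move=> s s' /= Hs Hs'; have := HM _ _ Hs Hs'; congr H.
  by apply/funext => x /=; rewrite gh.
- move=> s /= Hs; have [t Ht [st ts]] := HV _ Hs; exists (h \o t \o g).
    by move: Ht; congr H; apply/funext => x /=; rewrite !hg.
  split=> x /=.
    by have := st (g x); rewrite /= gh => ->; rewrite gh.
  by apply: (can_inj gh); have := ts (g x) => /=.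
- move=> s [Gs s3 [c [u [u0 rs]]]]; apply: SH; split.
  + by apply: (GM _ _ _ Gh); apply: GM.
  + exact: order3_conj.
  + exact: rotation_about_conj (GI _ Gg) gh hg u0 rs.
Qed.

Lemma isom_subgroup_conj (R : realType) (G : set ('rV[R]_3 -> 'rV[R]_3)) f f' :
  similarity f -> cancel f f' -> cancel f' f -> isom_subgroup G ->
  isom_subgroup (conjugate f f' G).
Proof.
move=> [k k0 fk] ff' f'f [GI G1 GM GV]; split.
- move=> _ [g Gg <-] x y /=; rewrite fk (GI _ Gg) -fk !f'f //.
- by exists idfun => //; apply/funext => x /=; rewrite f'f.
- move=> _ _ [g Gg <-] [g' Gg' <-]; exists (g \o g'); first exact: GM.
  by apply/funext => x /=; rewrite ff'.
- move=> _ [g Gg <-]; have [h Gh [gh hg]] := GV g Gg.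
  exists (f \o h \o f'); first by exists h.
  by split=> x /=; rewrite ff' ?gh ?hg f'f.
Qed.

Definition coord_ops (R : realType) (G : set ('rV[R]_3 -> 'rV[R]_3)) f f' : set op :=
  [set d | G (f' \o @act R d \o f)].

Definition cubic_coords (R : realType) (G : set ('rV[R]_3 -> 'rV[R]_3)) f f' : Prop :=
  [/\ similarity f, cancel f f', cancel f' f, admissible (coord_ops G f f') &
      G = [set f' \o act d \o f | d in coord_ops G f f']].

Lemma full_cubic_coords (R : realType) (G : set ('rV[R]_3 -> 'rV[R]_3)) :
  full_cubic G -> exists f f', cubic_coords G f f'.
Proof.
move=> [[[sG _] _] [f [f' [fs ff' f'f oddG]]]]; exists f, f'.
have sG1 := isom_subgroup_conj fs ff' f'f sG.
have conjE g : conjugate f f' G g -> G (f' \o g \o f).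
  by move=> [g' Gg' <-]; move: Gg'; congr G; apply/funext => x /=; rewrite !ff'.
have FG d : F23op d -> conjugate f f' G (@act R d).
  by move=> Fd; apply: (odd_subgroup_sub sG1); rewrite oddG R1_F23op; exists d.
have bccG g : G g -> exists2 d, bcc d & f \o g \o f' = act d.
  move=> Gg; have G1g : conjugate f f' G (f \o g \o f') by exists g.
  have [GI _ _ GV] := sG1; have [h G1h [gh hg]] := GV _ G1g.
  apply: (normalizer_bcc (GI _ G1g) gh hg) => d Fd.
  have : odd_subgroup (conjugate f f' G) (@act R d) by rewrite oddG R1_F23op; exists d.
  move/(odd_subgroup_normal sG1 G1g gh hg); rewrite oddG R1_F23op => -[d' Fd' d'E].
  by exists d' => // x; rewrite d'E.
split => //.
- split; first exact: opgroup_pull.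
  + by move=> d /FG /conjE.
  + move=> d /bccG [d' Nd' d'E].
    suff -> : d = d' by [].
    by apply: (@act_inj R); rewrite -d'E; apply/funext => x /=; rewrite !f'f.
- apply/seteqP; split; last by move=> _ [d Dd <-].
  move=> g Gg; have [d Nd dE] := bccG g Gg; exists d.
    by rewrite /coord_ops /= -dE; move: Gg; congr G; apply/funext => x /=; rewrite !ff'.
  by rewrite -dE; apply/funext => x /=; rewrite !ff'.
Qed.

Lemma inv_op_unique a b : mul_op a b = one_op -> inv_op a = b.
Proof. by move=> ab; rewrite -(mulKop a b) ab mulop1. Qed.

Lemma similarity_comp_act (R : realType) (f : 'rV[R]_3 -> 'rV[R]_3) n :
  similarity f -> similarity (act n \o f).
Proof. by move=> [k k0 fk]; exists k => // x y; rewrite /= act_isometry fk. Qed.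

(** Elements of the normalizer of R1 serve as changes of coordinates; they bring the base point to
    its normal form. *)
Lemma cubic_coords_comp (R : realType) (G : set ('rV[R]_3 -> 'rV[R]_3)) f f' n :
  bcc n -> cubic_coords G f f' ->
  cubic_coords G (act n \o f) (f' \o act (inv_op n)).
Proof.
move=> Nn [fs ff' f'f [gD FD ND] GE]; have Nv := bcc_inv Nn.
have conjE d : coord_ops G (act n \o f) (f' \o act (inv_op n)) d <->
    coord_ops G f f' (mul_op (inv_op n) (mul_op d n)).
  rewrite /coord_ops /=.
  have -> // : f' \o @act R (inv_op n) \o act d \o (act n \o f) =
     f' \o act (mul_op (inv_op n) (mul_op d n)) \o f.
  by apply/funext => x /=; rewrite !act_mul.
split.
- exact: similarity_comp_act.
- by move=> x /=; rewrite act_inv ff'.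
- by move=> x /=; rewrite f'f act_invr.
- have [D1 DM DV] := gD; split; first split.
  + by apply/conjE; rewrite mul1op mulVop.
  + move=> a b /conjE Da /conjE Db; apply/conjE; have := DM _ _ Da Db.
    by rewrite -!mul_opA (mul_opA n) mulopV mul1op.
  + move=> a /conjE Da; apply/conjE; have := DV _ Da; congr (coord_ops G f f').
    by apply: inv_op_unique; rewrite -!mul_opA !mulKVop mulVop.
  + move=> d Fd; apply/conjE/FD; have := F23op_conj Nv Fd.
    by have -> : inv_op (inv_op n) = n by apply: inv_op_unique; rewrite mulVop.
  + move=> d /conjE /ND Nd; have := bcc_mul Nn (bcc_mul Nd Nv).
    by rewrite -!mul_opA mulopV mulop1 mulKVop.
- apply/seteqP; split; last by move=> _ [d Dd <-].
  move=> g; rewrite {1}GE => -[d Dd <-].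
  exists (mul_op n (mul_op d (inv_op n))).
    by apply/conjE; rewrite -!mul_opA mulVop mulop1 mulKop.
  by apply/funext => x /=; rewrite !act_mul !act_inv.
Qed.

(** * Discreteness, and transfer of the minimality hypothesis *)

Lemma ball_row (R : realType) (x y : 'rV[R]_3) e : ball x e y ->
  forall i, `|x 0 i - y 0 i| < e.
Proof. by move=> [_ h] i; apply: h. Qed.

(** Singletons are compact, so closeness at two points defines a neighbourhood in the compact-open
    topology. *)
Lemma isolated_two_points (R : realType) (G : set ('rV[R]_3 -> 'rV[R]_3))
    (a b : 'rV[R]_3) (e : R) : 0 < e ->
  (forall g h, G g -> G h -> ball (g a) e (h a) -> ball (g b) e (h b) -> h = g) ->
  G `<=` @isolated {compact-open, 'rV[R]_3 -> 'rV[R]_3} G.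
Proof.
move=> e0 sep g Gg; split; first exact: mem_set.
pose U (c : 'rV[R]_3) : set {compact-open, 'rV[R]_3 -> 'rV[R]_3} :=
  [set h : 'rV[R]_3 -> 'rV[R]_3 | h @` [set c] `<=` ball (g c) e].
have Ug c : nbhs (g : {compact-open, 'rV[R]_3 -> 'rV[R]_3}) (U c).
  apply: open_nbhs_nbhs; split.
    apply: compact_open_open; [exact: compact_set1|exact: ball_open].
  by move=> _ [_ -> <-]; apply: ballxx.
exists (U a `&` U b); first exact: filterI.
apply/seteqP; split => [h [[Ua Ub] Gh]|h ->]; last first.
  by split => //; split; apply: nbhs_singleton (Ug _).
by apply: sep => //; [apply: Ua|apply: Ub]; [exists a|exists b].
Qed.

Lemma similarity_inv (R : realType) (f f' : 'rV[R]_3 -> 'rV[R]_3) :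
  similarity f -> cancel f' f -> similarity f'.
Proof.
move=> [k k0 fk] f'f; exists k^-1; first by rewrite invr_gt0.
by move=> x y; rewrite -{2}(f'f x) -{2}(f'f y) fk mulKf // gt_eqF.
Qed.

Lemma act_int_sub (R : realType) d d' (v : 'rV[R]_3) i :
  (forall i, exists m : int, v 0 i = m%:~R) ->
  exists m : int, act d v 0 i - act d' v 0 i = m%:~R / 2.
Proof.
move=> vz; rewrite !actE; have [m ->] := vz (osg d i); have [n ->] := vz (osg d' i).
exists ((if oe d i then - m else m) * 2 + ot d 0 i
  - ((if oe d' i then - n else n) * 2 + ot d' 0 i)).
by rewrite rmorphB /= !intrD !intrM; case: ifP; case: ifP => _ _; rewrite ?rmorphN /=; field.
Qed.

Lemma act_close (R : realType) (d d' : op) (v : 'rV[R]_3) :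
  (forall i, exists m : int, v 0 i = m%:~R) ->
  edist (act d v) (act d' v) < 1 / 2 -> act d v = act d' v.
Proof.
move=> vz h; apply/rowP => i; have [m mE] := act_int_sub d d' i vz.
suff m0 : m = 0 by apply/eqP; rewrite -subr_eq0 mE m0 mul0r.
have h2 : dot (act d v - act d' v) (act d v - act d' v) < 1 / 4.
  rewrite -eucl_edist_sq; have -> : 1 / 4 = (1 / 2) ^+ 2 :> R by field.
  by rewrite (ltr_pXn2r (n := 2)) // nnegrE; [exact: eucl_edist_ge0|lra].
have h3 : (act d v 0 i - act d' v 0 i) ^+ 2 < 1 / 4.
  apply: le_lt_trans h2; rewrite dotE.
  have E j : (act d v - act d' v) 0 j = act d v 0 j - act d' v 0 j by rewrite !mxE.
  rewrite !E -!expr2.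
  have := sqr_ge0 (act d v 0 0 - act d' v 0 0); have := sqr_ge0 (act d v 0 1 - act d' v 0 1).
  have := sqr_ge0 (act d v 0 2 - act d' v 0 2).
  by clear; move: i; apply: I3_ind; lra.
have : (m * m)%:~R < 1%:~R :> R by rewrite intrM; move: h3; rewrite mE; lra.
rewrite ltr_int; clear; nia.
Qed.

Lemma crystallographic_pull (R : realType) (f f' : 'rV[R]_3 -> 'rV[R]_3) D :
  similarity f -> cancel f f' -> cancel f' f -> opgroup D -> has_lattice D ->
  crystallographic [set f' \o @act R d \o f | d in D].
Proof.
move=> fs ff' f'f gD lD.
have f's := similarity_inv fs f'f.
have imE : [set f' \o @act R d \o f | d in D] = conjugate f' f [set @act R d | d in D].
  by rewrite /conjugate image_comp.
split; first split.
- by rewrite imE; apply: isom_subgroup_conj => //; apply: isom_subgroup_act.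
- have [k k0 fk] := fs.
  (* Balls are for the sup norm: radius 1/(4k) keeps Euclidean distances below 1/(2k), and [f]
     stretches this to 1/2, the least distance between distinct half-integral points. *)
  apply: (@isolated_two_points _ _ (f' 0) (f' (vec3 1 2 4)) (4 * k)^-1).
    by rewrite invr_gt0 mulr_gt0.
  move=> _ _ [d Dd <-] [d' Dd' <-] /=; rewrite !f'f.
  have near (v : 'rV[R]_3) : (forall i, exists m : int, v 0 i = m%:~R) ->
      ball (f' (act d v)) (4 * k)^-1 (f' (act d' v)) -> act d v = act d' v.
    move=> vz /ball_row bl; apply: act_close => //.
    rewrite -(f'f (act d v)) -(f'f (act d' v)) fk.
    set x := f' _ in bl *; set y := f' _ in bl *.
    have dk : dot (x - y) (x - y) < (1 / (2 * k)) ^+ 2.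
      rewrite dotE.
      have E j : (x - y) 0 j = x 0 j - y 0 j by rewrite !mxE.
      have sq j : (x - y) 0 j * (x - y) 0 j <= ((4 * k)^-1) ^+ 2.
        rewrite E -expr2 -[X in X <= _]real_normK ?num_real //.
        rewrite (ler_pXn2r (n := 2)) // ?nnegrE ?normr_ge0 //; first exact: ltW.
        by rewrite invr_ge0 mulr_ge0 // ltW.
      have := sq 0; have := sq 1; have := sq 2.
      have -> : (1 / (2 * k)) ^+ 2 = 4 * (4 * k)^-1 ^+ 2 by field; rewrite gt_eqF.
      have : 0 < (4 * k)^-1 ^+ 2 by rewrite exprn_gt0 // invr_gt0 mulr_gt0.
      lra.
    rewrite -(ltr_pdivlMl _ _ k0).
    have -> : k^-1 * (1 / 2) = 1 / (2 * k) by field; rewrite gt_eqF.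
    rewrite -(ltr_pXn2r (n := 2)) ?eucl_edist_sq // nnegrE; first exact: eucl_edist_ge0.
    by rewrite divr_ge0 ?ler01 // mulr_ge0 ?ler0n // ltW.
  move=> b0 b1; have E0 : act d (0 : 'rV[R]_3) = act d' 0.
    by apply: near => // i; exists 0; rewrite mxE.
  have E1 : act d (vec3 1 2 4 : 'rV[R]_3) = act d' (vec3 1 2 4).
    by apply: near => //; apply: I3_ind; [exists 1|exists 2|exists 4]; rewrite vec3E.
  by rewrite (act_eq2 E0 E1).
- have [k [A [b [k0 AA fE]]]] := similarity_affine fs.
  (* Pulls back the sublattice 2 Z^3 of D3, in which [z] is subject to no parity condition. *)
  exists ((2 / k) *: A^T).
    rewrite unitmxZ; last by rewrite unitfE mulf_neq0 ?invr_eq0 ?pnatr_eq0 // gt_eqF.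
    by rewrite unitmx_tr; have [] := mulmx1_unit AA.
  move=> z; pose t : 'rV[int]_3 := \row_i (z 0 i * 4).
  have tE i : t 0 i = z 0 i * 4 by rewrite mxE.
  exists (trop t).
    by apply: lD; apply/F23op_trop; rewrite /tbcc /tcl /bcc /cl /= !tE; split; lia.
  apply/funext => x /=; apply: (can_inj ff'); rewrite f'f /translation !fE.
  rewrite mulmxDl -mulmxA -scalemxAl (mulmx1C AA) -scalemxAr mulmx1 scalerDr.
  rewrite addrAC; apply/rowP => i; rewrite actE osg_trop ffunE /= [RHS]mxE; congr (_ + _).
  by rewrite !mxE intrM; field; rewrite gt_eqF.
Qed.

Lemma card_lt_eq (T U T' U' : Type) (A : set T) (B : set U) (A' : set T') (B' : set U') :
  (A #= A')%card -> (B #= B')%card -> card_lt A B -> card_lt A' B'.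
Proof.
move=> /card_eqPle[AA' A'A] /card_eqPle[BB' B'B]; rewrite /card_lt; apply: contra.
by move=> B'A'; apply: card_le_trans BB' (card_le_trans B'A' A'A).
Qed.

Lemma stabilizer_pull (R : realType) (f f' : 'rV[R]_3 -> 'rV[R]_3) D p :
  cancel f f' -> cancel f' f ->
  (opstab D (f p) #= stabilizer [set f' \o @act R d \o f | d in D] p)%card.
Proof.
move=> ff' f'f; have inj : injective (fun d => f' \o @act R d \o f).
  move=> d d' e; apply: (@act_inj R); apply/funext => x.
  by have := congr1 (fun F => f (F (f' x))) e; rewrite /= !f'f.
have -> : stabilizer [set f' \o @act R d \o f | d in D] p =
    [set f' \o @act R d \o f | d in opstab D (f p)].
  apply/seteqP; split => [_ [[d Dd <-]] /= fp|_ [d [Dd dp] <-]].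
    by exists d => //; split => //; rewrite -[LHS]f'f fp.
  by split; [exists d | rewrite /= dp ff'].
by rewrite card_eq_sym; apply: inj_card_eq => d d' _ _ /inj.
Qed.

Lemma orbit_pull (R : realType) (f f' : 'rV[R]_3 -> 'rV[R]_3) D p :
  orbit_of [set f' \o @act R d \o f | d in D] p = f' @` oporbit D (f p).
Proof.
apply/seteqP; split => [_ [_ [d Dd <-] <-]|_ [_ [d Dd <-] <-]].
  by exists (act d (f p)) => //; exists d.
by exists (f' \o act d \o f) => //; exists d.
Qed.

Lemma minimal_stab_pull (R : realType) (G : set ('rV[R]_3 -> 'rV[R]_3)) f f' p :
  cubic_coords G f f' ->
  (~ exists (G' : set ('rV[R]_3 -> 'rV[R]_3)) (p' : 'rV[R]_3),
       [/\ crystallographic G', G' <> G, orbit_of G' p' = orbit_of G p &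
           card_lt (stabilizer G' p') (stabilizer G p)]) ->
  minimal_stab (coord_ops G f f') (f p).
Proof.
move=> [fs ff' f'f aD GE] nG D' gD' ND' lD' eqO ltS; apply: nG.
set D := coord_ops G f f' in GE eqO ltS *.
have ltS' : card_lt (stabilizer [set f' \o @act R d \o f | d in D'] p) (stabilizer G p).
  by rewrite GE; apply: card_lt_eq ltS; apply: stabilizer_pull.
exists [set f' \o @act R d \o f | d in D'], p; split=> //.
- exact: crystallographic_pull.
- by move=> e; move: ltS'; rewrite e /card_lt card_lexx.
- by rewrite GE !orbit_pull eqO.
Qed.

Lemma nontrivial_opstab (R : realType) (G : set ('rV[R]_3 -> 'rV[R]_3)) f f' p :
  cubic_coords G f f' -> stabilizer G p <> [set idfun] ->
  exists2 s, opstab (coord_ops G f f') (f p) s & s <> one_op.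
Proof.
move=> [fs ff' f'f [[D1 _ _] _ _] GE] nt; apply: contrapT => h; apply: nt.
have id1 : f' \o @act R one_op \o f = idfun.
  by apply/funext => x /=; rewrite act_one ff'.
apply/seteqP; split => [g [] |_ ->]; last first.
  by split => //; move: D1; rewrite /coord_ops /= id1.
rewrite {1}GE => -[d Dd <-] dp; rewrite /= -id1.
suff -> : d = one_op by [].
apply: contrapT => d1; apply: h; exists d => //; split => //.
by rewrite -[LHS]f'f; move: dp => /= ->.
Qed.

(** * The types F4_132 and Fd-3 *)

Lemma dia_ops_quot m a b : [/\ bcc a, cl a = 3, alpha a & omu a = m] ->
  [/\ bcc b, cl b = 3, alpha b & omu b = m] -> F23op (mul_op a b).
Proof.
move=> [Na ca aa ma] [Nb cb ab mb]; split.
- exact: bcc_mul.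
- by rewrite cl_mul // rho_cl // cb aa /= ca.
- by rewrite alpha_mul aa ab.
- by rewrite /= ma mb addbb.
Qed.

Lemma dia_odd_inv m a : [/\ bcc a, cl a = 3, alpha a & omu a = m] ->
  [/\ bcc (inv_op a), cl (inv_op a) = 3, alpha (inv_op a) & omu (inv_op a) = m].
Proof.
move=> [Na ca aa ma]; have Nv := bcc_inv Na; split => //; last by rewrite alpha_inv.
have := cl_mul a Nv; rewrite mulopV cl_one rho_inv // rho_cl // ca aa /=.
have := cl_bound (inv_op a); lia.
Qed.

Lemma opgroup_dia m : opgroup (dia_ops 3 m).
Proof.
split; first by left; apply: F23op_one.
- move=> a b [Fa|oa] [Fb|ob].
  + by left; apply: F23op_mul.
  + right; have [Na ca aa ma] := Fa; have [Nb cb ab mb] := ob; split.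
    * exact: bcc_mul.
    * by rewrite cl_mul // aa andbF ca cb.
    * by rewrite alpha_mul aa ab.
    * by rewrite /= ma mb.
  + right; have [Na ca aa ma] := oa; have [Nb cb ab mb] := Fb; split.
    * exact: bcc_mul.
    * by rewrite cl_mul // rho_cl // ca cb.
    * by rewrite alpha_mul aa ab.
    * by rewrite /= ma mb addbF.
  + by left; apply: dia_ops_quot oa ob.
- move=> a [Fa|oa]; first by left; apply: F23op_inv.
  by right; apply: dia_odd_inv.
Qed.

(** The class of [d] is odd, so the linear part of [n] negates it exactly when [n] has an odd number
    of signs; the even classes of [n] and its inverse cancel. Hence a reflection in a coordinate
    plane exchanges classes 1 and 3. *)
Lemma dia_conj n c m d : bcc n -> rho n = false -> modz c 2 = 1 -> dia_ops c m d ->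
  dia_ops (modz (if alpha n then - c else c) 4) m (mul_op n (mul_op d (inv_op n))).
Proof.
move=> Nn rn c2 [Fd|[Nd cd ad md]]; first by left; apply: F23op_conj.
have Nv := bcc_inv Nn; right; split.
- by apply: bcc_mul => //; apply: bcc_mul.
- rewrite cl_mul; last exact: bcc_mul.
  rewrite cl_mul // rho_mul // rho_inv // rn /= cd addbF.
  have -> : rho d = true by rewrite rho_cl // cd c2.
  have := cl_mul n Nv; rewrite mulopV cl_one rho_inv // rn /=.
  have : modz (cl n) 2 = 0 by have := rho_cl Nn; rewrite rn; lia.
  by case: (alpha n) => /=; lia.
- by rewrite !alpha_mul alpha_inv ad; case: (alpha n).
- by rewrite /= md; case: (omu n); case: (m).
Qed.

Lemma coord_ops_comp (R : realType) (G : set ('rV[R]_3 -> 'rV[R]_3)) f f' n :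
  coord_ops G (act n \o f) (f' \o act (inv_op n)) =
  [set d | coord_ops G f f' (mul_op (inv_op n) (mul_op d n))].
Proof.
apply/seteqP; split => d; rewrite /coord_ops /=;
have -> // : f' \o @act R (inv_op n) \o act d \o (act n \o f) =
     f' \o act (mul_op (inv_op n) (mul_op d n)) \o f
  by apply/funext => x /=; rewrite !act_mul.
Qed.

Lemma coord_ops_dia (R : realType) (G : set ('rV[R]_3 -> 'rV[R]_3)) f f' n c m :
  bcc n -> rho n = false -> 0 <= c < 4 -> modz c 2 = 1 ->
  coord_ops G f f' = dia_ops c m ->
  coord_ops G (act n \o f) (f' \o act (inv_op n)) =
    dia_ops (modz (if alpha n then - c else c) 4) m.
Proof.
move=> Nn rn c4 c2 E; rewrite coord_ops_comp E; apply/seteqP; split => d /= Dd.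
  have := dia_conj Nn rn c2 Dd.
  by rewrite -!mul_opA mulopV mulop1 mulKVop.
have c2' : modz (modz (if alpha n then - c else c) 4) 2 = 1 by case: ifP => _; lia.
have rv : rho (inv_op n) = false by rewrite rho_inv.
have := dia_conj (bcc_inv Nn) rv c2' Dd.
have -> : inv_op (inv_op n) = n by apply: inv_op_unique; rewrite mulVop.
rewrite alpha_inv; suff -> : modz (if alpha n then - modz (if alpha n then - c else c) 4
  else modz (if alpha n then - c else c) 4) 4 = c by [].
by case: (alpha n); lia.
Qed.

(** The last generators of [F4132] and [Fd3bar] in doubled coordinates, where the face-centred
    lattice is D3. As [ot] doubles once more, 3/4 and 1/4 appear as 3 and 1. *)
Definition dia_glide (m : bool) : op :=
  if m then Op true 1 [ffun i : 'I_3 => nth false [:: false; false; true] i] (vec3z 3 1 3)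
  else Op false 0 [ffun=> true] (vec3z 1 1 1).

Lemma dia_glideP m :
  [/\ bcc (dia_glide m), cl (dia_glide m) = 3, alpha (dia_glide m) & omu (dia_glide m) = m].
Proof. by case: m; split; rewrite /bcc /cl /alpha ?ffunE ?vec3z_E. Qed.

Lemma dia_ops_generated (D : set op) m : opgroup D ->
  F23op `<=` D -> D (dia_glide m) -> dia_ops 3 m `<=` D.
Proof.
move=> [D1 DM DV] FD Dg d [/FD//|od]; rewrite -(mulKVop (dia_glide m) d).
apply: (DM) => //; apply: FD.
exact: dia_ops_quot (dia_odd_inv (dia_glideP m)) od.
Qed.

Definition dia_group (R : realType) (m : bool) : set ('rV[R]_3 -> 'rV[R]_3) :=
  if m then F4132 R else Fd3bar R.

Lemma triplet_act (R : realType) (F : R -> R -> R -> 'rV[R]_3) d :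
  (forall x y z, F x y z = 2^-1 *: act d (2 *: vec3 x y z)) ->
  triplet F = ( *:%R 2^-1) \o act d \o ( *:%R 2).
Proof.
move=> FE; apply/funext => v; rewrite /triplet FE /=; congr (_ *: act d (_ *: _)).
by apply: row3P; rewrite vec3E.
Qed.

Lemma translation_act (R : realType) (a b c : R) (t : 'rV[int]_3) :
  (t 0 0)%:~R = 4 * a -> (t 0 1)%:~R = 4 * b -> (t 0 2)%:~R = 4 * c ->
  translation (vec3 a b c) = ( *:%R 2^-1) \o act (trop t) \o ( *:%R 2).
Proof.
move=> ta tb tc; apply/funext => v; rewrite /translation /=.
have E (i : 'I_3) (y : R) : (t 0 i)%:~R = 4 * y -> v 0 i + y = 2^-1 * (2 * v 0 i + (t 0 i)%:~R / 2).
  by move=> ->; field.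
by apply: row3P; rewrite [RHS]mxE actE osg_trop ffunE ![in RHS]mxE [LHS]mxE vec3E; apply: E.
Qed.

Lemma dia_groupE (R : realType) m :
  @dia_group R m = [set ( *:%R 2^-1) \o @act R d \o ( *:%R 2) | d in dia_ops 3 m].
Proof.
pose h : 'rV[R]_3 -> 'rV[R]_3 := *:%R 2; pose h' : 'rV[R]_3 -> 'rV[R]_3 := *:%R 2^-1.
have n2 : (2 : R) != 0 by rewrite pnatr_eq0.
have hh' : cancel h h' by move=> x; rewrite /h /h' scalerA mulVf // scale1r.
have h'h : cancel h' h by move=> x; rewrite /h /h' scalerA mulfV // scale1r.
have h's : similarity h'.
  exists 2^-1; first by rewrite invr_gt0.
  move=> x y; rewrite /edist -scalerBr dotZl dotZr mulrA -expr2.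
  by rewrite sqrtrM ?sqr_ge0 // sqrtr_sqr ger0_norm // invr_ge0.
set H := [set _ | _ in _].
have sH : isom_subgroup H.
  have -> : H = conjugate h' h [set @act R d | d in dia_ops 3 m].
    by rewrite /conjugate image_comp.
  by apply: isom_subgroup_conj => //; apply/isom_subgroup_act/opgroup_dia.
have glideE : ( *:%R 2^-1) \o @act R (dia_glide m) \o ( *:%R 2) =
  if m then triplet (fun x y z => vec3 (y + 3 / 4) (x + 1 / 4) (- z + 3 / 4))
  else triplet (fun x y z => vec3 (- x + 1 / 4) (- y + 1 / 4) (- z + 1 / 4)).
  apply/esym; case: (m); apply: triplet_act => x y z; apply: row3P;
   rewrite vec3E [RHS]mxE actE /= ffunE /= vec3z_E mxE /osg /dih /= ?I3E vec3E; by field.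
have gen_op (S : set ('rV[R]_3 -> 'rV[R]_3)) : S = @F23_generators R `|`
    [set if m then triplet (fun x y z => vec3 (y + 3 / 4) (x + 1 / 4) (- z + 3 / 4))
     else triplet (fun x y z => vec3 (- x + 1 / 4) (- y + 1 / 4) (- z + 1 / 4))] ->
   generated S = H.
  move=> SE.
  have tr (a b c : R) (t1 t2 t3 : int) : t1%:~R = 4 * a -> t2%:~R = 4 * b ->
      t3%:~R = 4 * c -> translation (vec3 a b c) = h' \o act (trop (vec3z t1 t2 t3)) \o h.
    by move=> e1 e2 e3; apply: translation_act; rewrite vec3z_E.
  have lin k (e0 e1 e2 : bool) F :
      (forall x y z, F x y z = 2^-1 *: act (linop false k e0 e1 e2) (2 *: vec3 x y z)) ->
      triplet F = h' \o @act R (linop false k e0 e1 e2) \o h by apply: triplet_act.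
  have E1 : translation (vec3 1 0 0) = h' \o @act R (trop (vec3z 4 0 0)) \o h.
    by apply: tr; rewrite ?mulr0 ?mulr1.
  have E2 : translation (vec3 0 1 0) = h' \o @act R (trop (vec3z 0 4 0)) \o h.
    by apply: tr; rewrite ?mulr0 ?mulr1.
  have E3 : translation (vec3 0 0 1) = h' \o @act R (trop (vec3z 0 0 4)) \o h.
    by apply: tr; rewrite ?mulr0 ?mulr1.
  have E4 : translation (vec3 0 2^-1 2^-1) = h' \o @act R (trop (vec3z 0 2 2)) \o h.
    by apply: tr; rewrite ?mulr0 //; by field.
  have E5 : translation (vec3 2^-1 0 2^-1) = h' \o @act R (trop (vec3z 2 0 2)) \o h.
    by apply: tr; rewrite ?mulr0 //; by field.
  have E6 : triplet (fun x y z : R => vec3 (- x) (- y) z) = h' \o @act R (linop false 0 true true false) \o h.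
    apply: lin => x y z; apply: row3P;
    rewrite vec3E [RHS]mxE actE linop_oeE !mxE /osg /dih /= ?I3E ?vec3E; by field.
  have E7 : triplet (fun x y z : R => vec3 (- x) y (- z)) = h' \o @act R (linop false 0 true false true) \o h.
    apply: lin => x y z; apply: row3P;
    rewrite vec3E [RHS]mxE actE linop_oeE !mxE /osg /dih /= ?I3E ?vec3E; by field.
  have E8 : triplet (fun x y z : R => vec3 z x y) = h' \o @act R (linop false 2 false false false) \o h.
    apply: lin => x y z; apply: row3P;
    rewrite vec3E [RHS]mxE actE linop_oeE !mxE /osg /dih /= ?I3E ?vec3E; by field.
  have trF a b c : modz a 2 = 0 -> modz b 2 = 0 -> modz c 2 = 0 -> modz (a + b + c) 4 = 0 ->
      F23op (trop (vec3z a b c)).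
    move=> ha hb hc habc; apply/F23op_trop.
    by rewrite /tbcc /tcl /bcc /cl /= !vec3z_E ha hb hc habc eqxx.
  have liF k a b c : a (+) b (+) c = false -> F23op (linop false k a b c).
    by move=> abc; split; rewrite // /bcc /cl /alpha ?linop_oeE ?mxE.
  have SH : S `<=` H.
    rewrite SE => g [|->]; last by rewrite -glideE; exists (dia_glide m) => //; right; apply: dia_glideP.
    rewrite /F23_generators /mkset !inE => /or4P[/eqP|/eqP|/eqP|/or4P[/eqP|/eqP|/eqP|/orP[/eqP|/eqP]]];
    rewrite ?E1 ?E2 ?E3 ?E4 ?E5 ?E6 ?E7 ?E8 => ->; eexists; try reflexivity; left; try exact: trF; exact: liF.
  have sS := isom_subgroup_generated sH SH.
  apply/seteqP; split; first by move=> g /(_ _ (conj sH SH)).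
  pose D := [set d | generated S (h' \o @act R d \o h)].
  have gD : opgroup D by apply: opgroup_pull.
  have [D1 DM DV] := gD.
  have DS d : S (h' \o act d \o h) -> D d by move=> Sd K [sK SK]; apply: SK.
  suff DD : dia_ops 3 m `<=` D by move=> _ [d /DD Dd <-].
  apply: dia_ops_generated => //; last first.
    by apply: DS; rewrite SE; right; rewrite /= -glideE.
  have DF g d : g \in [:: translation (vec3 1 0 0);
            translation (vec3 0 1 0);
            translation (vec3 0 0 1);
            translation (vec3 0 2^-1 2^-1);
            translation (vec3 2^-1 0 2^-1);
            triplet (fun x y z : R => vec3 (- x) (- y) z);
            triplet (fun x y z : R => vec3 (- x) y (- z));
            triplet (fun x y z : R => vec3 z x y)] -> g = h' \o act d \o h -> D d.
    by move=> Sg gE; apply: DS; rewrite -gE SE; left.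
  apply: F23op_gen => //.
  - have D2 : D (linop false 2 false false false) by apply: DF E8; rewrite !inE eqxx !orbT.
    have := DM _ _ D2 D2; congr D; apply: op_eq => [||i|i] //.
    + exact: val_inj.
    + by rewrite mul_oeE !ffunE; move: i; apply: I3_ind.
    + by rewrite mul_otE !mxE; case: ifP.
  - by apply: DF E6; rewrite !inE eqxx !orbT.
  - by apply: DF E4; rewrite !inE eqxx !orbT.
by rewrite /dia_group; case: (m) gen_op => gen_op; apply: gen_op.
Qed.

Lemma same_type_dia_direct (R : realType) (G : set ('rV[R]_3 -> 'rV[R]_3)) f f' m M b :
  cubic_coords G f f' -> coord_ops G f f' = dia_ops 3 m ->
  (forall x, f x = x *m M + b) -> 0 < \det M -> same_type G (dia_group m).
Proof.
move=> [fs ff' f'f _ GE] DE fE dM.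
have uM : M \in unitmx by rewrite unitmxE unitfE gt_eqF.
have n2 : (2 : R) != 0 by rewrite pnatr_eq0.
exists (2^-1 *: M), (2^-1 *: b); split.
  by rewrite detZ mulr_gt0 // exprn_gt0 // invr_gt0.
have -> : (fun y : 'rV[R]_3 => (y - 2^-1 *: b) *m invmx (2^-1 *: M)) = f' \o ( *:%R 2).
  apply/funext => y /=; apply: (can_inj ff'); rewrite f'f fE.
  rewrite invmxZ ?unitmxZ ?unitfE ?invr_eq0 // invrK -scalemxAr -scalemxAl.
  rewrite mulmxKV // scalerBr scalerA mulfV // scale1r subrK //.
have -> : (fun x : 'rV[R]_3 => x *m (2^-1 *: M) + 2^-1 *: b) = ( *:%R 2^-1) \o f.
  by apply/funext => x; rewrite /= fE -scalemxAr scalerDr.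
rewrite dia_groupE GE DE /conjugate image_comp; congr image.
by apply/funext => d; apply/funext => x /=; rewrite !f'f.
Qed.

Lemma same_type_dia (R : realType) (G : set ('rV[R]_3 -> 'rV[R]_3)) f f' m :
  cubic_coords G f f' -> coord_ops G f f' = dia_ops 3 m -> same_type G (dia_group m).
Proof.
move=> cf DE; have [fs _ _ _ _] := cf.
have [k [A [b [k0 AA fE]]]] := similarity_affine fs.
have fE' x : f x = x *m (k *: A) + b by rewrite fE -scalemxAr.
have dA : \det A ^+ 2 = 1 by rewrite expr2 -{2}det_tr -det_mulmx AA det1.
have [dA0|dA0] := ltP 0 (\det A).
  by apply: same_type_dia_direct cf DE fE' _; rewrite detZ mulr_gt0 // exprn_gt0.
(* [same_type] admits only positive determinants. If [f] reverses orientation, it is followed by the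
   exchange of the last two coordinates, which has determinant -1 but no signs, so that class 3 is
   kept. *)
pose n := linop true 0 false false false.
have Nn : bcc n by rewrite /bcc !mxE.
have an : alpha n = false by rewrite /alpha !linop_oeE.
pose P : 'M[R]_3 := \matrix_(i, j) (i == osg n j)%:R.
have nP v : act n v = v *m P.
  apply: row3P; rewrite actE linop_oeE /osg /dih /= ?I3E !mxE big_I3 !mxE /osg /dih /= ?I3E /=;
  by rewrite !(mulr0, mulr1, add0r, addr0, mul0r).
have dP : \det P = -1.
  by rewrite det_mx33 !mxE /osg /dih /= ?I3E /=; ring.
apply: (@same_type_dia_direct _ _ (act n \o f) (f' \o act (inv_op n)) _ ((k *: A) *m P) (b *m P)).
- exact: cubic_coords_comp.
- by rewrite (@coord_ops_dia _ _ _ _ n 3 m) // ?an // /rho !mxE.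
- by move=> x /=; rewrite nP fE' mulmxDl mulmxA.
- rewrite det_mulmx dP detZ mulrN1 -mulrN mulr_gt0 ?exprn_gt0 // oppr_gt0.
  by rewrite lt_neqAle dA0 andbT; apply/eqP => d0; move: dA; rewrite d0 expr0n /=; lra.
Qed.

(** * Facets of Voronoi cells *)

Definition polyhedron (R : realType) (n : nat) (a : 'I_n -> 'rV[R]_3) (c : 'I_n -> R) :
    set 'rV[R]_3 := [set x | forall i, dot (a i) x <= c i].

Lemma polyhedron_nbhs (R : realType) n (a : 'I_n -> 'rV[R]_3) (c : 'I_n -> R) y :
  (forall i, dot (a i) y < c i) ->
  exists2 e : R, 0 < e & forall v : 'rV[R]_3, (forall j, `|v 0 j| <= e) -> polyhedron a c (y + v).
Proof.
move=> ylt.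
pose b i := `|a i 0 0| + `|a i 0 1| + `|a i 0 2| + 1.
have b0 i : 0 < b i by rewrite ltr_wpDl // !addr_ge0.
pose e i := (c i - dot (a i) y) / b i.
have e0 i : 0 < e i by rewrite divr_gt0 // subr_gt0.
(* The inverse of this sum is at most every [e i], and it is positive even without constraints. *)
pose s := 1 + \sum_i (e i)^-1.
have s0 : 0 < s by rewrite ltr_pwDl // sumr_ge0 // => i _; rewrite invr_ge0 ltW.
have se i : s^-1 <= e i.
  rewrite -[e i]invrK lef_pV2 ?posrE ?invr_gt0 //.
  rewrite /s (bigD1 i) //= addrCA lerDl addr_ge0 // sumr_ge0 // => j _.
  by rewrite invr_ge0 ltW.
exists s^-1 => [|v vs i]; first by rewrite invr_gt0.
rewrite dotDr -lerBrDl.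
have le_s : dot (a i) v <= s^-1 * b i.
  rewrite dotE mulrDr mulr1 !mulrDr.
  have bnd j : a i 0 j * v 0 j <= s^-1 * `|a i 0 j|.
    apply: le_trans (ler_norm _) _; rewrite normrM mulrC.
    by rewrite ler_wpM2r.
  have := bnd 0; have := bnd 1; have := bnd 2.
  have : 0 < s^-1 by rewrite invr_gt0.
  lra.
apply: le_trans le_s _; have := se i; rewrite /e ler_pdivlMr //.
Qed.

(** Both normals lie in the kernel of the matrix of two independent differences, which has dimension
    1. *)
Lemma same_plane (R : realType) (x : 'I_3 -> 'rV[R]_3) (u v : 'rV[R]_3) (c d : R) :
  aff_independent (d := 2) x -> u != 0 -> v != 0 ->
  (forall i, dot u (x i) = c) -> (forall i, dot v (x i) = d) ->
  [set y | dot u y = c] = [set y | dot v y = d].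
Proof.
move=> xi u0 v0 ux vx; rewrite /aff_independent in xi.
set W := (X in row_free X) in xi.
have rW : \rank (kermx W^T) = 1%N.
  by rewrite mxrank_ker mxrank_tr (eqP xi).
have ker w e : (forall i, dot w (x i) = e) -> (w <= kermx W^T)%MS.
  move=> wx; apply/sub_kermxP/rowP => i; rewrite !mxE.
  transitivity (dot w (x (lift ord0 i) - x ord0)).
    by apply: eq_bigr => j _; rewrite !mxE.
  by rewrite dotDr dotNr !wx subrr.
have sub w e : w != 0 -> (forall i, dot w (x i) = e) -> (kermx W^T <= w)%MS.
  move=> w0 wx; have wk := ker w e wx.
  by rewrite -(mxrank_leqif_sup wk) rW rank_rV w0.
have /sub_rVP [a va] : (v <= u)%MS by apply: submx_trans (ker v d vx) (sub u c u0 ux).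
have a0 : a != 0 by apply: contraNneq v0 => a0; rewrite va a0 scale0r.
have dc : d = a * c by rewrite -(vx 0) va dotZl ux.
apply/seteqP; split => y /=; rewrite va dotZl dc; first by move=> ->.
by move/(mulfI a0).
Qed.

(** The interior point [q] makes the polyhedron three-dimensional, so a facet has a nonzero normal
    [u]. If no constraint were tight at the centroid of three independent points of the facet, one
    could move along [u] inside the polyhedron. *)
Lemma facet_polyhedron (R : realType) n (a : 'I_n -> 'rV[R]_3) (c : 'I_n -> R) q F :
  (forall i, a i != 0) -> (forall i, dot (a i) q < c i) ->
  facets (polyhedron a c) F ->
  exists i, F = polyhedron a c `&` [set x | dot (a i) x = c i].
Proof.
move=> a0 qlt [[u [e [ue FE]]] [[x xi xF] nF]].
have xP j : polyhedron a c (x j) by have := xF j; rewrite FE => -[].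
have xu j : dot u (x j) = e by have := xF j; rewrite FE => -[].
have u0 : u != 0.
  apply/eqP => u0; apply: nF.
  have e0 : e = 0 by rewrite -(xu 0) u0 dotE !mxE !mul0r !addr0.
  have FP : F = polyhedron a c.
    rewrite FE u0 e0; apply/seteqP; split => [y []//|y Py]; split => //=.
    by rewrite dotE !mxE !mul0r !addr0.
  have [t t0 tP] := polyhedron_nbhs qlt.
  pose z (j : 'I_4) := if unlift ord0 j is Some i then q + t *: delta_mx 0 i else q.
  exists z; last first.
    move=> j; rewrite FP /z; case: unliftP => [i _|_]; last by move=> i; apply: ltW.
    apply: tP => l; rewrite !mxE /=; case: eqP => _; rewrite ?mulr1 ?mulr0 ?normr0 ?ger0_norm //; exact: ltW.
  rewrite /aff_independent; have -> : \matrix_(i < 3) (z (lift ord0 i) - z ord0) = t%:M.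
    apply/row_matrixP => i; rewrite rowK /z liftK unlift_none addrC addKr.
    by rewrite -scalemx1 linearZ /= row1.
  by rewrite row_free_unit unitmxE det_scalar unitfE expf_neq0 // gt_eqF.
pose y := 3^-1 *: (x 0 + x 1 + x 2).
have doty w : dot w y = (dot w (x 0) + dot w (x 1) + dot w (x 2)) / 3.
  by rewrite /y dotZr !dotDr mulrC.
(* A constraint tight at the centroid y is tight at all three points. *)
have [i yi] : exists i, dot (a i) y = c i.
  apply: contrapT => no.
  have ylt i : dot (a i) y < c i.
    rewrite lt_neqAle; apply/andP; split; first by apply/eqP => yi; apply: no; exists i.
    by rewrite doty; have := xP 0 i; have := xP 1 i; have := xP 2 i; lra.
  have [t t0 tP] := polyhedron_nbhs ylt.
  pose m := 1 + `|u 0 0| + `|u 0 1| + `|u 0 2|.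
  have m0 : 0 < m by rewrite !ltr_pwDl.
  have : dot u (y + (t / m) *: u) <= e.
    apply: ue; apply: tP => j; rewrite mxE normrM (ger0_norm (ltW _)) ?divr_gt0 //.
    rewrite mulrAC ler_pdivrMr // ler_pM2l //.
    have := normr_ge0 (u 0 0); have := normr_ge0 (u 0 1); have := normr_ge0 (u 0 2).
    by rewrite /m; move: j; apply: I3_ind; lra.
  rewrite dotDr doty !xu dotZr.
  have uu : 0 < dot u u.
    by rewrite lt_neqAle dot_ge0 andbT eq_sym; apply: contraNneq u0 => /dot_eq0 ->.
  have : 0 < t / m * dot u u by rewrite mulr_gt0 ?divr_gt0.
  lra.
have xi' j : dot (a i) (x j) = c i.
  move: yi; rewrite doty; have := xP 0 i; have := xP 1 i; have := xP 2 i.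
  by move: j; apply: I3_ind; lra.
by exists i; rewrite FE (same_plane xi u0 (a0 i) xu xi').
Qed.

(** The bisectors of [q] and the [s i] present the cell as a polyhedron with [q] strictly inside,
    and each facet lies on one of them. *)
Lemma facets_voronoi_le (R : realType) (S : set 'rV[R]_3) q n (s : 'I_n.+1 -> 'rV[R]_3) :
  (forall i, S (s i)) -> (forall i, s i <> q) ->
  (forall y, (forall i, edist y q <= edist y (s i)) -> voronoi_cell S q y) ->
  (facets (voronoi_cell S q) #<= `I_n.+1)%card.
Proof.
move=> Ss sq near.
pose a i := s i - q; pose c i := (dot (s i) (s i) - dot q q) / 2.
have acE y i : (edist y q <= edist y (s i)) = (dot (a i) y <= c i).
  rewrite eucl_edist_le /a /c !(dotDl, dotDr, dotNl, dotNr) (dotC q y) (dotC (s i) y).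
  by apply/idP/idP; lra.
have VE : voronoi_cell S q = polyhedron a c.
  apply/seteqP; split => y; first by move=> yV i; rewrite -acE; apply: yV.
  by move=> yP; apply: near => i; rewrite acE.
have a0 i : a i != 0 by rewrite subr_eq0; apply/eqP/sq.
have qlt i : dot (a i) q < c i.
  have : 0 < dot (a i) (a i).
    by rewrite lt_neqAle dot_ge0 andbT eq_sym; apply: contraNneq (a0 i) => /dot_eq0 ->.
  by rewrite /a /c !(dotDl, dotDr, dotNl, dotNr) (dotC q (s i)); lra.
rewrite VE; apply: (@card_le_trans _ _ _ ((fun k => polyhedron a c `&`
   [set x | dot (a (inord k)) x = c (inord k)]) @` `I_n.+1)); last exact: card_image_le.
apply: subset_card_le => F /(facet_polyhedron a0 qlt) [i ->].
by exists (i : nat) => /=; rewrite ?inord_val.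
Qed.

(* The square bipyramid with apices 0, (1,0,0) and equator (1/2,±1/2,±1/2). *)
Definition bipyramid (R : realType) (y : 'rV[R]_3) : Prop :=
  [/\ - y 0 0 <= y 0 1, y 0 1 <= y 0 0, - y 0 0 <= y 0 2 & y 0 2 <= y 0 0] /\
  [/\ y 0 0 - 1 <= y 0 1, y 0 1 <= 1 - y 0 0, y 0 0 - 1 <= y 0 2 &
      y 0 2 <= 1 - y 0 0].

Lemma int_le_sqr (n : int) : n <= n ^+ 2 /\ - n <= n ^+ 2.
Proof. rewrite expr2; split; nia. Qed.

(** As (1,0,0) is not in D3, its squared distance a^2 + b^2 + c^2 - 2a + 1 to a point of D3 is at
    least 1. Parity matters only for a = 1, where b and c cannot both vanish. *)
Lemma double_le_sum_sqr (a b c : int) : modz (a + b + c) 2 = 0 ->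
  2 * a <= a ^+ 2 + b ^+ 2 + c ^+ 2.
Proof.
move=> ev; have [b1 b2] := int_le_sqr b; have [c1 c2] := int_le_sqr c.
have [a1|a1] := eqVneq a 1.
  move: b1 b2 c1 c2; rewrite a1 expr1n in ev *.
  by move: (b ^+ 2) (c ^+ 2) => B C; lia.
have a2 : 0 <= a * (a - 2).
  have [a0|a0] := leP a 0; last by apply: mulr_ge0; lia.
  by rewrite -mulrNN; apply: mulr_ge0; lia.
have E : a * (a - 2) = a ^+ 2 - 2 * a by ring.
by move: a2 b1 b2 c1 c2; rewrite E; move: (a ^+ 2) (b ^+ 2) (c ^+ 2) => A B C; lia.
Qed.

(** This compares |y - d|^2 with |y|^2 for d = (a,b,c) in D3. The bipyramid lies in the Voronoi cell
    of 0 in D3, a rhombic dodecahedron, of which all its vertices other than 0 are vertices. *)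
Lemma bipyramid_nearest_D3 (R : realType) (y0 y1 y2 : R) (a b c : int) :
  [/\ - y0 <= y1, y1 <= y0, - y0 <= y2 & y2 <= y0] ->
  [/\ y0 - 1 <= y1, y1 <= 1 - y0, y0 - 1 <= y2 & y2 <= 1 - y0] ->
  modz (a + b + c) 2 = 0 ->
  0 <= (a%:~R ^+ 2 + b%:~R ^+ 2 + c%:~R ^+ 2) - 2 * (y0 * a%:~R + y1 * b%:~R + y2 * c%:~R).
Proof.
move=> [l1 u1 l2 u2] [l1' u1' l2' u2'] ev.
have abs (n : int) : exists D : R, [/\ 0 <= D, n%:~R <= D, - n%:~R <= D & D <= n%:~R ^+ 2].
  have [n0|n0] := leP 0 n.
    exists n%:~R; split => //; rewrite ?ler0z //; first by rewrite lerNl -rmorphN /= ler_int; lia.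
    by rewrite -rmorphXn /= ler_int; have [] := int_le_sqr n.
  exists (- n%:~R); rewrite -!rmorphN /= -rmorphXn /= !ler_int ler0z.
  by split; [lia|lia|lia|have [] := int_le_sqr n].
have prod (n : int) (D z w : R) : 0 <= D -> n%:~R <= D -> - n%:~R <= D ->
    - w <= z -> z <= w -> z * n%:~R <= w * D.
  by move=> *; nra.
have [A [A0 Aa Aa' AA]] := abs a; have [B [B0 Bb Bb' BB]] := abs b.
have [C [C0 Cc Cc' CC]] := abs c.
have w0 : 0 <= y0 by lra.
have w1 : 0 <= 1 - y0 by lra.
have [y12|y12] := leP y0 (1 / 2).
  have p1 := prod _ _ _ _ B0 Bb Bb' l1 u1; have p2 := prod _ _ _ _ C0 Cc Cc' l2 u2.
  have p0 : y0 * a%:~R <= y0 * A by rewrite ler_wpM2l.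
  have : 2 * y0 * (A + B + C) <= A + B + C.
    by rewrite -[leRHS]mul1r ler_wpM2r //; lra.
  by move: p0 p1 p2 AA BB CC; lra.
have p1 : y1 * b%:~R <= (1 - y0) * B by apply: prod => //; lra.
have p2 : y2 * c%:~R <= (1 - y0) * C by apply: prod => //; lra.
pose N : R := a%:~R ^+ 2 + b%:~R ^+ 2 + c%:~R ^+ 2.
have n1 : 2 * a%:~R <= N.
  rewrite /N -!rmorphXn -!rmorphD /= (_ : 2 = 2%:~R :> R) // -intrM ler_int.
  exact: double_le_sum_sqr.
have n2 : a%:~R + B + C <= N by rewrite /N; lra.
(* Here y has weight 2 y0 - 1 on the apex (1,0,0) and 2 - 2 y0 on the equatorial square; [n1] and
   [n2] are the inequalities there. *)
have m1 : (2 * y0 - 1) * (2 * a%:~R) <= (2 * y0 - 1) * N by rewrite ler_wpM2l //; lra.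
have m2 : (2 - 2 * y0) * (a%:~R + B + C) <= (2 - 2 * y0) * N by rewrite ler_wpM2l //; lra.
move: p1 p2 m1 m2; rewrite -/N; lra.
Qed.

(* The difference of the two squared distances is affine in x; at x = 0 and
   x = 1 it compares distances to points of D3 and of its complement in Z^3. *)
Lemma axis_nearest (R : realType) (x : R) (y : 'rV[R]_3) e :
  0 <= x <= 1 -> bipyramid y -> bcc e -> cl e = 0 ->
  edist y (vec3 x 0 0) <= edist y (act e (vec3 x 0 0)).
Proof.
move=> /andP[x0 x1] [Q1 Q2] Ne ce; rewrite eucl_edist_le.
rewrite (act_axis _ (inv_sgK e 0)); set i := inv_sg e 0; set b := oe e i.
have ev j : ot e 0 j = divz (ot e 0 j) 2 * 2.
  have : modz (ot e 0 j) 2 = 0; last by lia.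
  by move: j Ne ce; rewrite /bcc /cl; apply: I3_ind; lia.
pose d j := divz (ot e 0 j) 2.
have dE j : (ot e 0 j)%:~R / 2 = (d j)%:~R :> R by rewrite ev -/(d j) intrM; field.
have ds : modz (d 0 + d 1 + d 2) 2 = 0.
  by move: ce; rewrite /cl (ev 0) (ev 1) (ev 2) -!/(d _); lia.
have A := bipyramid_nearest_D3 Q1 Q2 ds.
(* The reflection y0 -> 1 - y0 preserves the bipyramid and exchanges its apices; it reduces x = 1,
   with base point (1,0,0), to the comparison with D3. *)
have Q1' : [/\ - (1 - y 0 0) <= y 0 1, y 0 1 <= 1 - y 0 0, - (1 - y 0 0) <= y 0 2 & y 0 2 <= 1 - y 0 0].
  by case: Q2 => *; split; lra.
have Q2' : [/\ (1 - y 0 0) - 1 <= y 0 1, y 0 1 <= 1 - (1 - y 0 0), (1 - y 0 0) - 1 <= y 0 2 & y 0 2 <= 1 - (1 - y 0 0)].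
  by case: Q1 => *; split; lra.
pose o (j : 'I_3) : int := if j == i then if b then -1 else 1 else 0.
have os : modz ((1 - (d 0 + o 0)) + (d 1 + o 1) + (d 2 + o 2)) 2 = 0.
  by move: ds; rewrite /o; move: (i); apply: I3_ind; rewrite /=; case: (b); lia.
have B := bipyramid_nearest_D3 Q1' Q2' os.
have E p : dot (y - p) (y - p) = (y 0 0 - p 0 0) ^+ 2 + (y 0 1 - p 0 1) ^+ 2 + (y 0 2 - p 0 2) ^+ 2.
  by rewrite dotE !mxE; ring.
rewrite !E !vec3E -subr_ge0.
have pE j : axis_pt x i b (ot e) 0 j = (d j)%:~R + x * (o j)%:~R.
  by rewrite mxE dE /o addrC; case: eqP => _; case: (b); rewrite ?rmorphN /=; ring.
have o2 : (o 0)%:~R ^+ 2 + (o 1)%:~R ^+ 2 + (o 2)%:~R ^+ 2 = 1 :> R.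
  rewrite /o; move: (i); apply: I3_ind => /=; case: (b); rewrite ?rmorphN /=; ring.
rewrite !pE.
set a0 : R := (d 0)%:~R in A *; set a1 : R := (d 1)%:~R in A *; set a2 : R := (d 2)%:~R in A *.
rewrite rmorphB !rmorphD /= -/a0 -/a1 -/a2 in B.
set o0 : R := (o 0)%:~R in B o2 *; set o1 : R := (o 1)%:~R in B o2 *.
set o3 : R := (o 2)%:~R in B o2 *.
move: A B; set LA := (X in 0 <= X); set LB := (X in _ -> 0 <= X -> _) => A B.
(* The terms in x^2 cancel because the orbit point moves along the unit vector [o]. *)
suff claim : forall L, L = (1 - x) * LA + x * LB + (x ^+ 2 - x) * (o0 ^+ 2 + o1 ^+ 2 + o3 ^+ 2 - 1) -> 0 <= L.
  by apply: claim; rewrite /LA /LB; ring.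
by move=> L ->; rewrite o2 subrr mulr0 addr0 addr_ge0 // mulr_ge0 // subr_ge0.
Qed.

(** On an edge of Z^3 the orbit point is at distance x from the end in D3. The first eight points
    lie on the edges at (0,0,0) and (1,0,0) perpendicular to the x-axis; their bisectors with
    (x,0,0), such as y0 = y1 for (0,x,0), do not depend on x. The last four lie on the edges
    bounding the equator. *)
Definition dia_neighbours (R : realType) (x : R) : seq 'rV[R]_3 :=
  [:: vec3 0 x 0; vec3 0 (- x) 0; vec3 0 0 x; vec3 0 0 (- x);
      vec3 1 (1 - x) 0; vec3 1 (x - 1) 0; vec3 1 0 (1 - x); vec3 1 0 (x - 1);
      vec3 (1 / 2) (1 / 2) (1 / 2 - x); vec3 (1 / 2) (1 / 2 - x) (1 / 2);
      vec3 (1 / 2) (- (1 / 2)) (x - 1 / 2); vec3 (1 / 2) (x - 1 / 2) (- (1 / 2))].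

Lemma dia_neighbours_orbit (R : realType) (D : set op) (x : R) s m : admissible D ->
  D = dia_ops 3 m -> s \in dia_neighbours x -> oporbit D (vec3 x 0 0) s.
Proof.
move=> aD DE; have D0 : D one_op by case: aD => [[]].
have Dg : D (dia_glide m) by rewrite DE; right; apply: dia_glideP.
have [_ cg _ _] := dia_glideP m.
have even i b t p : tbcc t -> tcl t = 0 -> p = axis_pt x i b t -> oporbit D (vec3 x 0 0) p.
  by move=> Nt ct ->; apply: (@orbit_axis _ D x one_op); rewrite ?cl_one.
have odd i b t p : tbcc t -> tcl t = 3 -> p = axis_pt x i b t -> oporbit D (vec3 x 0 0) p.
  by move=> Nt ct ->; apply: (@orbit_axis _ D x (dia_glide m)); rewrite ?cg.
rewrite !inE => /or4P[|||/or4P[|||/or4P[|||/or3P[||]]]] /eqP ->;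
  [apply: (even 1 false (vec3z 0 0 0)) | apply: (even 1 true (vec3z 0 0 0))
  |apply: (even 2 false (vec3z 0 0 0)) | apply: (even 2 true (vec3z 0 0 0))
  |apply: (even 1 true (vec3z 2 2 0))  | apply: (even 1 false (vec3z 2 (-2) 0))
  |apply: (even 2 true (vec3z 2 0 2))  | apply: (even 2 false (vec3z 2 0 (-2)))
  |apply: (odd 2 true (vec3z 1 1 1))   | apply: (odd 1 true (vec3z 1 1 1))
  |apply: (odd 2 false (vec3z 1 (-1) (-1)))
  |apply: (odd 1 false (vec3z 1 (-1) (-1)))];
  rewrite /tbcc /tcl /bcc /cl /= ?vec3z_E //; apply: row3P;
  rewrite vec3E mxE vec3z_E /=; by field.
Qed.

(* Symmetries of the orbit that exchange the edges of the two cubic lattices and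
   move one of the last four neighbours to (x,0,0). *)
Definition signop (k : 'I_3) (a b c : bool) : op :=
  Op false k [ffun i : 'I_3 => nth false [:: a; b; c] i] (vec3z 1 1 1).

(** Seen from [s], the points of class 3 are those of its own cubic lattice: the signs of [signop]
    turn class 3 into 3 - 3 = 0. So [axis_nearest] shows that none of them is nearer to [y] than
    [s]. *)
Lemma glide_nearest (R : realType) (x : R) (y s : 'rV[R]_3) k a b c e :
  0 <= x <= 1 -> a (+) b (+) c ->
  act (signop k a b c) s = vec3 x 0 0 -> bipyramid (act (signop k a b c) y) ->
  edist y (vec3 x 0 0) <= edist y s ->
  bcc e -> cl e = 3 -> edist y (vec3 x 0 0) <= edist y (act e (vec3 x 0 0)).
Proof.
move=> x01 abc ds Qd ys Ne ce; apply: le_trans ys _.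
set d := signop k a b c in ds Qd *.
have Nd : bcc d by rewrite /bcc !vec3z_E.
rewrite -(act_isometry d y s) -(act_isometry d y (act e _)) ds -act_mul.
apply: axis_nearest => //; first exact: bcc_mul.
rewrite cl_mul // rho_cl // ce.
have -> : alpha d = true by rewrite /alpha !ffunE.
by rewrite /cl !vec3z_E.
Qed.

Lemma dia_nearest (R : realType) (x : R) (y : 'rV[R]_3) m e : 0 < x < 1 ->
  (forall s, s \in dia_neighbours x -> edist y (vec3 x 0 0) <= edist y s) ->
  dia_ops 3 m e -> edist y (vec3 x 0 0) <= edist y (act e (vec3 x 0 0)).
Proof.
move=> /andP[x0 x1] ny; have x01 : 0 <= x <= 1 by rewrite !ltW.
have E p : dot (y - p) (y - p) = (y 0 0 - p 0 0) ^+ 2 + (y 0 1 - p 0 1) ^+ 2 + (y 0 2 - p 0 2) ^+ 2.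
  by rewrite dotE !mxE; ring.
have Q : bipyramid y.
  have half0 (z w : R) : 0 <= x * (z - w) -> w <= z by rewrite pmulr_rge0 // subr_ge0.
  have half1 (z w : R) : 0 <= (1 - x) * (z - w) -> w <= z.
    by rewrite pmulr_rge0 ?subr_gt0 // subr_ge0.
  have n a b c : vec3 a b c \in dia_neighbours x ->
      (y 0 0 - x) ^+ 2 + (y 0 1 - 0) ^+ 2 + (y 0 2 - 0) ^+ 2 <=
      (y 0 0 - a) ^+ 2 + (y 0 1 - b) ^+ 2 + (y 0 2 - c) ^+ 2.
    by move=> /ny; rewrite eucl_edist_le !E !vec3E.
  split; split.
  - by apply: half0; have := n 0 (- x) 0; rewrite !inE eqxx !orbT => /(_ isT); lra.
  - by apply: half0; have := n 0 x 0; rewrite !inE eqxx => /(_ isT); lra.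
  - by apply: half0; have := n 0 0 (- x); rewrite !inE eqxx !orbT => /(_ isT); lra.
  - by apply: half0; have := n 0 0 x; rewrite !inE eqxx !orbT => /(_ isT); lra.
  - by apply: half1; have := n 1 (x - 1) 0; rewrite !inE eqxx !orbT => /(_ isT); lra.
  - by apply: half1; have := n 1 (1 - x) 0; rewrite !inE eqxx !orbT => /(_ isT); lra.
  - by apply: half1; have := n 1 0 (x - 1); rewrite !inE eqxx !orbT => /(_ isT); lra.
  - by apply: half1; have := n 1 0 (1 - x); rewrite !inE eqxx !orbT => /(_ isT); lra.
move=> [[Ne ce _ _]|[Ne ce _ _]]; first exact: axis_nearest.
have [[q1 q2 q3 q4] [q5 q6 q7 q8]] := Q.
(* The planes y1 = y2 and y1 = -y2 cut the bipyramid into four pieces, each inside the bipyramid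
   around the equatorial edge that it meets. *)
have case4 : [\/ y 0 2 <= y 0 1 /\ - y 0 2 <= y 0 1, y 0 1 <= y 0 2 /\ - y 0 1 <= y 0 2,
    y 0 2 <= - y 0 1 /\ - y 0 2 <= - y 0 1 | y 0 1 <= - y 0 2 /\ - y 0 1 <= - y 0 2].
  have [h|h] := leP (y 0 2) (y 0 1); have [h'|h'] := leP (- y 0 2) (y 0 1).
  - by constructor 1.
  - by constructor 4; split; lra.
  - by constructor 2; split; lra.
  - by constructor 3; split; lra.
have finish k a b c s : a (+) b (+) c -> s \in dia_neighbours x ->
  act (signop k a b c) s = vec3 x 0 0 -> bipyramid (act (signop k a b c) y) ->
  edist y (vec3 x 0 0) <= edist y (act e (vec3 x 0 0)).
  by move=> abc sn ds Qd; apply: (glide_nearest x01 abc ds Qd (ny s sn) Ne ce).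
case: case4 => -[r1 r2];
  [apply: (finish 2 true true true (vec3 (1 / 2) (1 / 2) (1 / 2 - x)))
  |apply: (finish 1 true true true (vec3 (1 / 2) (1 / 2 - x) (1 / 2)))
  |apply: (finish 2 false true false (vec3 (1 / 2) (- (1 / 2)) (x - 1 / 2)))
  |apply: (finish 1 false false true (vec3 (1 / 2) (x - 1 / 2) (- (1 / 2))))];
  first
    [ by []
    | by rewrite !inE eqxx !orbT
    | by apply: row3P; rewrite actE ffunE vec3z_E /osg /dih /= ?I3E !vec3E; lra
    | by rewrite /bipyramid !actE !ffunE !vec3z_E /osg /dih /= ?I3E;
         split; split; lra ].
Qed.

Lemma dia_neighbours_neq (R : realType) (x : R) s : 0 < x < 1 ->
  s \in dia_neighbours x -> s <> vec3 x 0 0.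
Proof.
move=> /andP[x0 x1] sn sx; have ne a b c : s = vec3 a b c -> [/\ a = x, b = 0 & c = 0].
  by move=> sE; move: sx; rewrite sE => /rowP h; have := h 0; have := h 1; have := h 2; rewrite !vec3E.
by move: sn; rewrite !inE => /or4P[|||/or4P[|||/or4P[|||/or3P[||]]]] /eqP /ne []; lra.
Qed.

Lemma full_cubic_dia (R : realType) (G : set ('rV[R]_3 -> 'rV[R]_3)) p :
  full_cubic G -> stabilizer G p <> [set idfun] ->
  ~ (exists (G' : set ('rV[R]_3 -> 'rV[R]_3)) (p' : 'rV[R]_3),
       [/\ crystallographic G', G' <> G, orbit_of G' p' = orbit_of G p &
           card_lt (stabilizer G' p') (stabilizer G p)]) ->
  exists f f' m x, [/\ cubic_coords G f f', coord_ops G f f' = dia_ops 3 m,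
    f p = vec3 x 0 0 & 0 < x < 1].
Proof.
move=> /full_cubic_coords [f0 [f0' cf0]] nt nG.
have [s0 Ss0 s01] := nontrivial_opstab cf0 nt.
have [_ _ _ aD0 _] := cf0.
have [n Nn [x nx]] := stab_normal_form aD0 (minimal_stab_pull cf0 nG) Ss0 s01.
have cf1 := cubic_coords_comp Nn cf0; have mD1 := minimal_stab_pull cf1 nG.
have [s1 Ss1 s11] := nontrivial_opstab cf1 nt.
move: cf1 mD1 Ss1; set f1 := act n \o f0; set f1' := f0' \o _ => cf1 mD1 Ss1.
have [_ _ _ aD1 _] := cf1.
have f1p : f1 p = act n (f0 p) by [].
case: nx => [nx|[nx xh]]; rewrite {}nx in f1p; rewrite f1p in mD1 Ss1; last first.
  by case: (skew_axis_false aD1 mD1 xh Ss1).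
have xn := axis_not_int aD1 mD1.
have [c [m [c13 DE]]] := axis_dia aD1 mD1.
have [f2 [f2' [cf2 DE2 f2p]]] : exists f2 f2', [/\ cubic_coords G f2 f2',
    coord_ops G f2 f2' = dia_ops 3 m & f2 p = vec3 x 0 0].
  case: c13 DE => -> DE; last by exists f1, f1'.
  (* The reflection z -> -z fixes (x,0,0) and turns class 1 into class 3. *)
  pose r := linop false 0 false false true.
  have Nr : bcc r by rewrite /bcc !mxE.
  exists (act r \o f1), (f1' \o act (inv_op r)); split.
  - exact: cubic_coords_comp.
  - by rewrite (coord_ops_dia _ _ _ _ DE) // ?/rho ?mxE // /alpha !linop_oeE.
  - rewrite /= f1p; apply: row3P; rewrite actE linop_oeE /osg /dih /= add0r !vec3E mxE mul0r addr0 //.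
    by rewrite oppr0.
(* An integral translation has even doubled entries and no signs, so class 3 is kept; as x is not an
   integer, it ends up strictly between 0 and 1. *)
pose t := trop (vec3z (- (Num.floor x * 2)) 0 0).
have Nt : bcc t by rewrite /bcc !vec3z_E; lia.
have rt : rho t = false by rewrite /rho vec3z_E; lia.
exists (act t \o f2), (f2' \o act (inv_op t)), m, (x - (Num.floor x)%:~R); split.
- exact: cubic_coords_comp.
- by rewrite (coord_ops_dia _ _ _ _ DE2) // /alpha !ffunE.
- rewrite /= f2p; apply: row3P; rewrite actE ffunE osg_trop !vec3E vec3z_E ?mul0r ?addr0 //.
  by rewrite rmorphN /= intrM; field.
- rewrite subr_gt0 ltrBlDr lt_neqAle floor_le andbT.
  apply/andP; split; first by apply/eqP => h; apply: (xn (Num.floor x)).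
  by rewrite addrC -[1 in X in _ + X]/(1%:~R) -intrD floorD1_gt.
Qed.

Lemma facets_dia (R : realType) (G : set ('rV[R]_3 -> 'rV[R]_3)) f f' m x p q :
  cubic_coords G f f' -> coord_ops G f f' = dia_ops 3 m -> f p = vec3 x 0 0 ->
  0 < x < 1 -> orbit_of G p q ->
  (facets (voronoi_cell (orbit_of G p) q) #<= `I_12)%card.
Proof.
move=> cf DE fp x01 Sq; have [fs ff' f'f aD GE] := cf.
have [[D1 DM DV] FD ND] := aD.
have SE : orbit_of G p = f' @` oporbit (coord_ops G f f') (vec3 x 0 0).
  by rewrite {1}GE orbit_pull fp.
move: Sq; rewrite SE => -[_ [d Dd <-] <-].
pose s (i : 'I_12) := f' (act d (dia_neighbours x)`_i).
have sn (i : 'I_12) : (dia_neighbours x)`_i \in dia_neighbours x by apply: mem_nth.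
apply: (@facets_voronoi_le _ _ _ 11 s).
- move=> i; exists (act d (dia_neighbours x)`_i) => //.
  have [e De <-] := dia_neighbours_orbit aD DE (sn i).
  by exists (mul_op d e); [exact: DM | rewrite act_mul].
- move=> i /(can_inj f'f) /(can_inj (act_inv d)); exact: dia_neighbours_neq.
move=> y yn _ [_ [e De <-] <-].
have [k k0 fk] := fs.
(* Coordinates in which the given orbit point sits at (x,0,0); they multiply distances by [k]. *)
pose h z := act (inv_op d) (f z).
have hd z w : edist (h z) (h w) = k * edist z w by rewrite /h act_isometry fk.
have hs w : h (f' (act d w)) = w by rewrite /h f'f act_inv.
rewrite -(ler_pM2l k0) -!hd hs /h f'f -act_mul.
have De' : dia_ops 3 m (mul_op (inv_op d) e) by rewrite -DE; apply: DM => //; apply: DV.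
apply: dia_nearest De' => // w /(nthP 0) [i lti <-].
rewrite -/(h y) -[X in edist _ X <= _]hs -[X in _ <= edist _ X]hs !hd ler_pM2l //.
exact: (yn (Ordinal lti)).
Qed.

Theorem theoremA5 (R : realType) (G : set ('rV[R]_3 -> 'rV[R]_3))
    (p : 'rV[R]_3)
    (fullG : full_cubic G)
    (nontrivial_stab : stabilizer G p <> [set idfun])
    (no_smaller_stab :
       ~ exists (G' : set ('rV[R]_3 -> 'rV[R]_3)) (p' : 'rV[R]_3),
           [/\ crystallographic G', G' <> G, orbit_of G' p' = orbit_of G p &
               card_lt (stabilizer G' p') (stabilizer G p)]) :
  (same_type G (F4132 R) \/ same_type G (Fd3bar R)) /\
  forall q, orbit_of G p q ->
    (facets (voronoi_cell (orbit_of G p) q) #<= `I_12)%card.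
Proof.
have [f [f' [m [x [cf DE fp x01]]]]] := full_cubic_dia fullG nontrivial_stab no_smaller_stab.
split; last by move=> q; apply: facets_dia cf DE fp x01.
by have := same_type_dia cf DE; case: m {DE}; [left | right].
Qed.
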